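(* Let $\xi\in L^2(\Omega,\mathcal F_T,\mathbb P;\mathbb R)$ and let $f:\Omega\times[0,T]\times\mathbb R\to\mathbb R$ (a driver independent of $z$) be such that for each $y$ the process $f(\cdot,\cdot,y)$ is $\mathbb F$-predictable. Let $(\tilde Y,\tilde Z,\tilde O)\in\mathcal S^2_{\mathcal F}(0,T)\times\mathcal M^2_{\mathcal F}(0,T)\times\mathcal L^2_{\mathcal F}(0,T)$ be a solution of the BSDE under complete information $$\tilde Y_t=\xi+\int_t^T f(s,\tilde Y_{s-})\,d\langle M\rangle_s-\int_t^T\tilde Z_s\,dM_s-(\tilde O_T-\tilde O_t),\quad 0\le t\le T,$$ where $\tilde O$ is strongly orthogonal to $M$. Set $L_t:=\int_0^t\tilde Z_s\,d\langle M\rangle_s$ for $t\in[0,T]$. Then the triplet $$(Y,Z,O)=\Big(\tilde Y,\ \frac{dL^{\mathbb H}}{d\langle M\rangle^{\mathbb H}},\ \tilde O+B\Big),$$ where $B=\int(\tilde Z_s-Z_s)\,dM_s$ is a square-integrable $\mathbb F$-martingale weakly orthogonal to $M$, is a solution under partial information of the BSDE $$Y_t=\xi+\int_t^T f(s,Y_{s-})\,d\langle M\rangle_s-\int_t^T Z_s\,dM_s-(O_T-O_t),\quad 0\le t\le T,$$ that is, it satisfies this equation, $(Y,Z,O)\in\mathcal S^2_{\mathcal F}(0,T)\times\mathcal M^2_{\mathcal H}(0,T)\times\mathcal L^2_{\mathcal F}(0,T)$, and $O$ is weakly orthogonal to $M$.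
   Context: $T\in(0,\infty)$ is fixed. $(\Omega,\mathcal F,\mathbb P)$ is a probability space with two filtrations $\mathbb F=(\mathcal F_t)_{0\le t\le T}$ and $\mathbb H=(\mathcal H_t)_{0\le t\le T}$, both satisfying the usual conditions, with $\mathcal F=\mathcal F_T$ and $\mathcal H_t\subseteq\mathcal F_t$ for all $t$. $M$ is a real-valued square-integrable càdlàg $\mathbb F$-martingale with $\mathbb F$-predictable quadratic variation $\langle M\rangle$. Spaces: - $\mathcal S^2_{\mathcal F}(0,T)$: càdlàg $\mathbb F$-adapted processes $\phi$ with $\mathbb E[\sup_{0\le t\le T}|\phi_t|^2]<\infty$. - $\mathcal M^2_{\mathcal H}(0,T)$ (resp. $\mathcal M^2_{\mathcal F}(0,T)$): $\mathbb H$-predictable (resp. $\mathbb F$-predictable) processes $\varphi$ with $\mathbb E[\int_0^T|\varphi_s|^2\,d\langle M\rangle_s]<\infty$. - $\mathcal L^2_{\mathcal F}(0,T)$: $\mathbb F$-martingales $\psi$ with $\psi_0=0$ and $\mathbb E[\psi_T^2]<\infty$. A martingale $\tilde O$ is strongly orthogonal to $M$ if $\langle\tilde O,M\rangle_t=0$ $\mathbb P$-a.s. for every $t\in[0,T]$. A square-integrable $\mathbb F$-martingale $O$ is weakly orthogonal to $M$ if $\mathbb E\big[O_T\int_0^T\varphi_t\,dM_t\big]=0$ for all $\varphi\in\mathcal M^2_{\mathcal H}(0,T)$. The $\mathbb H$-predictable dual projection of a càdlàg $\mathbb F$-adapted process $G$ of integrable variation is the unique $\mathbb H$-predictable process $G^{\mathbb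 H}$ of integrable variation with $\mathbb E[\int_0^T\varphi_s\,dG^{\mathbb H}_s]=\mathbb E[\int_0^T\varphi_s\,dG_s]$ for every bounded $\mathbb H$-predictable $\varphi$. $L^{\mathbb H}$ and $\langle M\rangle^{\mathbb H}$ denote the $\mathbb H$-predictable dual projections of $L$ and $\langle M\rangle$; $L^{\mathbb H}$ is absolutely continuous with respect to $\langle M\rangle^{\mathbb H}$, and $Z=dL^{\mathbb H}/d\langle M\rangle^{\mathbb H}$ denotes the $\mathbb H$-predictable Radon–Nikodým density, i.e. $L^{\mathbb H}_t=\int_0^t Z_s\,d\langle M\rangle^{\mathbb H}_s$. *)

(* Defs.v *)
From HB Require Import structures.
From mathcomp Require Import all_boot all_order all_algebra.
From mathcomp Require Import all_classical all_reals all_analysis.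

Set Implicit Arguments.
Unset Strict Implicit.
Unset Printing Implicit Defensive.

Import Order.TTheory GRing.Theory Num.Theory.
Import numFieldNormedType.Exports.

Local Open Scope classical_set_scope.
Local Open Scope ring_scope.

Section paths.
Context {R : realType} (T : R).
Implicit Types g h : R -> R.

(* Right-continuity on [0, T[ and left limits on ]0, T]; the values of a path
   outside [0, T] are irrelevant everywhere in this file. *)
Definition cadlag_path g : Prop :=
  (forall t, 0 <= t < T -> g r @[r --> t^'+] --> g t) /\
  (forall t, 0 < t <= T -> cvg (g r @[r --> t^'-])).

Definition left_limit g (t : R) : R := lim (g r @[r --> t^'-]).

Definition stopped g (t : R) : R := g (Num.max 0 (Num.min t T)).

Definition cumulative_of g
    (Hg : nondecreasing g /\ right_continuous g) : R -> R := g.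

HB.instance Definition _ g (Hg : nondecreasing g /\ right_continuous g) :=
  isCumulative.Build R _ R (cumulative_of Hg) (proj1 Hg) (proj2 Hg).

(* The measure dg on ]0, T], for g nondecreasing and right-continuous on
   [0, T] (junk value 0 otherwise). *)
Definition stieltjes g : {measure set (measurableTypeR R) -> \bar R} :=
  match pselect (nondecreasing (stopped g) /\ right_continuous (stopped g)) with
  | left Hg => lebesgue_stieltjes_measure (cumulative_of Hg)
  | right _ => mzero
  end.

(* Jordan decomposition dg = dg^+ - dg^- of a right-continuous g of bounded
   variation on [0, T]. *)
Definition stieltjes_pos g := stieltjes (fine \o pos_tv 0 g).
Definition stieltjes_neg g := stieltjes (fine \o neg_tv 0 g).

Definition bv_integrable h g : Prop :=
  (stieltjes_pos g).-integrable `]0, T] (EFin \o h) /\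
  (stieltjes_neg g).-integrable `]0, T] (EFin \o h).

(* \int_]0, t] h dg *)
Definition bv_integral h g (t : R) : R :=
  Rintegral (stieltjes_pos g) `]0, t] h - Rintegral (stieltjes_neg g) `]0, t] h.

End paths.

Section processes.
Context {R : realType} {d : measure_display} {Omega : measurableType d}.
Variables (P : probability Omega R) (T : R).

Definition process := R -> Omega -> R.

Definition filtration := R -> set (set Omega).

Implicit Types (F H : filtration) (X Y A G M N qM phi : process).

Definition is_filtration F : Prop :=
  [/\ forall t, 0 <= t <= T -> sigma_algebra setT (F t),
      forall t, 0 <= t <= T -> F t `<=` measurable
    & forall s t, 0 <= s -> s <= t -> t <= T -> F s `<=` F t].

Definition usual_conditions F : Prop :=
  [/\ is_filtration F,
      (forall N : set Omega, P.-negligible N -> F 0 N)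
    & forall t, 0 <= t < T -> F t = \bigcap_(s in `]t, T]) F s].

Definition adapted F X : Prop :=
  forall t, 0 <= t <= T ->
  forall B : set R, measurable B -> F t (X t @^-1` B).

Definition cadlag X : Prop := forall w, cadlag_path T (X ^~ w).

Definition predictable_rectangles F : set (set (R * Omega)) :=
  [set C | (exists2 A : set Omega, F 0 A & C = [set 0] `*` A) \/
           (exists s t (A : set Omega), [/\ 0 <= s, s < t, t <= T, F s A
                            & C = `]s, t] `*` A])].

Definition predictable_sigma_algebra F : set (set (R * Omega)) :=
  <<s `[0, T] `*` setT, predictable_rectangles F >>.

Definition predictable F X : Prop :=
  forall B : set R, measurable B ->
  predictable_sigma_algebra F
    ((`[0, T] `*` setT) `&` [set u | B (X u.1 u.2)]).

(* The last clause is E[X_t | F_s] = X_s. *)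
Definition martingale F X : Prop :=
  [/\ adapted F X, cadlag X,
      forall t, 0 <= t <= T -> P.-integrable setT (EFin \o X t)
    & forall s t, 0 <= s -> s <= t -> t <= T -> forall A : set Omega, F s A ->
      (\int[P]_(w in A) (X t w)%:E = \int[P]_(w in A) (X s w)%:E)%E].

Definition square_integrable_martingale F X : Prop :=
  martingale F X /\
  forall t, 0 <= t <= T -> ('E_P[(fun w => (X t w) ^+ 2)%R] < +oo)%E.

Definition integrable_variation A : Prop :=
  (forall w, bounded_variation 0 T (A ^~ w)) /\
  (\int[P]_w total_variation 0 T (A ^~ w) < +oo)%E.

(* A = <X, Y> *)
Definition is_predictable_covariation F X Y A : Prop :=
  [/\ predictable F A, cadlag A, integrable_variation A,
      forall w, A 0 w = 0
    & martingale F (fun t w => X t w * Y t w - A t w)].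

(* qM = <M> *)
Definition is_predictable_quadratic_variation F M qM : Prop :=
  is_predictable_covariation F M M qM /\
  forall w s t, 0 <= s -> s <= t -> t <= T -> qM s w <= qM t w.

Definition strongly_orthogonal F X M : Prop :=
  exists A, is_predictable_covariation F X M A /\
  forall t, 0 <= t <= T -> {ae P, forall w, A t w = 0}.

Definition qv_measure qM (w : Omega) := stieltjes T (qM ^~ w).

(* E[\int_0^T |phi_s|^2 d<M>_s] *)
Definition M2_normsq qM phi : \bar R :=
  (\int[P]_w \int[qv_measure qM w]_(s in `]0%R, T]) ((phi s w) ^+ 2)%:E)%E.

Definition in_S2 F X : Prop :=
  [/\ cadlag X, adapted F X
    & (\int[P]_w ereal_sup [set ((X t w) ^+ 2)%:E | t in `[0%R, T]]
       < +oo)%E].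

Definition in_M2 F qM phi : Prop :=
  predictable F phi /\ (M2_normsq qM phi < +oo)%E.

Definition in_L2 F X : Prop :=
  [/\ martingale F X, {ae P, forall w, X 0 w = 0}
    & ('E_P[(fun w => (X T w) ^+ 2)%R] < +oo)%E].

(* A list of triples ((s_i, t_i), x_i) stands for the elementary predictable
   process \sum_i x_i 1_]s_i, t_i]. *)
Definition elementary := seq ((R * R) * (Omega -> R)).

Definition elementary_wf F (e : elementary) : Prop :=
  forall p, p \in e ->
  [/\ 0 <= p.1.1, p.1.1 <= p.1.2, p.1.2 <= T,
      forall B : set R, measurable B -> F p.1.1 (p.2 @^-1` B)
    & exists K : R, forall w, `|p.2 w| <= K].

Definition elementary_process (e : elementary) : process := fun t w =>
  \sum_(p <- e) p.2 w * (p.1.1 < t <= p.1.2)%R%:R.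

Definition elementary_integral M (e : elementary) : process := fun t w =>
  \sum_(p <- e) p.2 w * (M (Num.min p.1.2 t) w - M (Num.min p.1.1 t) w).

(* N = \int phi dM, by L^2-extension of the integral of elementary processes *)
Definition is_stochastic_integral F M qM phi N : Prop :=
  [/\ square_integrable_martingale F N, forall w, N 0 w = 0
    & exists e : nat -> elementary,
      [/\ forall n, elementary_wf F (e n),
          M2_normsq qM (fun t w => elementary_process (e n) t w - phi t w)
            @[n --> \oo] --> 0%E
        & 'E_P[(fun w => (elementary_integral M (e n) T w - N T w) ^+ 2)%R]%E
            @[n --> \oo] --> 0%E]].

(* For phi in M^2_F such an N exists and is unique up to indistinguishability;
   a version is chosen. *)
Definition stochastic_integral F M qM phi : process :=
  xget (fun _ _ => 0) [set N | is_stochastic_integral F M qM phi N].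

(* F is the filtration of the martingales, H the smaller one *)
Definition weakly_orthogonal F H M qM X : Prop :=
  forall phi, in_M2 H qM phi ->
  ('E_P[(fun w => X T w * stochastic_integral F M qM phi T w)%R] = 0)%E.

(* t |-> \int_0^t phi_s d<M>_s *)
Definition qv_integral qM phi : process := fun t w =>
  Rintegral (qv_measure qM w) `]0, t] (phi ^~ w).

(* GH is the H-predictable dual projection of G (itself supposed cadlag and of
   integrable variation, at least outside a null set). *)
Definition is_dual_projection H G GH : Prop :=
  [/\ predictable H GH, cadlag GH, integrable_variation GH,
      forall w, GH 0 w = 0
    & forall phi, predictable H phi ->
      (exists K : R, forall t w, 0 <= t <= T -> `|phi t w| <= K) ->
      ('E_P[(fun w => bv_integral T (phi ^~ w) (GH ^~ w) T)%R] =
       'E_P[(fun w => bv_integral T (phi ^~ w) (G ^~ w) T)%R])%E].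

(* Z = dA/dG as an H-predictable density *)
Definition is_density H A G Z : Prop :=
  predictable H Z /\
  {ae P, forall w, bv_integrable T (Z ^~ w) (G ^~ w) /\
    forall t, 0 <= t <= T ->
    A t w = bv_integral T (Z ^~ w) (G ^~ w) t}.

(* The equation Y_t = xi + \int_t^T f(s, Y_{s-}) d<M>_s - \int_t^T Z_s dM_s
   - (O_T - O_t), up to indistinguishability, including that the Stieltjes
   integral makes sense. *)
Definition bsde_equation F M qM (xi : Omega -> R) (f : Omega -> R -> R -> R)
    Y Z O : Prop :=
  {ae P, forall w,
    (qv_measure qM w).-integrable `]0, T]
      (fun s => (f w s (left_limit (Y ^~ w) s))%:E) /\
    forall t, 0 <= t <= T ->
    Y t w = xi w
      + Rintegral (qv_measure qM w) `]t, T]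
          (fun s => f w s (left_limit (Y ^~ w) s))
      - (stochastic_integral F M qM Z T w - stochastic_integral F M qM Z t w)
      - (O T w - O t w)}.

Definition solution_complete_info F M qM xi f Y Z O : Prop :=
  [/\ in_S2 F Y, in_M2 F qM Z, in_L2 F O,
      bsde_equation F M qM xi f Y Z O
    & strongly_orthogonal F O M].

Definition solution_partial_info F H M qM xi f Y Z O : Prop :=
  [/\ in_S2 F Y, in_M2 H qM Z, in_L2 F O,
      bsde_equation F M qM xi f Y Z O
    & weakly_orthogonal F H M qM O].

End processes.

Arguments process R {d} Omega.
Arguments filtration R {d} Omega.

(* Main.v *)
(** The density [Z] is an orthogonal projection in disguise. Let [mu] be the
    measure [P(dw) d<M>_s(w)] on the predictable sets of [F]. The duality defining
    [L^H] and [<M>^H] gives [mu(phi Zt) = mu(phi Z)] for every bounded H-predictable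
    [phi] with [phi Z] bounded. Taking [phi = Z 1_{|Z| <= n}] yields
    [mu(Z^2 1_{|Z| <= n}) <= mu(Zt^2)], so [Z] is in [M^2_H]; by truncation
    [Zt - Z] is then orthogonal in [L^2(mu)] to all of [M^2_H], and by Ito's isometry
    [int (Zt - Z) dM] is weakly orthogonal to [M]. The equation follows by
    linearity of the stochastic integral.

    Every integrand of [M^2_F] has a stochastic integral because elementary
    processes are dense in [L^2(mu)] and a rapidly converging sequence of elementary
    integrals converges uniformly in time almost surely, by Doob's maximal
    inequality and Borel-Cantelli. *)

Require Import Defs.
From HB Require Import structures.
From mathcomp Require Import all_boot all_order all_algebra.
From mathcomp Require Import all_classical all_reals all_analysis.
From mathcomp Require Import ring lra measurable_realfun.

Set Implicit Arguments.
Unset Strict Implicit.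
Unset Printing Implicit Defensive.

Import Order.TTheory GRing.Theory Num.Theory.
Import numFieldNormedType.Exports.

Local Open Scope classical_set_scope.
Local Open Scope ring_scope.

(** * Square-integrable functions *)

(** Three features of the definitions shape the proof. A dual projection is known only through
    expectations of [bv_integral], a difference of integrals against two variation measures, while
    L^2(mu) is built from the Stieltjes measure of the nondecreasing <M>. The bridge is a uniqueness
    principle: a linear functional of bounded Borel functions, continuous under bounded pointwise
    convergence and carried by ]0, T], is determined by its values on the intervals ]0, t]. Those
    expectations are taken of functions of w whose measurability is not established, and the density
    relation and the integrability of Zt along the paths hold only almost surely, so integrals are
    compared through almost everywhere equality alone. Finally, stochastic integrals are chosen
    versions, a priori unrelated for different integrands: the isometry makes a linear combination
    vanish at T in L^2, and a martingale that vanishes at T almost surely vanishes on all of [0, T]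
    by the maximal inequality. Conditional expectations never appear; the martingale property, given
    on sets of F_s, is extended to F_s-measurable test functions. *)

Section bounded_induction.
Context {R : realType} (U : Type).
Implicit Types (f g : U -> R).

(** The range lies in an interval cut into 2N cells of length e, and on each cell f is replaced by
    its left end. The B i are sets of values, so the approximant combines indicators of preimages
    under f and is measurable for any sigma-algebra that makes f measurable. *)
Lemma level_set_approx f (K e : R) : 0 < e -> (forall x, `|f x| <= K) ->
  exists n (c : 'I_n -> R) (B : 'I_n -> set R), (forall i, measurable (B i)) /\
  forall x, `|f x - \sum_(i < n) c i * \1_(B i) (f x)| <= e.
Proof.
move=> e0 fK; pose N := (Num.trunc (K / e)).+1.
pose c (i : nat) : R := (i%:R - N%:R) * e.
exists (N + N)%N, (fun i => c i), (fun i => `[c i, c i.+1[%classic); split.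
  by move=> i; exact: measurable_itv.
move=> x; have K0 : 0 <= K by apply: le_trans (fK x).
have KN : K / e < N%:R by rewrite /N; have/andP[] := truncn_itv (divr_ge0 K0 (ltW e0)).
have fKx := fK x; rewrite ler_norml in fKx.
pose y := f x / e + N%:R.
have fN : `|f x / e| < N%:R.
  rewrite normrM normfV (gtr0_norm e0); apply: le_lt_trans KN.
  by rewrite ler_pM2r ?invr_gt0.
have y0 : 0 <= y by move: fN; rewrite ltr_norml /y => /andP[? _]; lra.
have/andP[jy yj] := truncn_itv y0.
have jN : (Num.trunc y < N + N)%N.
  rewrite -(ltr_nat R); apply: le_lt_trans jy _.
  by move: fN; rewrite ltr_norml /y natrD => /andP[_ ?]; lra.
pose j := Ordinal jN.
have cj : c j <= f x < c j.+1.
  have -> : f x = (y - N%:R) * e by rewrite /y addrK divfK ?gt_eqF.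
  by rewrite /c ler_pM2r// ltr_pM2r// lerD2r ltrD2r jy yj.
rewrite (bigD1 j)//= indicE mem_set; last by rewrite /= in_itv.
rewrite mulr1 big1; last first.
  move=> i ij; rewrite indicE memNset ?mulr0//= in_itv/= => /andP[c1 c2].
  move/eqP: ij; apply; apply/val_inj/eqP; rewrite eqn_leq /=.
  move/andP: cj => [c3 c4].
  have := le_lt_trans c1 c4; have := le_lt_trans c3 c2.
  by rewrite /c !ltr_pM2r// !ltrD2r !ltr_nat !ltnS => -> ->.
rewrite addr0 ger0_norm; first by move/andP: cj; rewrite /c -natr1; lra.
by move/andP: cj; rewrite subr_ge0 => -[].
Qed.

(** A monotone class principle reduced to level sets of f, linear combinations and one uniform
    limit. With no sigma-algebra fixed on U, it serves F_s-measurable, predictable and Borel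
    functions alike. *)
Lemma bounded_ind (Pr : (U -> R) -> Prop) f (K : R) :
  (forall x, `|f x| <= K) ->
  Pr (fun _ => 0) ->
  (forall c g h, Pr g -> Pr h -> Pr (fun x => c * g x + h x)) ->
  (forall B, measurable B -> Pr (fun x => \1_B (f x))) ->
  ((forall e, 0 < e -> exists g, Pr g /\ forall x, `|f x - g x| <= e) -> Pr f) ->
  Pr f.
Proof.
move=> fK P0 PD P1; apply => e e0.
have [n [c [B [mB H]]]] := level_set_approx e0 fK.
eexists; split; last exact: H.
elim: n c B mB {H} => [|n IH] c B mB.
  by rewrite (_ : (fun _ => _) = (fun _ => 0))//; apply/funext => x; rewrite big_ord0.
rewrite (_ : (fun _ => _) = (fun x => c ord0 * \1_(B ord0) (f x) +
    \sum_(i < n) c (lift ord0 i) * \1_(B (lift ord0 i)) (f x))); last first.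
  by apply/funext => x; rewrite big_ord_recl.
apply: PD; first exact: P1.
exact: (IH (fun i => c (lift ord0 i)) (fun i => B (lift ord0 i))).
Qed.

End bounded_induction.

Notation intble mu f := (mu.-integrable setT (EFin \o f)).

Section L2.
Context {d} {T : measurableType d} {R : realType}.
Variable mu : {measure set T -> \bar R}.
Implicit Types (f g h : T -> R).

Lemma EFin_Rintegral f : intble mu f -> (\int[mu]_x f x)%:E = (\int[mu]_x (f x)%:E)%E.
Proof. by move=> ifx; rewrite /Rintegral fineK//; exact: integrable_fin_num. Qed.

Lemma intbleD f g : intble mu f -> intble mu g -> intble mu (fun x => f x + g x).
Proof. by move=> ? ?; apply: (@integrableD _ _ _ mu setT measurableT (EFin \o f) (EFin \o g)). Qed.

Lemma intbleB f g : intble mu f -> intble mu g -> intble mu (fun x => f x - g x).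
Proof. by move=> ? ?; apply: (@integrableB _ _ _ mu setT measurableT (EFin \o f) (EFin \o g)). Qed.

Lemma intbleZ c f : intble mu f -> intble mu (fun x => c * f x).
Proof. by move=> ?; apply: (@integrableZl _ _ _ mu setT measurableT c (EFin \o f)). Qed.

Lemma measurable_intble f : intble mu f -> measurable_fun setT f.
Proof. by move=> /(measurable_int mu)/measurable_EFinP. Qed.

Lemma intble_norm f : intble mu f -> intble mu (fun x => `|f x|).
Proof. by move=> ?; apply: integrable_norm. Qed.

Lemma le_intble f g : measurable_fun setT f -> (forall x, `|f x| <= g x) ->
  intble mu g -> intble mu f.
Proof.
move=> mf fg ig; apply: (@le_integrable _ _ _ mu setT measurableT _ (EFin \o g)) => //.
  exact/measurable_EFinP.
by move=> x _ /=; rewrite lee_fin (le_trans (fg x))// ler_norm.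
Qed.

Lemma intble_bM (Y : T -> R) f (K : R) : measurable_fun setT Y -> (forall x, `|Y x| <= K) ->
  intble mu f -> intble mu (fun x => Y x * f x).
Proof.
move=> mY YK ifx; apply: (@le_intble _ (fun x => K * `|f x|)).
- by apply: measurable_funM => //; exact: measurable_intble.
- by move=> x; rewrite normrM ler_wpM2r.
- exact/intbleZ/intble_norm.
Qed.

Lemma intble_bnd f (K : R) : (mu setT < +oo)%E -> measurable_fun setT f ->
  (forall x, `|f x| <= K) -> intble mu f.
Proof.
move=> mufin mf fK; apply: measurable_bounded_integrable => //.
exists K; split; first exact: num_real.
by move=> x Kx y _; exact: le_trans (fK y) (ltW Kx).
Qed.

Definition sqi f := measurable_fun setT f /\ (\int[mu]_x ((f x) ^+ 2)%:E < +oo)%E.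

Lemma sqiP f : sqi f <-> measurable_fun setT f /\ intble mu (fun x => f x ^+ 2).
Proof.
split=> -[mf H]; split=> //.
  apply/integrableP; split; first exact/measurable_EFinP/measurable_funX.
  by under eq_integral do rewrite /= ger0_norm ?sqr_ge0//.
have/integrableP[_] := H.
by under eq_integral do rewrite /= ger0_norm ?sqr_ge0//.
Qed.

Lemma sqi_sqr f : sqi f -> intble mu (fun x => f x ^+ 2).
Proof. by move=> /sqiP[]. Qed.

Lemma sqi_M f g : sqi f -> sqi g -> intble mu (fun x => f x * g x).
Proof.
move=> /sqiP[mf sf] /sqiP[mg sg].
apply: (@le_intble _ (fun x => f x ^+ 2 + g x ^+ 2)); last exact: intbleD.
  exact: measurable_funM.
move=> x; rewrite normrM -[f x ^+ 2]real_normK ?num_real// -[g x ^+ 2]real_normK ?num_real//.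
have := sqr_ge0 (`|f x| - `|g x|); have := normr_ge0 (f x); have := normr_ge0 (g x).
by nra.
Qed.

Lemma sqiZ c f : sqi f -> sqi (fun x => c * f x).
Proof.
move=> /sqiP[mf sf]; apply/sqiP; split; first exact: measurable_funM.
by under eq_fun do rewrite exprMn; exact: intbleZ.
Qed.

Lemma sqiD f g : sqi f -> sqi g -> sqi (fun x => f x + g x).
Proof.
move=> sf sg; have ifg := sqi_M sf sg; move: sf sg => /sqiP[mf sf] /sqiP[mg sg].
apply/sqiP; split; first exact: measurable_funD.
rewrite (_ : (fun x => _) = (fun x => f x ^+ 2 + g x ^+ 2 + 2 * (f x * g x))).
  by apply: intbleD; [exact: intbleD|exact: intbleZ].
by apply/funext => x; ring.
Qed.

Lemma sqiB f g : sqi f -> sqi g -> sqi (fun x => f x - g x).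
Proof.
move=> sf sg; have := sqiD sf (sqiZ (-1) sg).
by under eq_fun do rewrite mulN1r.
Qed.

Lemma sqi_bM (Y : T -> R) f (K : R) : measurable_fun setT Y -> (forall x, `|Y x| <= K) ->
  sqi f -> sqi (fun x => Y x * f x).
Proof.
move=> mY YK /sqiP[mf sf]; apply/sqiP; split; first exact: measurable_funM.
under eq_fun do rewrite exprMn.
apply: (@intble_bM (fun x => Y x ^+ 2) _ (K ^+ 2)) => //; first exact: measurable_funX.
by move=> x; rewrite normrX lerXn2r ?nnegrE// (le_trans _ (YK x)).
Qed.

Lemma le_sqi f g : measurable_fun setT f -> (forall x, `|f x| <= `|g x|) -> sqi g -> sqi f.
Proof.
move=> mf fg /sqiP[mg sg]; apply/sqiP; split=> //.
apply: le_intble sg; first exact: measurable_funX.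
move=> x; rewrite normrX -[g x ^+ 2]real_normK ?num_real//.
by rewrite lerXn2r ?nnegrE.
Qed.

Lemma sqi_bnd f (K : R) : (mu setT < +oo)%E -> measurable_fun setT f ->
  (forall x, `|f x| <= K) -> sqi f.
Proof.
move=> mufin mf fK; apply: (@le_sqi _ (fun=> K)) => //.
  by move=> x; rewrite (le_trans (fK x))// ler_norm.
split; first exact: measurable_cst.
by rewrite (integral_cst _ measurableT) lte_mul_pinfty// lee_fin sqr_ge0.
Qed.

Lemma intble_of_sqi f : (mu setT < +oo)%E -> sqi f -> intble mu f.
Proof.
move=> mufin sf; have s1 : sqi (fun=> 1) by apply: (@sqi_bnd _ 1) => // x; rewrite normr1.
by have := sqi_M sf s1; under eq_fun do rewrite mulr1.
Qed.

(** Squared L^2 norm as a real number, with the junk value 0 when the integral is infinite; a bound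
    on it carries information only together with [sqi]. *)
Definition nsq f := \int[mu]_x (f x ^+ 2).

Lemma nsq_ge0 f : 0 <= nsq f.
Proof. by apply: Rintegral_ge0 => x _; exact: sqr_ge0. Qed.

Lemma EFin_nsq f : sqi f -> (nsq f)%:E = (\int[mu]_x (f x ^+ 2)%:E)%E.
Proof. by move=> /sqi_sqr/EFin_Rintegral. Qed.

Lemma nsqZ c f : sqi f -> nsq (fun x => c * f x) = c ^+ 2 * nsq f.
Proof.
move=> sf; rewrite /nsq -RintegralZl//; last exact: sqi_sqr.
by apply: eq_Rintegral => x _; rewrite exprMn.
Qed.

Lemma nsq_D f g : sqi f -> sqi g ->
  nsq (fun x => f x + g x) = nsq f + 2 * \int[mu]_x (f x * g x) + nsq g.
Proof.
move=> sf sg; have ifg := sqi_M sf sg; have := sqi_sqr sf; have := sqi_sqr sg => ig i_f.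
rewrite /nsq -RintegralZl// -!RintegralD//.
- by apply: eq_Rintegral => x _; ring.
- by apply: intbleD => //; exact: intbleZ.
- exact: intbleZ.
Qed.

Lemma nsq_B f g : sqi f -> sqi g ->
  nsq (fun x => f x - g x) = nsq f - 2 * \int[mu]_x (f x * g x) + nsq g.
Proof.
move=> sf sg; have := nsq_D sf (sqiZ (-1) sg).
under [X in nsq X]eq_fun do rewrite mulN1r.
move=> ->; rewrite nsqZ//.
under [X in _ + 2 * X]eq_Rintegral do rewrite mulrCA.
rewrite RintegralZl//; last exact: sqi_M.
ring.
Qed.

Lemma nsqB_le f g : sqi f -> sqi g ->
  nsq (fun x => f x - g x) <= 2 * nsq f + 2 * nsq g.
Proof.
move=> sf sg; have := nsq_D sf sg; have := nsq_B sf sg.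
have := nsq_ge0 (fun x => f x + g x); have := nsq_ge0 (fun x => f x - g x). lra.
Qed.

Lemma nsqD_le f g : sqi f -> sqi g ->
  nsq (fun x => f x + g x) <= 2 * nsq f + 2 * nsq g.
Proof.
move=> sf sg; have := nsq_D sf sg; have := nsq_B sf sg.
have := nsq_ge0 (fun x => f x + g x); have := nsq_ge0 (fun x => f x - g x). lra.
Qed.

Lemma nsq_subrr f : nsq (fun x => f x - f x) = 0.
Proof.
rewrite /nsq (@eq_Rintegral _ _ _ mu setT (fun=> 0)) ?Rintegral_cst ?mul0r//.
by move=> x _; rewrite subrr expr0n.
Qed.

(** The quadratic t -> nsq (f + t g) is nonnegative. It is evaluated at its minimum if nsq g > 0; if
    nsq g = 0 it is affine in t, and a nonzero slope would let it take the value -1. *)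
Lemma cauchy_schwarz f g : sqi f -> sqi g ->
  (\int[mu]_x (f x * g x)) ^+ 2 <= nsq f * nsq g.
Proof.
move=> sf sg; set I := Rintegral _ _ _.
have H t : 0 <= nsq f + 2 * t * I + t ^+ 2 * nsq g.
  have := nsq_ge0 (fun x => f x + t * g x); rewrite nsq_D//; last exact: sqiZ.
  rewrite nsqZ//; under [X in _ + 2 * X]eq_Rintegral do rewrite mulrCA.
  rewrite RintegralZl//; first by rewrite mulrA.
  exact: sqi_M.
have [B0|B0] := eqVneq (nsq g) 0.
  rewrite B0 mulr0; have [->|I0] := eqVneq I 0; first by rewrite expr0n.
  have := H (- (nsq f + 1) / (2 * I)); rewrite B0 mulr0 addr0.
  rewrite (_ : 2 * _ * I = - (nsq f + 1)); last by field.
  by lra.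
have B1 : 0 < nsq g by rewrite lt0r B0 nsq_ge0.
have := H (- I / nsq g).
rewrite (_ : _ + _ + _ = nsq f - I ^+ 2 / nsq g); last by field.
by rewrite subr_ge0 ler_pdivrMr.
Qed.

Lemma cvg_sqr0 (u : nat -> R) : (u n ^+ 2 @[n --> \oo] --> 0) -> u n @[n --> \oo] --> 0.
Proof.
move=> H; apply/cvgr0Pnorm_lt => e e0.
move/cvgr0Pnorm_lt : H => /(_ (e ^+ 2)); rewrite exprn_gt0// => /(_ isT).
apply: filterS => n; rewrite normrX => H.
by rewrite -(@ltr_pXn2r _ 2)// nnegrE// ltW.
Qed.

(** Continuity of the inner product: f_n g_n - f g is expanded into three products, each with a
    factor tending to 0, and each is bounded by Cauchy-Schwarz. *)
Lemma L2_cvg (f_ g_ : nat -> T -> R) f g : (forall n, sqi (f_ n)) ->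
  (forall n, sqi (g_ n)) -> sqi f -> sqi g ->
  (nsq (fun x => f_ n x - f x) @[n --> \oo] --> 0) ->
  (nsq (fun x => g_ n x - g x) @[n --> \oo] --> 0) ->
  \int[mu]_x (f_ n x * g_ n x) @[n --> \oo] --> \int[mu]_x (f x * g x).
Proof.
move=> sf_ sg_ sf sg cf cg.
have CS (a b : nat -> T -> R) : (forall n, sqi (a n)) -> (forall n, sqi (b n)) ->
  (nsq (a n) * nsq (b n) @[n --> \oo] --> 0) ->
  \int[mu]_x (a n x * b n x) @[n --> \oo] --> 0.
  move=> sa sb H; apply: cvg_sqr0.
  apply: (squeeze_cvgr (f := fun=> 0) (h := fun n => nsq (a n) * nsq (b n))) => //.
  - by apply: nearW => n; rewrite sqr_ge0 cauchy_schwarz.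
  - exact: cvg_cst.
have sB n := sqiB (sf_ n) sf; have sC n := sqiB (sg_ n) sg.
have c1 := CS _ _ sB sC; have c2 := CS _ _ (fun _ => sf) sC; have c3 := CS _ _ sB (fun _ => sg).
apply/subr_cvg0.
rewrite (_ : (fun n => _) = (fun n => \int[mu]_x ((f_ n x - f x) * (g_ n x - g x)) +
  \int[mu]_x (f x * (g_ n x - g x)) + \int[mu]_x ((f_ n x - f x) * g x))); last first.
  apply/funext => n; rewrite -RintegralB//; [|exact: sqi_M..].
  rewrite -RintegralD//; [|exact: sqi_M..].
  rewrite -RintegralD//; [|by apply: intbleD; exact: sqi_M|exact: sqi_M].
  by apply: eq_Rintegral => x _; ring.
rewrite -[X in _ --> X]addr0 -[X in _ --> X + _]addr0; apply: cvgD; first apply: cvgD.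
- by apply: c1; rewrite -[X in _ --> X](mulr0 0); exact: cvgM.
- by apply: c2; rewrite -[X in _ --> X](mulr0 (nsq f)); apply: cvgM => //; exact: cvg_cst.
- by apply: c3; rewrite -[X in _ --> X](mul0r (nsq g)); apply: cvgM => //; exact: cvg_cst.
Qed.

Import HBNNSimple.

(** Serves for pathwise integrals whose measurability in w is not established. The integral of a
    nonnegative function is a supremum over the simple functions below it, and setting such a simple
    function to 0 on a measurable null set does not change its integral. *)
Lemma ae_eq_integral_nonmeas (f g : T -> \bar R) :
  {ae mu, forall x, f x = g x} -> (\int[mu]_x f x = \int[mu]_x g x)%E.
Proof.
suff H (f1 g1 : T -> \bar R) : (forall x, 0 <= f1 x)%E -> (forall x, 0 <= g1 x)%E ->
    {ae mu, forall x, f1 x = g1 x} -> (\int[mu]_x f1 x <= \int[mu]_x g1 x)%E.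
  move=> fg; rewrite integralE [RHS]integralE; congr (_ - _)%E;
    apply/eqP; rewrite eq_le; apply/andP; split; apply: H => //;
    by apply: filterS fg => x; rewrite !unlock => ->.
move=> f0 g0 [N [mN N0 fgN]].
rewrite ge0_integralTE// ge0_integralTE//.
apply: ge_ereal_sup => _ [h /= hf <-].
pose k := proj_nnsfun h (measurableC mN).
have -> : sintegral mu h = sintegral mu k.
  rewrite -!integralT_nnsfun; apply: ae_eq_integral => //.
  - exact/measurable_EFinP.
  - exact/measurable_EFinP.
  - exists N; split=> // x /= /not_implyP[_ neq]; apply: contrapT => Nx; apply: neq.
    by rewrite /k /= /mindic indicE mem_set ?mulr1.
apply: ereal_sup_ubound; exists k => //= x; rewrite /mindic indicE.
have [xN|xN] := pselect (N x).
  by rewrite memNset ?mulr0//= => /(_ xN).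
rewrite mem_set// mulr1 (le_trans (hf x))// le_eqVlt; apply/orP; left.
by apply/eqP; apply: contrapT => /fgN.
Qed.

(** Gives membership in L^2 and the bound together, for limits not yet known to be
    square-integrable. *)
Lemma L2_fatou (f_ : nat -> T -> R) f (C : R) : (forall n, sqi (f_ n)) ->
  (forall x, f_ n x @[n --> \oo] --> f x) -> (forall n, nsq (f_ n) <= C) ->
  sqi f /\ nsq f <= C.
Proof.
move=> sf cf fC.
have mf : measurable_fun setT f.
  by apply: (measurable_fun_cvg (h := f_)) => // n; have [] := sf n.
have le_C : (\int[mu]_x (f x ^+ 2)%:E <= C%:E)%E.
  have -> : (\int[mu]_x (f x ^+ 2)%:E = \int[mu]_x limn_einf (fun n => (f_ n x ^+ 2)%:E))%E.
    apply: eq_integral => x _; apply/esym.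
    have c2 : (f_ n x ^+ 2)%:E @[n --> \oo] --> (f x ^+ 2)%:E.
      by apply: cvg_EFin; [exact: nearW|exact: (cvgM (cf x) (cf x))].
    rewrite is_cvg_limn_einfE; first exact: cvg_lim.
    by apply/cvg_ex; exists (f x ^+ 2)%:E.
  apply: le_trans.
    apply: (fatou mu measurableT (f := fun n x => (f_ n x ^+ 2)%:E)).
      by move=> n; apply/measurable_EFinP/measurable_funX; have [] := sf n.
    by move=> n x _; rewrite lee_fin sqr_ge0.
  rewrite limn_einf_lim; apply: lime_le; first exact: is_cvg_einfs.
  apply: nearW => n; apply: le_trans (_ : (\int[mu]_x (f_ n x ^+ 2)%:E <= _)%E).
    by apply: ereal_inf_lbound; exists n => //=.
  by rewrite -EFin_nsq// lee_fin.
have sf' : sqi f by split=> //; apply: le_lt_trans le_C _; rewrite ltry.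
by split=> //; rewrite -lee_fin EFin_nsq.
Qed.

Lemma nsq_trunc_cvg f (A_ : nat -> set T) : sqi f -> (forall n, measurable (A_ n)) ->
  (forall x, \forall n \near \oo, A_ n x) ->
  nsq (fun x => \1_(A_ n) x * f x - f x) @[n --> \oo] --> 0.
Proof.
move=> sf mA An; have mf := sf.1.
have mg n : measurable_fun setT (fun x => \1_(A_ n) x * f x - f x).
  by apply: measurable_funB => //; apply: measurable_funM => //; exact: measurable_indic.
have H := @dominated_convergence _ _ _ mu setT measurableT
  (fun n x => ((\1_(A_ n) x * f x - f x) ^+ 2)%:E) (fun=> 0%E) (fun x => (f x ^+ 2)%:E).
case: H => //.
- by move=> n; apply/measurable_EFinP/measurable_funX.
- apply: aeW => x _; apply: cvg_near_cst; apply: filterS (An x) => n Anx.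
  by rewrite indicE mem_set// mul1r subrr expr0n.
- exact: sqi_sqr.
- apply: aeW => x n _; rewrite lee_fin ger0_norm ?sqr_ge0// indicE.
  by case: (x \in _); rewrite ?mul1r ?mul0r ?subrr ?sub0r ?sqrrN ?expr0n//= sqr_ge0.
move=> _ _; rewrite integral0 => H.
have : fine (\int[mu]_x ((\1_(A_ n) x * f x - f x) ^+ 2)%:E)%E @[n --> \oo] --> fine 0%E.
  exact: fine_cvg.
by [].
Qed.

End L2.

(** * Martingales and the maximal inequality *)

Section measurable_wrt.
Context {R : realType} {Omega : pointedType}.
Variable G : set (set Omega).
Hypothesis sG : sigma_algebra setT G.
Implicit Types X Y : Omega -> R.

Definition fmeas Y := forall B : set R, measurable B -> G (Y @^-1` B).

(** The sigma-algebras of a filtration are not the one attached to the type [Omega]; this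
    equivalence makes closure properties of measurable functions available for each of them. *)
Lemma fmeasE Y : fmeas Y <-> measurable_fun [set: g_sigma_algebraType G] Y.
Proof.
split=> [H _ B mB|H B mB].
  by rewrite setTI; apply: sub_sigma_algebra; exact: H.
have := H measurableT B mB; rewrite setTI /measurable /=.
by rewrite sigma_algebra_id.
Qed.

Lemma fmeasM X Y : fmeas X -> fmeas Y -> fmeas (fun w => X w * Y w).
Proof. by move=> /fmeasE mX /fmeasE mY; apply/fmeasE; exact: measurable_funM. Qed.

Lemma fmeasD X Y : fmeas X -> fmeas Y -> fmeas (fun w => X w + Y w).
Proof. by move=> /fmeasE mX /fmeasE mY; apply/fmeasE; exact: measurable_funD. Qed.

Lemma fmeasB X Y : fmeas X -> fmeas Y -> fmeas (fun w => X w - Y w).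
Proof. by move=> /fmeasE mX /fmeasE mY; apply/fmeasE; exact: measurable_funB. Qed.

Lemma fmeas_cst c : fmeas (fun=> c).
Proof. by apply/fmeasE; exact: measurable_cst. Qed.

Lemma fmeas_comp (h : R -> R) Y : measurable_fun setT h -> fmeas Y -> fmeas (h \o Y).
Proof. by move=> mh /fmeasE mY; apply/fmeasE; exact: measurableT_comp. Qed.

Lemma fmeas_indic A : G A -> fmeas (\1_A).
Proof.
move=> GA; apply/fmeasE; apply: measurable_indic.
exact: sub_sigma_algebra.
Qed.

Lemma fmeas_cvg (Y_ : nat -> Omega -> R) Y : (forall n, fmeas (Y_ n)) ->
  (forall w, Y_ n w @[n --> \oo] --> Y w) -> fmeas Y.
Proof.
move=> H c; apply/fmeasE; apply: (@measurable_fun_cvg _ (g_sigma_algebraType G) R setT Y_) => [n|w _].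
  exact/fmeasE.
exact: c.
Qed.

Lemma fmeas_gt_norm Y (c : R) : fmeas Y -> G [set w | c < `|Y w|].
Proof.
move=> /(fmeas_comp (@normr_measurable _ setT)) H.
have := H (`]c, +oo[)%classic (measurable_itv _).
by congr G; apply/seteqP; split => w /=; rewrite in_itv/= andbT.
Qed.

Lemma fmeas_le_norm Y (c : R) : fmeas Y -> G [set w | `|Y w| <= c].
Proof.
move=> /(fmeas_comp (@normr_measurable _ setT)) H.
have := H (`]-oo, c])%classic (measurable_itv _).
by congr G; apply/seteqP; split => w /=; rewrite in_itv/=.
Qed.

End measurable_wrt.

Section martingales.
Context {R : realType} {d : measure_display} {Omega : measurableType d}.
Variables (P : probability Omega R) (T : R) (T0 : 0 < T).
Variable F : filtration R Omega.
Hypothesis uF : usual_conditions P T F.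
Implicit Types X Y M : process R Omega.

Lemma filtration_sigma t : 0 <= t <= T -> sigma_algebra setT (F t).
Proof. by move=> tT; case: uF => -[+ _ _] _ _; exact. Qed.

Lemma filtration_le (s t : R) : 0 <= s -> s <= t -> t <= T -> F s `<=` F t.
Proof. by move=> ? ? ?; case: uF => -[_ _ +] _ _; exact. Qed.

Lemma filtration_measurable t : 0 <= t <= T -> F t `<=` measurable.
Proof. by move=> tT; case: uF => -[_ + _] _ _; exact. Qed.

Lemma fmeas_le (s t : R) (Y : Omega -> R) : 0 <= s -> s <= t -> t <= T ->
  fmeas (F s) Y -> fmeas (F t) Y.
Proof. by move=> s0 st tT H B mB; apply: (filtration_le s0 st tT); exact: H. Qed.

Lemma fmeas_measurable t (Y : Omega -> R) : 0 <= t <= T ->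
  fmeas (F t) Y -> measurable_fun setT Y.
Proof.
by move=> tT H _ B mB; rewrite setTI; apply: (filtration_measurable tT); exact: H.
Qed.

Lemma negligible_filtration t N : 0 <= t <= T -> P.-negligible N -> F t N.
Proof.
move=> /andP[t0 tT] N0; apply: (filtration_le _ t0 tT) => //.
by case: uF => _ + _; apply.
Qed.

Lemma mart_intble X t : martingale P T F X -> 0 <= t <= T -> intble P (X t).
Proof. by move=> [_ _ H _] /H. Qed.

Lemma mart_fmeas X t : martingale P T F X -> 0 <= t <= T -> fmeas (F t) (X t).
Proof. by move=> [H _ _ _] /H. Qed.

Lemma mart_measurable X t : martingale P T F X -> 0 <= t <= T ->
  measurable_fun setT (X t).
Proof. by move=> /mart_intble H /H /measurable_intble. Qed.

Lemma Rintegral_indic_setI (mu : {measure set Omega -> \bar R}) (A : set Omega) (f : Omega -> R) :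
  \int[mu]_w (\1_A w * f w) = \int[mu]_(w in A) f w.
Proof.
rewrite [RHS]Rintegral_mkcond; apply: eq_Rintegral => w _.
by rewrite patchE indicE; case: ifP => _; rewrite ?mul1r ?mul0r.
Qed.

Lemma mart_indic X (s t : R) A : martingale P T F X -> 0 <= s -> s <= t -> t <= T ->
  F s A -> \int[P]_w (\1_A w * X t w) = \int[P]_w (\1_A w * X s w).
Proof.
move=> [_ _ _ H] s0 st tT FA; rewrite !Rintegral_indic_setI /Rintegral.
by rewrite (H s t).
Qed.

(** Takes the place of the identity E[X_t | F_s] = X_s: from indicators of sets of F_s to bounded
    F_s-measurable functions, by [bounded_ind]. *)
Lemma mart_test X (s t : R) (Y : Omega -> R) (K : R) : martingale P T F X ->
  0 <= s -> s <= t -> t <= T ->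
  fmeas (F s) Y -> (forall w, `|Y w| <= K) ->
  \int[P]_w (Y w * X t w) = \int[P]_w (Y w * X s w).
Proof.
move=> mX s0 st tT mY YK.
have sT : 0 <= s <= T by rewrite s0 (le_trans st).
have tT' : 0 <= t <= T by rewrite tT (le_trans s0).
have iXt := mart_intble mX tT'; have iXs := mart_intble mX sT.
suff [] : [/\ measurable_fun setT Y, (exists K, forall w, `|Y w| <= K)
  & \int[P]_w (Y w * X t w) = \int[P]_w (Y w * X s w)] by [].
have mYT := fmeas_measurable sT mY.
apply: (bounded_ind (Pr := fun Y : Omega -> R => [/\ measurable_fun setT Y, (exists K, forall w, `|Y w| <= K)
  & \int[P]_w (Y w * X t w) = \int[P]_w (Y w * X s w)]) YK).
- split=> //; first by exists 0 => w; rewrite normr0.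
  by apply: eq_Rintegral => w _; rewrite !mul0r.
- move=> c g h [mg [K1 gK1] eg] [mh [K2 hK2] eh]; split.
  + by apply: measurable_funD => //; exact: measurable_funM.
  + exists (`|c| * K1 + K2) => w; rewrite (le_trans (ler_normD _ _))// lerD//.
    by rewrite normrM ler_wpM2l.
  + have lin (Z : Omega -> R) : intble P Z -> \int[P]_w ((c * g w + h w) * Z w) =
      c * \int[P]_w (g w * Z w) + \int[P]_w (h w * Z w).
      move=> iZ; rewrite -RintegralZl//; last exact: (intble_bM (K := K1)).
      rewrite -RintegralD//; last 2 first.
        exact/intbleZ/(intble_bM (K := K1)).
        exact: (intble_bM (K := K2)).
      by apply: eq_Rintegral => w _; ring.
    by rewrite !lin// eg eh.
- move=> B mB; have FB := mY B mB; split.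
  + have -> : (fun x => \1_B (Y x)) = \1_(Y @^-1` B) :> (Omega -> R) by apply/funext.
    by apply: measurable_indic; exact: filtration_measurable FB.
  + by exists 1 => w; rewrite indicE; case: (_ \in _); rewrite ?normr1 ?normr0.
  + by have := mart_indic mX s0 st tT FB.
- move=> H; split=> //; first by exists K.
  apply/eqP; rewrite -subr_eq0 -normr_eq0; apply/eqP/le_anti; rewrite normr_ge0 andbT.
  apply/ler_addgt0Pl => e e0; rewrite addr0.
  (* Replacing Y by g costs at most their uniform distance times C in total; dividing e by C + 1
     covers the case C = 0. *)
  pose C := \int[P]_w `|X t w| + \int[P]_w `|X s w|.
  have C0 : 0 <= C by apply: addr_ge0; apply: Rintegral_ge0 => w _.
  have C1 : 0 < C + 1 by lra.
  have [g [[mg [K1 gK1] eg] fg]] := H (e / (C + 1)) (divr_gt0 e0 C1).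
  have bnd r (iXr : intble P (X r)) :
    `| \int[P]_w (Y w * X r w) - \int[P]_w (g w * X r w)| <= e / (C + 1) * \int[P]_w `|X r w|.
    have iY := intble_bM mYT YK iXr; have ig := intble_bM mg gK1 iXr.
    rewrite -RintegralB// (le_trans (le_normr_Rintegral _ _))//; first exact: intbleB.
    rewrite -RintegralZl//; last exact: intble_norm.
    apply: le_Rintegral => //; first exact/intble_norm/intbleB.
      exact/intbleZ/intble_norm.
    by move=> w _; rewrite -mulrBl normrM ler_wpM2r.
  have -> : \int[P]_w (Y w * X t w) - \int[P]_w (Y w * X s w) =
    (\int[P]_w (Y w * X t w) - \int[P]_w (g w * X t w)) -
    (\int[P]_w (Y w * X s w) - \int[P]_w (g w * X s w)) by rewrite eg; ring.
  rewrite (le_trans (ler_normB _ _))// (le_trans (lerD (bnd t iXt) (bnd s iXs)))//.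
  rewrite -mulrDr -/C mulrAC ler_pdivrMr// ler_wpM2l ?ltW//; lra.
Qed.

(** Y is cut to the event |Y| <= n, which lies in F_s, and both sides converge by continuity of the
    inner product. *)
Lemma mart_test_sqi X (s t : R) (Y : Omega -> R) : martingale P T F X ->
  0 <= s -> s <= t -> t <= T -> sqi P (X t) -> sqi P (X s) ->
  fmeas (F s) Y -> sqi P Y ->
  \int[P]_w (Y w * X t w) = \int[P]_w (Y w * X s w).
Proof.
move=> mX s0 st tT sXt sXs mY sY.
have sT : 0 <= s <= T by rewrite s0 (le_trans st).
pose A n := [set w | `|Y w| <= n%:R].
have FA n : F s (A n).
  exact: (fmeas_le_norm (filtration_sigma sT)) mY.
have mA n : measurable (A n) by exact: filtration_measurable (FA n).
have An w : \forall n \near \oo, A n w.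
  exists (Num.truncn `|Y w|).+1 => // n /= nY.
  by rewrite /A/= ltW// (lt_le_trans (truncnS_gt _))// ler_nat.
have sYn n : sqi P (fun w => \1_(A n) w * Y w).
  apply: (sqi_bM (K := 1)) => //.
  by move=> w; rewrite indicE; case: (_ \in _); rewrite ?normr1 ?normr0.
have c0 := nsq_trunc_cvg sY mA An.
have c1 (Z : Omega -> R) : sqi P Z -> \int[P]_w (\1_(A n) w * Y w * Z w) @[n --> \oo] --> \int[P]_w (Y w * Z w).
  move=> sZ; apply: (L2_cvg (f_ := fun n w => \1_(A n) w * Y w) (g_ := fun=> Z)) => //.
  by under eq_fun do (rewrite /nsq; under eq_Rintegral do rewrite subrr expr0n/=; rewrite Rintegral_cst// mul0r); exact: cvg_cst.
have e n : \int[P]_w (\1_(A n) w * Y w * X t w) = \int[P]_w (\1_(A n) w * Y w * X s w).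
  apply: (mart_test (K := n%:R) mX) => //.
    by apply: (fmeasM (filtration_sigma sT)) => //; apply: (fmeas_indic (filtration_sigma sT)).
  move=> w; rewrite indicE; case: (boolP (w \in A n)); last by rewrite mul0r normr0.
  by rewrite inE mul1r.
have h1 := c1 _ sXt; have h2 := c1 _ sXs.
rewrite (funext e) in h1.
exact: (cvg_unique _ h1 h2).
Qed.

(** Jensen's inequality by projection. For Y_n = X_t cut to |X_t| <= n, testing the martingale
    property gives E[Y_n X_T] = E[Y_n^2], so 0 <= E[(Y_n - X_T)^2] = E[X_T^2] - E[Y_n^2]; Fatou's
    lemma concludes. *)
Lemma mart_sqi X t : martingale P T F X -> sqi P (X T) -> 0 <= t <= T ->
  sqi P (X t) /\ nsq P (X t) <= nsq P (X T).
Proof.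
move=> mX sX tT; have/andP[t0 tT'] := tT.
pose A n := [set w | `|X t w| <= n%:R].
have FA n : F t (A n).
  exact: (fmeas_le_norm (filtration_sigma tT)) (mart_fmeas mX tT).
have mA n : measurable (A n) by exact: filtration_measurable (FA n).
have An w : \forall n \near \oo, A n w.
  exists (Num.truncn `|X t w|).+1 => // n /= nY.
  by rewrite /A/= ltW// (lt_le_trans (truncnS_gt _))// ler_nat.
have mXt := mart_measurable mX tT.
pose Y n w := \1_(A n) w * X t w.
have Yn n w : `|Y n w| <= n%:R.
  rewrite /Y indicE; case: (boolP (w \in A n)); last by rewrite mul0r normr0.
  by rewrite inE mul1r.
have fY n : fmeas (F t) (Y n).
  apply: (fmeasM (filtration_sigma tT)) => //; last exact: (mart_fmeas mX tT).
  exact: (fmeas_indic (filtration_sigma tT)).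
have mY n := fmeas_measurable tT (fY n).
have sY n : sqi P (Y n).
  apply: (@sqi_bnd _ _ _ P _ n%:R) => //.
  by rewrite ltey_eq fin_num_measure.
apply: (L2_fatou (f_ := Y)) => //.
  move=> w; apply: cvg_near_cst; apply: filterS (An w) => n Anw.
  by rewrite /Y indicE mem_set// mul1r.
move=> n; have := mart_test mX t0 tT' (lexx T) (fY n) (Yn n).
have -> : \int[P]_w (Y n w * X t w) = nsq P (Y n).
  apply: eq_Rintegral => w _; rewrite /Y indicE; case: (_ \in _).
    by rewrite mul1r.
  by rewrite !mul0r expr0n.
have := nsq_B (sY n) sX; have := nsq_ge0 P (fun x => Y n x - X T x).
lra.
Qed.

Lemma sqmart_sqi X t : square_integrable_martingale P T F X -> 0 <= t <= T -> sqi P (X t).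
Proof.
move=> [mX sX] tT; split; first exact: mart_measurable mX tT.
by have := sX t tT; rewrite unlock.
Qed.

Lemma mart_orth X (s t : R) (Y : Omega -> R) : square_integrable_martingale P T F X ->
  0 <= s -> s <= t -> t <= T -> fmeas (F s) Y -> sqi P Y ->
  \int[P]_w (Y w * (X t w - X s w)) = 0.
Proof.
move=> mX s0 st tT mY sY.
have sT : 0 <= s <= T by rewrite s0 (le_trans st).
have tT' : 0 <= t <= T by rewrite tT (le_trans s0).
have sXt := sqmart_sqi mX tT'; have sXs := sqmart_sqi mX sT.
have := mart_test_sqi mX.1 s0 st tT sXt sXs mY sY => e.
under eq_Rintegral do rewrite mulrBr.
by rewrite RintegralB//; [rewrite e subrr|exact: sqi_M..].
Qed.

(** The event is decomposed by the first index at which the level is exceeded, one index per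
    induction step. That E belongs to F at the time [tt n] is carried along because the next slice
    must be an event of its own time. *)
Lemma doob_finite X (tt : nat -> R) n (l : R) : martingale P T F X ->
  (forall i j, (i <= j)%N -> tt i <= tt j) -> (forall i, 0 <= tt i <= T) -> 0 < l ->
  let E := [set w | exists2 k, (k <= n)%N & l < `|X (tt k) w|] in
  F (tt n) E /\ (l * fine (P E) <= \int[P]_w (\1_E w * `|X T w|)).
Proof.
move=> mX tt_nd tt_T l0 /=.
have iX := mart_intble mX; have TT : 0 <= T <= T by rewrite ltW/=.
have step k A : F (tt k) A -> (forall w, A w -> l < `|X (tt k) w|) ->
  l * fine (P A) <= \int[P]_w (\1_A w * `|X T w|).
  move=> FA Al; have mA : measurable A by exact: filtration_measurable FA.
  have st := tt_T k; have /andP[tk0 tkT] := st.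
  (* S is the sign of X at the time [tt k], cut to A: S X is |X| on A at that time, S X <= |X| at T,
     and the two expectations of S X agree. *)
  pose S w := \1_(A `&` [set w | 0 <= X (tt k) w]) w - \1_(A `\` [set w | 0 <= X (tt k) w]) w : R.
  have Fpos : F (tt k) [set w | 0 <= X (tt k) w].
    have := mart_fmeas mX st (measurable_itv `[0, +oo[).
    by congr F; apply/seteqP; split=> w /=; rewrite in_itv/= andbT.
  have fS : fmeas (F (tt k)) S.
    have sF := filtration_sigma st.
    apply: (fmeasB sF); apply: (fmeas_indic sF).
      have := @measurableI _ (g_sigma_algebraType (F (tt k))) A [set w | 0 <= X (tt k) w].
      by rewrite /measurable/= sigma_algebra_id//; apply.
    have := @measurableD _ (g_sigma_algebraType (F (tt k))) A [set w | 0 <= X (tt k) w].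
    by rewrite /measurable/= sigma_algebra_id//; apply.
  have SE w : S w = \1_A w * (if 0 <= X (tt k) w then 1 else -1).
    rewrite /S !indicE in_setI in_setD; case: (w \in A) => /=; last by rewrite subrr mul0r.
    case: ifPn => H.
      by rewrite (mem_set (_ : [set w | 0 <= X (tt k) w] w))//= mul1r subr0.
    by rewrite memNset/= ?mul1r ?sub0r//; apply/negP.
  have S1 w : `|S w| <= 1.
    rewrite SE indicE; case: (w \in A); case: ifP; rewrite ?mul1r ?mul0r ?normrN1 ?normr1 ?normr0//.
  have mS := fmeas_measurable st fS.
  have e := mart_test mX tk0 tkT (lexx T) fS S1.
  apply: (@le_trans _ _ (\int[P]_w (S w * X (tt k) w))).
    have -> : l * fine (P A) = \int[P]_w (l * \1_A w).
      rewrite RintegralZl//; last exact: integrable_indic.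
      by rewrite /Rintegral integral_indic// setIT.
    apply: le_Rintegral => //.
    - by apply/intbleZ; exact: integrable_indic.
    - exact: (intble_bM (K := 1)) (iX _ st).
    - move=> w _; rewrite SE indicE; case: (boolP (w \in A)) => [|_]; last by rewrite mulr0 !mul0r.
      rewrite inE mulr1 mul1r => /Al /ltW; case: ifP => [Xp|/negbT]; first by rewrite ger0_norm// mul1r.
      by rewrite -ltNge => /ltr0_norm ->; rewrite mulN1r.
  rewrite -e; apply: le_Rintegral => //.
  - exact: (intble_bM (K := 1)) (iX _ TT).
  - apply: (intble_bM (K := 1)) => //.
      by move=> w; rewrite indicE; case: (_ \in _); rewrite ?normr1 ?normr0.
    exact/intble_norm/iX.
  - move=> w _; rewrite SE -mulrA; apply: ler_wpM2l; first by rewrite indicE.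
    case: ifP => _; rewrite ?mul1r ?mulN1r ?ler_norm//.
    by rewrite -normrN ler_norm.
elim: n => [|n [FE IH]].
  have EE : [set w | exists2 k, (k <= 0)%N & l < `|X (tt k) w|] = [set w | l < `|X (tt 0%N) w|].
    apply/seteqP; split=> w /=; last by exists 0%N.
    by move=> [k]; rewrite leqn0 => /eqP ->.
  rewrite EE.
  have FE : F (tt 0%N) [set w | l < `|X (tt 0%N) w|].
    exact: (fmeas_gt_norm (filtration_sigma (tt_T 0%N))) (mart_fmeas mX (tt_T 0%N)).
  by split=> //; apply: (step 0%N).
set E := [set w | _] in FE IH; set E' := [set w | _].
(* The paths above the level at the index n.+1 and at no earlier one. *)
pose A := [set w | l < `|X (tt n.+1) w|] `\` E.
have st := tt_T n.+1; have sF := filtration_sigma st.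
have /andP[tn0 tnT] := tt_T n; have /andP[tn0' tnT'] := tt_T n.+1.
have FE1 : F (tt n.+1) E by apply: (filtration_le tn0 (tt_nd _ _ (leqnSn n)) tnT').
have FA : F (tt n.+1) A.
  have := @measurableD _ (g_sigma_algebraType (F (tt n.+1))) [set w | l < `|X (tt n.+1) w|] E.
  rewrite /measurable/= sigma_algebra_id//; apply=> //.
  exact: (fmeas_gt_norm sF) (mart_fmeas mX st).
have E'E : E' = E `|` A.
  apply/seteqP; split=> w /=.
    move=> [k]; rewrite leq_eqVlt ltnS => /orP[/eqP -> H|kn H]; last by left; exists k.
    by have [Ew|Ew] := pselect (E w); [left|right].
  case=> [[k kn H]|[H _]]; last by exists n.+1.
  by exists k => //; rewrite (leq_trans kn).
have FE' : F (tt n.+1) E'.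
  have := @measurableU _ (g_sigma_algebraType (F (tt n.+1))) E A.
  by rewrite /measurable/= sigma_algebra_id// E'E; apply.
split=> //.
have mE : measurable E by exact: filtration_measurable FE1.
have mA : measurable A by exact: filtration_measurable FA.
have EA : [disjoint E & A].
  by apply/disj_setPS => w /= [Ew [_ /(_ Ew)]].
have hA := step n.+1 A FA (fun w Aw => Aw.1).
have -> : fine (P E') = fine (P E) + fine (P A).
  rewrite E'E measureU//; last exact/disj_set2P.
  by rewrite fineD// fin_num_measure.
have -> : \int[P]_w (\1_E' w * `|X T w|) =
    \int[P]_w (\1_E w * `|X T w|) + \int[P]_w (\1_A w * `|X T w|).
  have iA B : measurable B -> intble P (fun w => \1_B w * `|X T w|).
    move=> mB; apply: (intble_bM (K := 1)) => //.
      by move=> w; rewrite indicE; case: (_ \in _); rewrite ?normr1 ?normr0.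
    exact/intble_norm/iX.
  rewrite -RintegralD//; [|exact: iA..].
  apply: eq_Rintegral => w _; rewrite -mulrDl; congr (_ * _).
  rewrite E'E !indicE in_setU; have := EA; rewrite disj_set2E => /eqP EA0.
  case: (boolP (w \in E)) => wE; case: (boolP (w \in A)) => wA; rewrite /= ?addr0 ?add0r//.
  have : (E `&` A) w by split; exact/set_mem.
  by rewrite EA0.
by rewrite mulrDr lerD.
Qed.

Lemma right_cvg_gt_norm (g : R -> R) (t l : R) : g r @[r --> t^'+] --> g t -> l < `|g t| ->
  \forall r \near t^'+, l < `|g r|.
Proof.
move=> gt lg; have e0 : 0 < `|g t| - l by rewrite subr_gt0.
move/cvgrPdist_lt : gt => /(_ _ e0); apply: filterS => r H.
by have := ler_normB (g t) (g t - g r); have := lerB_normD (g t) (- (g r)); rewrite normrN; lra.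
Qed.

(** By right continuity a path exceeding l at some time does so at a grid point; the events E n
    increase as the grid is refined, and the bound passes to their union. Asserting only a
    measurable event that contains these paths keeps the supremum over [0, T] out of the
    statement. *)
Lemma doob X (l : R) : martingale P T F X -> 0 < l -> exists E, [/\ measurable E,
  forall w t, 0 <= t <= T -> l < `|X t w| -> E w &
  l * fine (P E) <= \int[P]_w `|X T w| ].
Proof.
move=> mX l0; have cX : cadlag T X by case: mX.
(* Grid of mesh T / 2^n, frozen at T beyond the index 2^n because [doob_finite] takes an infinite
   sequence of times in [0, T]. *)
pose tt n k : R := Num.min T (k%:R / 2 ^+ n * T).
have tt_T n k : 0 <= tt n k <= T.
  rewrite /tt ge_min lexx/= andbT le_min ltW//=; apply: mulr_ge0; last exact: ltW.
  by apply: divr_ge0; [exact: ler0n|exact/exprn_ge0].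
have tt_nd n i j : (i <= j)%N -> tt n i <= tt n j.
  move=> ij; rewrite /tt le_min ge_min lexx/= ge_min; apply/orP; right.
  by rewrite ler_pM2r// ler_pM2r ?invr_gt0 ?exprn_gt0// ler_nat.
pose E n := [set w | exists2 k, (k <= 2 ^ n)%N & l < `|X (tt n k) w|].
have TT : 0 <= T <= T by rewrite ltW/=.
have HE n := doob_finite (2 ^ n) mX (tt_nd n) (tt_T n) l0.
have mE n : measurable (E n) by exact: filtration_measurable (HE n).1.
have iX := intble_norm (mart_intble mX TT).
have lE n : l * fine (P (E n)) <= \int[P]_w `|X T w|.
  apply: le_trans (HE n).2 _; apply: le_Rintegral => //.
    apply: (intble_bM (K := 1)) => //; first exact: (measurable_indic (mE n)).
    by move=> w; rewrite indicE; case: (_ \in _); rewrite ?normr1 ?normr0.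
  by move=> w _; rewrite indicE; case: (_ \in _); rewrite ?mul1r ?mul0r.
have ndE : nondecreasing_seq E.
  apply/nondecreasing_seqP => n; apply/subsetPset => w [k kn lX].
  exists (2 * k)%N; first by rewrite expnS leq_mul2l kn.
  move: lX; rewrite /tt natrM exprS invfM.
  by rewrite mulrACA divff// mul1r.
exists (\bigcup_n E n); split; first exact: bigcupT_measurable.
  (* Right continuity gives nothing at T, which is the grid point of index 1 for n = 0. *)
  move=> w t /andP[t0]; rewrite le_eqVlt => /predU1P[->|tT] lX.
    exists 0%N => //=; exists 1%N => //.
    by rewrite /tt expr0 divr1 mul1r minxx.
  have ct : X r w @[r --> t^'+] --> X t w by apply: (cX w).1; rewrite t0 tT.
  have := right_cvg_gt_norm ct lX.
  case=> e /= e0 H; pose de := Num.min e (T - t).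
  have de0 : 0 < de by rewrite lt_min e0 subr_gt0.
  (* The mesh T / 2^n is below de, and k is the first index whose grid point lies strictly to the
     right of t. That point is below t + de <= T, so the freezing at T does not move it. *)
  pose n := (Num.trunc (T / de)).+1; pose k := (Num.trunc (t / T * 2 ^+ n)).+1.
  have n2 : T / de < 2 ^+ n.
    apply: (lt_le_trans (truncnS_gt _)).
    by rewrite -natrX ler_nat ltnW// ltn_expl.
  have p2 : (0 : R) < 2 ^+ n by rewrite exprn_gt0.
  have k1 : t < k%:R / 2 ^+ n * T.
    rewrite mulrAC ltr_pdivlMr// -ltr_pdivrMr// mulrAC.
    exact: truncnS_gt.
  have k2 : k%:R / 2 ^+ n * T < t + de.
    have/andP[H1 _] : (Num.trunc (t / T * 2 ^+ n))%:R <= t / T * 2 ^+ n < k%:R.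
      by apply: truncn_itv; rewrite mulr_ge0 ?(ltW p2)// divr_ge0// ltW.
    have : (Num.trunc (t / T * 2 ^+ n))%:R / 2 ^+ n * T <= t.
      rewrite -ler_pdivlMr// ler_pdivrMr//.
    rewrite /k -[in X in _ -> X]natr1 2!mulrDl.
    have : 1 / 2 ^+ n * T < de by rewrite mulrAC mul1r ltr_pdivrMr// mulrC -ltr_pdivrMr.
    lra.
  have dTt : de <= T - t by rewrite /de ge_min lexx orbT.
  have dT : t + de <= T by lra.
  have de_e : de <= e by rewrite /de ge_min lexx.
  exists n => //; exists k.
    have : k%:R / 2 ^+ n < 1 :> R.
      by rewrite -(ltr_pM2r T0) mul1r; lra.
    by rewrite ltr_pdivrMr// mul1r -natrX ltr_nat => /ltnW.
  rewrite /tt min_r; last lra.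
  by apply: (H _ _ k1); rewrite /ball_/= distrC gtr0_norm; lra.
have mU : measurable (\bigcup_n E n) by exact: bigcupT_measurable.
have cE : P (E n) @[n --> \oo] --> P (\bigcup_n E n) by exact: nondecreasing_cvg_mu.
have fE : fine (P (E n)) @[n --> \oo] --> fine (P (\bigcup_n E n)).
  by apply: fine_cvg; rewrite fineK// fin_num_measure.
apply: (cvgr_to_le (cvgM (cvg_cst l) fE)); exact: nearW.
Qed.

(** Equality at the single time T yields indistinguishability: the maximal inequality at each level
    1/(n+1) has right-hand side 0. *)
Lemma mart_zero X : martingale P T F X -> {ae P, forall w, X T w = 0} ->
  {ae P, forall w, forall t, 0 <= t <= T -> X t w = 0}.
Proof.
move=> mX X0; have TT : 0 <= T <= T by rewrite ltW/=.
have I0 : \int[P]_w `|X T w| = 0.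
  rewrite /Rintegral (ae_eq_integral_nonmeas (g := fun=> 0%E)) ?integral0//.
  by apply: filterS X0 => w ->; rewrite normr0.
have H n : exists E, [/\ measurable E, P E = 0 &
    forall w t, 0 <= t <= T -> n.+1%:R^-1 < `|X t w| -> E w].
  have n0 : (0 : R) < n.+1%:R^-1 by [].
  have [E [mE EX lE]] := doob mX n0; exists E; split=> //.
  move: lE; rewrite I0 pmulr_rle0// => PE0.
  have := fin_num_measure P _ mE => /fineK <-; congr EFin; apply/le_anti.
  by rewrite PE0 fine_ge0.
have {}H := choice H; case: H => E HE.
exists (\bigcup_n E n); split.
- by apply: bigcupT_measurable => n; have [] := HE n.
- apply/negligibleP; first by apply: bigcupT_measurable => n; have [] := HE n.
  by apply: negligible_bigcup => n; apply/negligibleP; have [] := HE n.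
move=> w /= /existsNP[t] /not_implyP[tT Xt].
pose n := Num.trunc (`|X t w|^-1); exists n => //.
have [_ _ EX] := HE n; apply: (EX w t tT).
rewrite invf_plt ?posrE ?normr_gt0//; [exact: truncnS_gt|exact/eqP].
Qed.

End martingales.

(** * Random Stieltjes measures *)

Section mixture.
Context dX dZ {X : measurableType dX} {Z : measurableType dZ} {R : realType}.
Variables (P : {measure set X -> \bar R}) (K : X -> {measure set Z -> \bar R}).
Hypothesis mK : forall U, measurable U -> measurable_fun setT (K ^~ U).
Local Open Scope ereal_scope.

(** The measurability of the kernel is an argument of the function, because the measure structure
    attached to it below depends on that proof. *)
Definition mixture_fun of (forall U, measurable U -> measurable_fun setT (K ^~ U)) :=
  fun U => \int[P]_x K x U.
Local Notation mx := (mixture_fun mK).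

Let mixture0 : mx set0 = 0.
Proof. by rewrite /mx integral0_eq// => y _; rewrite measure0. Qed.

Let mixture_ge0 U : 0 <= mx U. Proof. exact: integral_ge0. Qed.

Let mixture_sigma_additive : semi_sigma_additive mx.
Proof.
move=> U mU tU mUU; rewrite [X in _ --> X](_ : _ = \sum_(n <oo) mx (U n)).
  by apply: is_cvg_nneseries => n _ _; exact: integral_ge0.
rewrite -integral_nneseries// => [|n]; last exact: mK.
apply: eq_integral => x _.
by apply/esym/cvg_lim => //; exact/measure_semi_sigma_additive.
Qed.

HB.instance Definition _ := isMeasure.Build _ _ R mx mixture0 mixture_ge0
  mixture_sigma_additive.

Definition mixture : {measure set Z -> \bar R} := mx.

Lemma measurable_fun_integral_mixture (f : Z -> \bar R) : (forall z, 0 <= f z) ->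
  measurable_fun setT f -> measurable_fun setT (fun x => \int[K x]_z f z).
Proof. by move=> f0 mf; exact: measurable_fun_integral_kernel. Qed.

Import HBNNSimple.

Let integral_mixture_nnsfun (f : {nnsfun Z >-> R}) :
  \int[mixture]_z (f z)%:E = \int[P]_x \int[K x]_z (f z)%:E.
Proof.
rewrite integralT_nnsfun sintegralE.
under [in RHS]eq_integral do rewrite integralT_nnsfun sintegralE.
rewrite ge0_integral_fsum//.
- apply: eq_fsbigr => r /set_mem[z _ <-].
  by rewrite ge0_integralZl ?lee_fin//; exact: mK.
- by move=> r; apply: measurable_funeM; exact: mK.
- by move=> r x _; exact: nnsfun_mulemu_ge0.
Qed.

Lemma ge0_integral_mixture (f : Z -> \bar R) : (forall z, 0 <= f z) ->
  measurable_fun setT f -> \int[mixture]_z f z = \int[P]_x \int[K x]_z f z.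
Proof.
move=> f0 mf; pose f_ := nnsfun_approx measurableT mf.
have m_ n : measurable_fun setT (EFin \o f_ n) by exact/measurable_EFinP.
have p_ n z : 0 <= (f_ n z)%:E by rewrite lee_fin.
have nd_ z : {homo (fun n => (f_ n z)%:E) : a b / (a <= b)%N >-> a <= b}.
  by move=> a b ab; rewrite lee_fin; exact/lefP/nd_nnsfun_approx.
have lim_ (m : {measure set Z -> \bar R}) :
    \int[m]_z f z = limn (fun n => \int[m]_z (f_ n z)%:E).
  rewrite -monotone_convergence//; apply: eq_integral => z _.
  by apply/esym/cvg_lim => //; exact: cvg_nnsfun_approx.
rewrite lim_ (eq_fun (fun n => integral_mixture_nnsfun (f_ n))) -monotone_convergence//.
- by apply: eq_integral => x _; rewrite lim_.
- by move=> n; exact: measurable_fun_integral_mixture (p_ n) (m_ n).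
- by move=> n x _; exact: integral_ge0.
- by move=> x _ a b ab; apply: ge0_le_integral => //;
    by [exact: m_|move=> z _; exact: nd_].
Qed.

(** Fubini for an integrable f of any sign: positive and negative parts have almost surely finite
    inner integrals, and are treated separately. *)
Lemma Rintegral_mixture (f : Z -> R) : intble mixture f ->
  {ae P, forall x, intble (K x) f} /\
  \int[P]_x (\int[K x]_z f z)%R%:E = (\int[mixture]_z f z)%R%:E.
Proof.
move=> i_f; have mf := measurable_intble i_f.
have mfE : measurable_fun setT (EFin \o f) by exact/measurable_EFinP.
have part (g : Z -> \bar R) : measurable_fun setT g -> (forall z, 0 <= g z) ->
  mixture.-integrable setT g -> P.-integrable setT (fun x => \int[K x]_z g z).
  move=> mg g0 /integrableP[_ ig]; apply/integrableP; split.
    exact: measurable_fun_integral_mixture.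
  under eq_integral do rewrite gee0_abs ?integral_ge0//.
  rewrite -ge0_integral_mixture//.
  by under eq_integral do rewrite -[g _]gee0_abs//.
have ip := part _ (measurable_funepos mfE) (funepos_ge0 _) (integrable_funepos measurableT i_f).
have im := part _ (measurable_funeneg mfE) (funeneg_ge0 _) (integrable_funeneg measurableT i_f).
have aep := integrable_ae measurableT ip; have aem := integrable_ae measurableT im.
have ae_int : {ae P, forall x, intble (K x) f}.
  apply: filterS2 aep aem => x /(_ I) px /(_ I) mxx; apply/integrableP; split=> //.
  rewrite -[fun _ => _]/(abse \o (EFin \o f)) fune_abse ge0_integralD//.
  - by rewrite ltey_eq fin_numD px mxx.
  - exact: measurable_funepos.
  - exact: measurable_funeneg.
split=> //.
rewrite EFin_Rintegral// [RHS]integralE !ge0_integral_mixture//; last 2 first.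
  exact: measurable_funeneg.
  exact: measurable_funepos.
(* On the null set of x where f is not integrable for K x, the real inner integral is a default
   value and may differ from the difference of the parts. *)
rewrite -integralB//; apply: ae_eq_integral_nonmeas.
by apply: filterS ae_int => x ix; rewrite EFin_Rintegral// integralE.
Qed.

End mixture.

(** * Stieltjes measure of a nondecreasing right-continuous path *)

Section stieltjes.
Context {R : realType} (T : R) (T0 : 0 < T).
Variable g : R -> R.
Hypothesis nd_g : forall s t, 0 <= s -> s <= t -> t <= T -> g s <= g t.
Hypothesis rc_g : forall t, 0 <= t < T -> g r @[r --> t^'+] --> g t.

Let clamp_ge0 t : 0 <= Num.max 0 (Num.min t T). Proof. by rewrite le_max lexx. Qed.
Let clamp_leT t : Num.max 0 (Num.min t T) <= T.
Proof. by rewrite ge_max ltW//= ge_min lexx orbT. Qed.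

Lemma stopped_in t : 0 <= t <= T -> stopped T g t = g t.
Proof. by move=> /andP[t0 tT]; rewrite /stopped min_l// max_r. Qed.

Lemma stopped_nd : nondecreasing (stopped T g).
Proof.
move=> s t st; rewrite /stopped; apply: nd_g => //.
by rewrite ge_max le_max lexx/= le_max orbC [in X in X || _]le_min !ge_min st lexx orbT.
Qed.

Lemma stopped_rc : forall t, stopped T g r @[r --> t^'+] --> stopped T g t.
Proof.
move=> t; have [t0|t0] := ltP t 0.
  apply: cvg_near_cst; near=> r.
  by rewrite /stopped !max_l// ge_min ltW.
have [tT|tT] := ltP t T; last first.
  apply: cvg_near_cst; near=> r.
  by rewrite /stopped [Num.min t T]min_r// [Num.min r T]min_r// (le_trans tT).
rewrite [X in _ --> X]stopped_in ?t0 ?ltW//.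
apply: cvg_trans (rc_g _); last by rewrite t0.
apply: near_eq_cvg; near=> r; rewrite stopped_in//.
by rewrite (le_trans t0)//=; near: r; exact: nbhs_right_le.
Unshelve. all: by end_near. Qed.

(** Shows that the junk branch of [stieltjes] is not taken: monotonicity and right continuity on
    [0, T] pass to the path stopped at 0 and T. *)
Lemma stieltjesE : exists f : cumulative R R,
  (forall A, stieltjes T g A = lebesgue_stieltjes_measure f A)
  /\ forall t, f t = stopped T g t.
Proof.
rewrite /stieltjes; case: pselect => [Hg|[]]; first by exists (cumulative_of Hg).
by split; [exact: stopped_nd|exact: stopped_rc].
Qed.

Lemma stieltjes_itv a b : 0 <= a -> a <= b -> b <= T ->
  stieltjes T g `]a, b]%classic = (g b - g a)%:E.
Proof.
move=> a0 ab bT; have [f [-> fE]] := stieltjesE.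
rewrite /lebesgue_stieltjes_measure /measure_extension/= measurable_mu_extE/=; last exact: is_ocitv.
rewrite wlength_itv_bnd// !fE !stopped_in ?a0 ?(le_trans ab)//=.
by rewrite bT (le_trans a0).
Qed.

End stieltjes.

Section mrestr_integral.
Context d {X : measurableType d} {R : realType}.
Variables (mu : {measure set X -> \bar R}) (D : set X) (mD : measurable D).
Local Open Scope ereal_scope.

Let ge0_integral_mrestr (f : X -> \bar R) : measurable_fun setT f -> (forall x, 0 <= f x) ->
  \int[mrestr mu mD]_x f x = \int[mu]_(x in D) f x.
Proof.
move=> mf f0; rewrite (ge0_negligible_integral (measurableC mD) measurableT mf)//.
  rewrite setTD setCK; apply: eq_measure_integral => A mA AD.
  by rewrite /mrestr/=; congr (mu _); apply/setIidPl.
by rewrite /= /mrestr setICl measure0.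
Qed.

Lemma integral_mrestr (f : X -> \bar R) : measurable_fun setT f ->
  \int[mrestr mu mD]_x f x = \int[mu]_(x in D) f x.
Proof.
move=> mf; rewrite [LHS]integralE [RHS]integralE !ge0_integral_mrestr//.
  exact: measurable_funeneg.
exact: measurable_funepos.
Qed.

End mrestr_integral.

(** * The measure P(dw) d<M>_s(w) on the product of [Omega] and time *)

Section quadratic_variation_measure.
Context {R : realType} {d : measure_display} {Omega : measurableType d}.
Variables (P : probability Omega R) (T : R) (T0 : 0 < T).
Variable qM : process R Omega.
Hypothesis mqM : forall t, 0 <= t <= T -> measurable_fun setT (qM t).
Hypothesis cqM : cadlag T qM.
Hypothesis ndqM : forall w s t, 0 <= s -> s <= t -> t <= T -> qM s w <= qM t w.
Local Notation mR := (measurableTypeR R).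

Lemma measurable_itv0T : measurable (`]0, T]%classic : set mR).
Proof. exact: measurable_itv. Qed.

(** Restricting d<M> to ]0, T] turns integrals over this interval into integrals over the whole time
    axis, the form that a mixture of measures requires. *)
Definition kqv w : {measure set mR -> \bar R} :=
  mrestr (qv_measure T qM w) measurable_itv0T.

Lemma qv_itv w a b : 0 <= a -> a <= b -> b <= T ->
  qv_measure T qM w `]a, b]%classic = (qM b w - qM a w)%:E.
Proof.
by apply: stieltjes_itv => // [s t|t tT]; [exact: ndqM|exact: (cqM w).1].
Qed.

Lemma kqv_setT w : kqv w setT = (qM T w - qM 0 w)%:E.
Proof. by rewrite /kqv/= /mrestr setTI qv_itv// ltW. Qed.

Lemma kqv_fin w U : measurable U -> (kqv w U < +oo)%E.
Proof.
move=> mU; apply: (@le_lt_trans _ _ (kqv w setT)).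
  by apply: le_measure; rewrite ?inE.
by rewrite kqv_setT ltry.
Qed.

(** Dynkin induction from the half-open intervals, whose mass is an increment of [qM] between times
    clamped to [0, T]; finite total mass handles complements. *)
Lemma measurable_kqv U : measurable U -> measurable_fun setT (kqv ^~ U).
Proof.
have mT : measurable_fun setT (kqv ^~ setT).
  rewrite (_ : (fun w => _) = (fun w => (qM T w - qM 0 w)%:E)).
    by apply/measurable_EFinP/measurable_funB; apply: mqM; rewrite lexx ltW.
  by apply/funext => w; rewrite kqv_setT.
apply: (@dynkin_induction _ mR (@ocitv R)
  (fun U => measurable_fun setT (kqv ^~ U))) => //.
- exact: ocitvI.
- move=> _ [[a b] _ <-] /=.
  pose a' := Num.max a 0; pose b' := Num.min b T.
  have itvE : (`]a, b] `&` `]0, T] = `]a', b'])%classic.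
    by apply/seteqP; split=> x /=; rewrite !in_itv/= /a' /b' gt_max le_min;
      [move=> [/andP[-> ->] /andP[-> ->]]|move=> /andP[/andP[-> ->] /andP[-> ->]]].
  have [ab|ba] := leP a' b'; last first.
    rewrite (_ : (fun w => _) = (fun=> 0%E)); first exact: measurable_cst.
    have itv0 : `]a', b']%classic = set0 by apply: set_itv_ge; rewrite bnd_simp -leNgt ltW.
    by apply/funext => w; rewrite /kqv/= /mrestr itvE itv0 measure0.
  have a0 : 0 <= a' by rewrite /a' le_max lexx orbT.
  have bT : b' <= T by rewrite /b' ge_min lexx orbT.
  rewrite (_ : (fun w => _) = (fun w => (qM b' w - qM a' w)%:E)); last first.
    by apply/funext => w; rewrite /kqv/= /mrestr itvE qv_itv.
  by apply/measurable_EFinP/measurable_funB; apply: mqM; rewrite ?a0 ?bT ?(le_trans ab)// (le_trans a0).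
- move=> S mS H.
  rewrite (_ : (fun w => _) = (fun w => kqv w setT - kqv w S)%E); first exact: emeasurable_funB.
  by apply/funext => w; rewrite -setTD measureD ?setTI// kqv_fin.
- move=> G mG tG H.
  rewrite (_ : (fun w => _) = (fun w => \sum_(0 <= n <oo) kqv w (G n))%E).
    by apply: ge0_emeasurable_sum => // n w _ _; exact: measure_ge0.
  apply/funext => w; apply/esym/cvg_lim => //.
  by apply: measure_semi_sigma_additive => //; exact: bigcupT_measurable.
Qed.

Definition slice (w : Omega) (s : mR) : Omega * mR := (w, s).

Lemma measurable_slice w : measurable_fun setT (slice w).
Proof. exact: pair1_measurable. Qed.

(** The image of d<M>(w) under s -> (w, s), carried by the section over w. Mixing these images in w
    produces a measure on the product. *)
Definition kpath w : {measure set (Omega * mR) -> \bar R} := 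
  measure_function_pushforward__canonical__measure_function_Measure
    (kqv w) (measurable_slice w).

Lemma measurable_kpath U : measurable U -> measurable_fun setT (kpath ^~ U).
Proof.
move=> mU.
pose kk : R.-ker Omega ~> mR := HB.pack kqv (isKernel.Build _ _ _ _ _ kqv measurable_kqv).
have [] := @measurable_prod_subset_xsection_kernel _ _ _ _ _ kk setT measurableT _ U mU.
  (* The total mass, increased by 1 because a strict bound is required. *)
  move=> w; exists (qM T w - qM 0 w + 1) => X mX.
  rewrite /mrestr setIT /=; apply: (@le_lt_trans _ _ (kqv w setT)).
    by apply: le_measure; rewrite ?inE.
  by rewrite kqv_setT lte_fin ltrDl.
move=> _; rewrite (_ : (fun x => _) = (fun w => kpath w U))//.
apply/funext => w; rewrite /kpath/= /mrestr setIT/= /pushforward.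
by congr (kqv w _); rewrite xsectionE.
Qed.

(** The measure mu, on the full product sigma-algebra: F-predictable and H-predictable integrands
    then lie in the same L^2 space. *)
Definition qvP : {measure set (Omega * mR) -> \bar R} := mixture P measurable_kpath.

Lemma integral_kpath w (f : Omega * mR -> \bar R) : measurable_fun setT f ->
  (\int[kpath w]_z f z = \int[qv_measure T qM w]_(s in `]0%R, T]) f (w, s))%E.
Proof.
move=> mf; have mfw : measurable_fun setT (f \o slice w).
  exact: measurableT_comp (measurable_slice w).
have ge0 (g : Omega * mR -> \bar R) : measurable_fun setT g -> (forall z, 0 <= g z)%E ->
  (\int[kpath w]_z g z = \int[qv_measure T qM w]_(s in `]0%R, T]) g (w, s))%E.
  move=> mg g0; rewrite ge0_integral_pushforward//; last exact: measurable_slice.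
  rewrite preimage_setT integral_mrestr//.
  exact: measurableT_comp (measurable_slice w).
rewrite [LHS]integralE ge0//; last exact: measurable_funepos.
rewrite ge0//; last exact: measurable_funeneg.
by rewrite [RHS]integralE; congr (_ - _)%E; apply: eq_integral => s _; rewrite !unlock.
Qed.

Lemma ge0_integral_qvP (f : Omega * mR -> \bar R) : (forall z, 0 <= f z)%E ->
  measurable_fun setT f ->
  (\int[qvP]_z f z = \int[P]_w \int[qv_measure T qM w]_(s in `]0%R, T]) f (w, s))%E.
Proof.
move=> f0 mf; rewrite ge0_integral_mixture//; apply: eq_integral => w _.
exact: integral_kpath.
Qed.

Lemma Rintegral_qvP (f : Omega * mR -> R) : intble qvP f ->
  {ae P, forall w, (qv_measure T qM w).-integrable `]0, T] (EFin \o (fun s => f (w, s)))} /\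
  (\int[P]_w (\int[qv_measure T qM w]_(s in `]0%R, T]) f (w, s))%R%:E = (\int[qvP]_z f z)%R%:E)%E.
Proof.
move=> i_f; have [ae_f <-] := Rintegral_mixture i_f.
have mf : measurable_fun setT (EFin \o f) by have /integrableP[] := i_f.
split; last first.
  by apply: eq_integral => w _; congr EFin; rewrite /Rintegral integral_kpath.
apply: filterS ae_f => w /integrableP[_ H]; apply/integrableP; split.
  by apply: measurable_funTS; exact: (measurableT_comp mf (measurable_slice w)).
by move: H; rewrite integral_kpath//; exact: measurableT_comp.
Qed.

End quadratic_variation_measure.

(** * Predictable processes and the isometry for elementary processes *)

Section predictable.
Context {R : realType} {d : measure_display} {Omega : measurableType d}.
Variables (P : probability Omega R) (T : R) (T0 : 0 < T).
Variable F : filtration R Omega.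
Hypothesis uF : usual_conditions P T F.
Local Notation mR := (measurableTypeR R).

(** Here the predictable rectangles generate a sigma-algebra on all of R x Omega, whereas
    [predictable_sigma_algebra] lives on [0, T] x Omega. As a measurable type it gives access to the
    usual operations on measurable functions. *)
Definition predictable_space := g_sigma_algebraType (predictable_rectangles T F).
Definition time_domain : set predictable_space := `[0, T]%classic `*` [set: Omega].

Lemma measurable_time_domain : measurable time_domain.
Proof.
have F0 : F 0 setT.
  have zT : 0 <= (0 : R) <= T by rewrite lexx ltW.
  have [F0 FC _] := filtration_sigma uF zT.
  by have := FC _ F0; rewrite setD0.
have -> : time_domain = ([set 0] `*` setT) `|` (`]0, T]%classic `*` setT).
  apply/seteqP; split=> -[t w] /=; rewrite !in_itv/=.
    move=> [/= + _]; rewrite in_itv/= => /andP[].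
    rewrite le_eqVlt => /predU1P[<-|t0 tT]; first by left.
    by right; rewrite t0.
  case=> -[]; first by move=> -> _; split=> //=; rewrite in_itv/= lexx ltW.
  by move=> /andP[/ltW t0 tT] _; split=> //=; rewrite in_itv/= t0 tT.
apply: measurableU; apply: sub_sigma_algebra; first by left; exists setT.
by right; exists 0, T, setT; split=> //.
Qed.

(** The two generated families differ only in the set in which complements are taken. Intersecting
    with [time_domain], itself measurable, turns one complement into the other. *)
Lemma predictable_sigma_algebraE (C : set predictable_space) : C `<=` time_domain ->
  predictable_sigma_algebra T F C <-> measurable C.
Proof.
move=> CD; split; last first.
  have -> : predictable_sigma_algebra T F C = predictable_sigma_algebra T F (C `&` time_domain).
    by congr predictable_sigma_algebra; apply/esym/setIidPl.
  move: C {CD}; apply: smallest_sub; last first.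
    move=> C GC; have -> : C `&` time_domain = C.
      apply/setIidPl; case: GC => [[A _ ->]|[s [t [A [s0 st tT _ ->]]]]] [r w] /=.
        by move=> [-> _]; split=> //=; rewrite in_itv/= lexx ltW.
      rewrite in_itv/= => -[/andP[sr rt] _]; split=> //=.
      by rewrite in_itv/= (le_trans s0 (ltW sr)) (le_trans rt).
    exact: sub_sigma_algebra.
  split.
  - by rewrite set0I; exact: sigma_algebra0.
  - move=> A /= H; rewrite setTD setIC -setDE.
    have := sigma_algebraCD H; rewrite /predictable_sigma_algebra.
    by congr (<<s _, _ >> _); rewrite setDIr setDv setU0.
  - move=> A /= H; rewrite setI_bigcupl; exact: sigma_algebra_bigcup.
move: C {CD}; apply: smallest_sub; last exact: sub_sigma_algebra.
split=> [|A mA|A mA]; first exact: measurable0.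
  by apply: measurableD => //; exact: measurable_time_domain.
exact: bigcupT_measurable.
Qed.

Lemma predictableP (X : process R Omega) : predictable T F X <->
  measurable_fun time_domain (fun u : predictable_space => X u.1 u.2).
Proof.
split=> [H _ B mB|H B mB].
  apply/predictable_sigma_algebraE; first exact: subIsetl.
  exact: H.
apply/(predictable_sigma_algebraE (@subIsetl _ _ _)).
exact: (H measurable_time_domain).
Qed.

(** Predictable sets are product measurable. Coordinates are exchanged because processes take the
    time first, while mu lives on Omega x R. *)
Lemma measurable_swap_predictable :
  measurable_fun setT (fun z : Omega * mR => (z.2, z.1) : predictable_space).
Proof.
apply: (@measurability _ _ (Omega * mR)%type predictable_space setT _
  (predictable_rectangles T F)) => // _ [C GC <-]; rewrite setTI.
case: GC => [[A FA ->]|[s [t [A [s0 st tT FA ->]]]]].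
  rewrite (_ : _ @^-1` _ = A `*` [set 0]); last first.
    by apply/seteqP; split=> -[w r] /= [].
  apply: measurableX; last exact: measurable_set1.
  by apply: (filtration_measurable uF) FA; rewrite lexx ltW.
rewrite (_ : _ @^-1` _ = A `*` `]s, t]%classic); last first.
  by apply/seteqP; split=> -[w r] /= [].
apply: measurableX; last exact: measurable_itv.
by apply: (filtration_measurable uF) FA; rewrite s0 (le_trans (ltW st)).
Qed.

(** The cut to ]0, T] removes the time 0, which d<M> does not charge, and the times outside [0, T],
    where predictability says nothing about X. *)
Definition uncurried (X : process R Omega) (z : Omega * mR) : R :=
  \1_(`]0, T]%classic : set R) z.2 * X z.2 z.1.

Lemma measurable_indic_snd (A : set mR) : measurable A ->
  measurable_fun setT (fun z : Omega * mR => \1_A z.2 : R).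
Proof. by move=> mA; apply: measurableT_comp => //; exact: measurable_indic. Qed.

Lemma measurable_uncurried X : predictable T F X -> measurable_fun setT (uncurried X).
Proof.
move=> /predictableP mX.
have /(measurable_restrictT _ measurable_time_domain) mX' := mX.
have := measurableT_comp mX' measurable_swap_predictable.
move=> /(measurable_funM (measurable_indic_snd (measurable_itv0T T))).
congr measurable_fun; apply/funext => -[w r]; rewrite /uncurried/= indicE.
have [|] := boolP (r \in _); last by rewrite !mul0r.
rewrite inE/= in_itv/= => /andP[r0 rT]; rewrite !mul1r patchE mem_set//.
by split=> //=; rewrite in_itv/= ltW.
Qed.

Lemma predictableB X Y : predictable T F X -> predictable T F Y ->
  predictable T F (fun t w => X t w - Y t w).
Proof. by move=> /predictableP mX /predictableP mY; apply/predictableP/measurable_funB. Qed.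

Lemma predictableM X Y : predictable T F X -> predictable T F Y ->
  predictable T F (fun t w => X t w * Y t w).
Proof. by move=> /predictableP mX /predictableP mY; apply/predictableP/measurable_funM. Qed.

Lemma predictable_comp (h : R -> R) X : measurable_fun setT h -> predictable T F X ->
  predictable T F (fun t w => h (X t w)).
Proof. by move=> mh /predictableP mX; apply/predictableP; exact: measurableT_comp. Qed.

End predictable.

(** * Isometry for elementary integrands *)

Section ito_isometry.
Context {R : realType} {d : measure_display} {Omega : measurableType d}.
Variables (P : probability Omega R) (T : R) (T0 : 0 < T).
Variable F : filtration R Omega.
Hypothesis uF : usual_conditions P T F.
Variables (M qM : process R Omega).
Hypothesis martM : square_integrable_martingale P T F M.
Hypothesis qvM : is_predictable_quadratic_variation P T F M qM.
Local Notation mR := (measurableTypeR R).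

Let mart2 : martingale P T F (fun t w => M t w * M t w - qM t w).
Proof. by case: qvM => -[]. Qed.
Let zeroT : 0 <= (0 : R) <= T. Proof. by rewrite lexx ltW. Qed.
Let TinT : 0 <= T <= T. Proof. by rewrite lexx ltW. Qed.

Lemma qv_intble t : 0 <= t <= T -> intble P (qM t).
Proof.
move=> tT; have sM := sqmart_sqi martM tT.
have := intbleB (sqi_M sM sM) (mart_intble mart2 tT).
by congr (_.-integrable _ (EFin \o _)); apply/funext => w; ring.
Qed.

Lemma qv_measurable t : 0 <= t <= T -> measurable_fun setT (qM t).
Proof. by move=> /qv_intble/measurable_intble. Qed.

Lemma qv_cadlag : cadlag T qM. Proof. by case: qvM => -[]. Qed.

Lemma qv_nd w s t : 0 <= s -> s <= t -> t <= T -> qM s w <= qM t w.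
Proof. by case: qvM => _ + ? ? ?; apply. Qed.

Definition dPqv := qvP P T0 qv_measurable qv_cadlag qv_nd.

Lemma dPqv_fin : (dPqv setT < +oo)%E.
Proof.
have -> : dPqv setT = (\int[dPqv]_z cst 1%E z)%E by rewrite integral_cst// mul1e.
rewrite ge0_integral_qvP//.
rewrite (eq_integral (fun w => (qM T w - qM 0 w)%:E)).
  by apply: integrable_lty => //; apply: intbleB; exact: qv_intble.
move=> w _ /=.
rewrite integral_cst//.
by rewrite mul1e (qv_itv T0 qv_cadlag qv_nd)// ltW.
Qed.

Lemma indic_bound (A : set mR) r : `|\1_A r : R| <= 1.
Proof. by rewrite indicE; case: (_ \in _); rewrite ?normr1 ?normr0. Qed.

Lemma Rintegral_dPqv_itv (y : Omega -> R) K a b : measurable_fun setT y ->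
  (forall w, `|y w| <= K) -> 0 <= a -> a <= b -> b <= T ->
  \int[dPqv]_z (y z.1 * \1_(`]a, b]%classic : set R) z.2) = \int[P]_w (y w * (qM b w - qM a w)).
Proof.
move=> my yK a0 ab bT.
have aT : 0 <= a <= T by rewrite a0 (le_trans ab).
have bT' : 0 <= b <= T by rewrite bT (le_trans a0).
have iy : intble P (fun w => y w * (qM b w - qM a w)).
  by apply: intble_bM yK _ => //; apply: intbleB; exact: qv_intble.
have mab : measurable (`]a, b]%classic : set mR) by exact: measurable_itv.
have i1 : intble dPqv (fun z => y z.1 * \1_(`]a, b]%classic : set R) z.2).
  apply: (@intble_bnd _ _ _ _ _ `|K|); first exact: dPqv_fin.
  - by apply: measurable_funM; [exact: measurableT_comp|exact: measurable_indic_snd].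
  - move=> z; rewrite normrM -[`|K|]mulr1 ler_pM ?indic_bound//.
    exact: le_trans (yK _) (ler_norm _).
have [_ H] := Rintegral_qvP i1.
apply/EFin_inj; rewrite -H EFin_Rintegral//; apply: eq_integral => w _; congr EFin.
rewrite /= RintegralZl; last 2 first.
- exact: measurable_itv.
- apply: measurable_bounded_integrable.
  + exact: measurable_itv.
  + by rewrite (qv_itv T0 qv_cadlag qv_nd)// ?ltry// ltW.
  + exact: measurable_indic.
  + exists 1; split=> // x x1 r _; exact: le_trans (indic_bound _ _) (ltW x1).
congr (_ * _); rewrite /Rintegral integral_indic; [|exact: measurable_itv|exact: mab].
rewrite (_ : _ `&` _ = `]a, b]%classic).
  by rewrite (qv_itv T0 qv_cadlag qv_nd).
apply/setIidPl => r /=; rewrite !in_itv/= => /andP[ar rb].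
by rewrite (le_lt_trans a0 ar) (le_trans rb).
Qed.

(** Tested form of E[(M_b - M_a)^2 | F_a] = E[<M>_b - <M>_a | F_a]. In the expansion of the square
    the cross term y M_a (M_b - M_a) has expectation 0, and M^2 - <M> is a martingale. *)
Lemma sqr_increment (y : Omega -> R) K a b : fmeas (F a) y -> (forall w, `|y w| <= K) ->
  0 <= a -> a <= b -> b <= T ->
  \int[P]_w (y w * (M b w - M a w) ^+ 2) = \int[P]_w (y w * (qM b w - qM a w)).
Proof.
move=> fy yK a0 ab bT.
have aT : 0 <= a <= T by rewrite a0 (le_trans ab).
have bT' : 0 <= b <= T by rewrite bT (le_trans a0).
have my := fmeas_measurable uF aT fy.
have sMa := sqmart_sqi martM aT; have sMb := sqmart_sqi martM bT'.
have e1 := mart_test uF mart2 a0 ab bT fy yK.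
have fyM : fmeas (F a) (fun w => y w * M a w).
  by apply: (fmeasM (filtration_sigma uF aT)) => //; exact: mart_fmeas martM.1 aT.
have syM := sqi_bM my yK sMa.
have e2 := mart_orth uF martM a0 ab bT fyM syM.
have i1 := intble_bM my yK (mart_intble mart2 aT).
have i2 := intble_bM my yK (mart_intble mart2 bT').
have i3 := sqi_M syM (sqiB sMb sMa).
have i4 : intble P (fun w => y w * (qM b w - qM a w)).
  by apply: intble_bM yK _ => //; apply: intbleB; exact: qv_intble.
transitivity (\int[P]_w (y w * (M b w * M b w - qM b w)) - \int[P]_w (y w * (M a w * M a w - qM a w))
  - 2 * \int[P]_w (y w * M a w * (M b w - M a w)) + \int[P]_w (y w * (qM b w - qM a w))); last first.
  by rewrite e1 e2; ring.
rewrite -RintegralZl// -RintegralB// -RintegralB//; last 2 first.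
  exact: intbleB.
  exact: intbleZ.
rewrite -RintegralD//; last by apply: intbleB; [exact: intbleB|exact: intbleZ].
by apply: eq_Rintegral => w _; ring.
Qed.

Definition elem1_wf (p : (R * R) * (Omega -> R)) := [/\ 0 <= p.1.1, p.1.1 <= p.1.2, p.1.2 <= T,
      fmeas (F p.1.1) p.2 & exists K : R, forall w, `|p.2 w| <= K].

Lemma pair_isometry p q : elem1_wf p -> elem1_wf q ->
  \int[P]_w (p.2 w * (M p.1.2 w - M p.1.1 w) * (q.2 w * (M q.1.2 w - M q.1.1 w))) =
  \int[dPqv]_z (p.2 z.1 * \1_(`]p.1.1, p.1.2]%classic : set R) z.2 *
     (q.2 z.1 * \1_(`]q.1.1, q.1.2]%classic : set R) z.2)).
Proof.
wlog pq : p q / p.1.1 <= q.1.1 => [H wp wq|].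
  have [pq|/ltW qp] := leP p.1.1 q.1.1; first exact: H.
  have := H q p qp wq wp.
  under eq_Rintegral do rewrite mulrC.
  by under [in RHS]eq_Rintegral do rewrite mulrC.
case: p q pq => [[s t] x] [[s' t'] x'] /= ss' [/= s0 st tT fx [K xK]] [/= s'0 st' tT' fx' [K' xK']].
have sT : 0 <= s <= T by rewrite s0 (le_trans st).
have sT' : 0 <= s' <= T by rewrite s'0 (le_trans st').
have tTT : 0 <= t <= T by rewrite tT (le_trans s0).
have tTT' : 0 <= t' <= T by rewrite tT' (le_trans s'0).
have fm r := mart_fmeas martM.1 (t := r).
have sF r := filtration_sigma uF (t := r).
pose y w := x w * x' w.
have yK w : `|y w| <= K * K' by rewrite normrM ler_pM.
have mx := fmeas_measurable uF sT fx; have mx' := fmeas_measurable uF sT' fx'.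
have my : measurable_fun setT y by exact: measurable_funM.
have sM r := sqmart_sqi martM (t := r).
have fy : fmeas (F s') y.
  by apply: (fmeasM (sF _ sT')) => //; apply: (fmeas_le uF s0 ss'); case/andP: sT'.
(* Disjoint intervals: all factors but the increment over ]s', t'] are known at s', and the two
   indicators have product 0. *)
have [ts'|s't] := leP t s'.
  have H : fmeas (F s') (fun w => y w * (M t w - M s w)).
    apply: (fmeasM (sF _ sT')) => //; apply: (fmeasB (sF _ sT')).
      by apply: (fmeas_le uF _ ts'); [case/andP: tTT|case/andP: sT'|exact: fm].
    by apply: (fmeas_le uF s0 ss'); [case/andP: sT'|exact: fm].
  have H2 := mart_orth uF martM s'0 st' tT' H (sqi_bM my yK (sqiB (sM _ tTT) (sM _ sT))).
  transitivity (0 : R).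
    by rewrite -[RHS]H2; apply: eq_Rintegral => w _; rewrite /y; ring.
  rewrite (@eq_Rintegral _ _ _ dPqv setT (fun=> 0)) ?Rintegral_cst ?mul0r// => -[w r] _ /=.
  rewrite !indicE; case: (boolP (r \in `]s, t]%classic)) => [|_]; last by rewrite mulr0 mul0r.
  rewrite inE/= in_itv/= => /andP[_ rt]; rewrite [r \in `]s', t']%classic]memNset ?mulr0//.
  by rewrite /= in_itv/= ltNge (le_trans rt ts').
(* Overlapping intervals have intersection ]s', b], and both increments of M are split at s' and b.
   Three products vanish in expectation, the first factor times y being known where the second
   increment begins; (M_t - M_b)(M_t' - M_b) is 0 because b is t or t'. The square of M_b - M_s'
   remains and yields the mass of ]s', b]. *)
pose b := Num.min t t'.
have s'b : s' <= b by rewrite le_min (ltW s't).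
have bt : b <= t by rewrite /b ge_min lexx.
have bt' : b <= t' by rewrite /b ge_min lexx orbT.
have bT : b <= T by exact: le_trans tT.
have bTT : 0 <= b <= T by rewrite bT (le_trans s'0).
have s'T : s' <= T by case/andP: sT'.
rewrite [RHS](_ : _ = \int[dPqv]_z (y z.1 * \1_(`]s', b]%classic : set R) z.2)); last first.
  apply: eq_Rintegral => -[w r] _ /=; rewrite mulrACA; congr (_ * _).
  rewrite !indicE -natrM mulnb -in_setI; congr (_ (_ \in _))%:R.
  apply/seteqP; split=> u /=; rewrite !in_itv/= /b le_min.
    by move=> [/andP[_ ->] /andP[-> ->]].
  by move=> /andP[s'u /andP[-> ->]]; rewrite s'u (le_lt_trans ss').
rewrite (Rintegral_dPqv_itv my yK)// -(sqr_increment fy yK)//.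
have fC : fmeas (F s') (fun w => y w * (M s' w - M s w)).
  apply: (fmeasM (sF _ sT')) => //; apply: (fmeasB (sF _ sT')); first exact: fm.
  by apply: (fmeas_le uF s0 ss' s'T); exact: fm.
have fB : fmeas (F b) (fun w => y w * (M b w - M s' w)).
  apply: (fmeasM (sF _ bTT)); first exact: (fmeas_le uF s'0 s'b bT).
  apply: (fmeasB (sF _ bTT)); first exact: fm.
  by apply: (fmeas_le uF s'0 s'b bT); exact: fm.
have sA := sqiB (sM _ tTT) (sM _ bTT); have sD := sqiB (sM _ tTT') (sM _ bTT).
have sE := sqiB (sM _ tTT') (sM _ sT').
have sC := sqi_bM my yK (sqiB (sM _ sT') (sM _ sT)).
have sB' := sqiB (sM _ bTT) (sM _ sT'); have sB := sqi_bM my yK sB'.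
have o1 := mart_orth uF martM s'0 st' tT' fC sC.
have bt0 : 0 <= b by exact: le_trans s'b.
have o2 := mart_orth uF martM bt0 bt tT fB sB.
have o3 := mart_orth uF martM bt0 bt' tT' fB sB.
have iB : intble P (fun w => y w * (M b w - M s' w) ^+ 2) by apply: intble_bM yK (sqi_sqr sB').
have i1 := sqi_M sC sE; have i2 := sqi_M sB sA; have i3 := sqi_M sB sD.
transitivity (\int[P]_w (y w * (M s' w - M s w) * (M t' w - M s' w))
  + \int[P]_w (y w * (M b w - M s' w) * (M t w - M b w))
  + \int[P]_w (y w * (M b w - M s' w) * (M t' w - M b w))
  + \int[P]_w (y w * (M b w - M s' w) ^+ 2)); last by rewrite o1 o2 o3 !add0r.
rewrite -RintegralD// -RintegralD//; last exact: intbleD.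
rewrite -RintegralD//; last by apply: intbleD => //; exact: intbleD.
apply: eq_Rintegral => w _.
have : (M t w - M b w) * (M t' w - M b w) = 0.
  by rewrite /b; case: leP => _; rewrite subrr ?mulr0 ?mul0r.
rewrite /y => AD.
transitivity (x w * x' w * ((M t w - M b w) * (M t' w - M b w)) +
 (x w * x' w * (M s' w - M s w) * (M t' w - M s' w)
  + x w * x' w * (M b w - M s' w) * (M t w - M b w)
  + x w * x' w * (M b w - M s' w) * (M t' w - M b w)
  + x w * x' w * (M b w - M s' w) ^+ 2)); first by ring.
by rewrite AD mulr0 add0r.
Qed.

Definition uncurry_elem (e : @elementary R d Omega) (z : Omega * mR) : R :=
  elementary_process e z.2 z.1.

Lemma uncurry_elemE e z : uncurry_elem e z =
  \sum_(p <- e) (p.2 z.1 * \1_(`]p.1.1, p.1.2]%classic : set R) z.2).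
Proof.
apply: eq_bigr => p _; congr (_ * _); rewrite indicE; congr (nat_of_bool _)%:R.
by apply/idP/idP; rewrite inE/= in_itv.
Qed.

Lemma elementary_integral_T (e : @elementary R d Omega) w : elementary_wf T F e ->
  elementary_integral M e T w = \sum_(p <- e) p.2 w * (M p.1.2 w - M p.1.1 w).
Proof.
move=> we; apply: eq_big_seq => p /we[_ st tT _ _].
by rewrite !min_l// (le_trans st).
Qed.

Lemma elementary_wf_cons p (e : @elementary R d Omega) :
  elementary_wf T F (p :: e) -> elem1_wf p /\ elementary_wf T F e.
Proof.
move=> H; split; first by apply: H; rewrite inE eqxx.
by move=> q qe; apply: H; rewrite inE qe orbT.
Qed.

Lemma elem1_sqi p : elem1_wf p -> sqi P (fun w => p.2 w * (M p.1.2 w - M p.1.1 w)).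
Proof.
move=> [s0 st tT fx [K xK]].
have sT : 0 <= p.1.1 <= T by rewrite s0 (le_trans st).
have tTT : 0 <= p.1.2 <= T by rewrite tT (le_trans s0).
apply: sqi_bM xK _; first exact: (fmeas_measurable uF sT fx).
by apply: sqiB; exact: sqmart_sqi martM _.
Qed.

Lemma elem1_sqi_dPqv p : elem1_wf p ->
  sqi dPqv (fun z => p.2 z.1 * \1_(`]p.1.1, p.1.2]%classic : set R) z.2).
Proof.
move=> [s0 st tT fx [K xK]].
have sT : 0 <= p.1.1 <= T by rewrite s0 (le_trans st).
apply: (@sqi_bnd _ _ _ _ _ `|K|); first exact: dPqv_fin.
  apply: measurable_funM.
    by apply: measurableT_comp => //; exact: (fmeas_measurable uF sT fx).
  by apply: measurable_indic_snd; exact: measurable_itv.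
move=> z; rewrite normrM -[`|K|]mulr1 ler_pM ?indic_bound//.
exact: le_trans (xK _) (ler_norm _).
Qed.

Lemma elementary_sqi (e : @elementary R d Omega) : elementary_wf T F e ->
  sqi P (elementary_integral M e T).
Proof.
move=> we; have -> : elementary_integral M e T = (fun w => \sum_(p <- e) p.2 w * (M p.1.2 w - M p.1.1 w)).
  by apply/funext => w; exact: elementary_integral_T.
elim: e we => [|p e IH] we.
  under eq_fun do rewrite big_nil; split; first exact: measurable_cst.
  by under eq_integral do rewrite expr0n/=; rewrite integral0.
have [wp we'] := elementary_wf_cons we.
under eq_fun do rewrite big_cons; apply: sqiD; last exact: IH.
exact: elem1_sqi.
Qed.

Lemma uncurry_elem_sqi (e : @elementary R d Omega) : elementary_wf T F e ->
  sqi dPqv (uncurry_elem e).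
Proof.
move=> we; rewrite (funext (uncurry_elemE e)).
elim: e we => [|p e IH] we.
  under eq_fun do rewrite big_nil; split; first exact: measurable_cst.
  by under eq_integral do rewrite expr0n/=; rewrite integral0.
have [wp we'] := elementary_wf_cons we.
under eq_fun do rewrite big_cons; apply: sqiD; last exact: IH.
exact: elem1_sqi_dPqv.
Qed.

(** Stated for inner products instead of norms, since orthogonality pairs two different integrands;
    bilinearity reduces it to pairs of single terms. *)
Lemma elementary_isometry (e e' : @elementary R d Omega) :
  elementary_wf T F e -> elementary_wf T F e' ->
  \int[P]_w (elementary_integral M e T w * elementary_integral M e' T w) =
  \int[dPqv]_z (uncurry_elem e z * uncurry_elem e' z).
Proof.
move=> we we'.
have sI (e0 : @elementary R d Omega) : elementary_wf T F e0 ->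
    sqi P (fun w => \sum_(p <- e0) p.2 w * (M p.1.2 w - M p.1.1 w)).
  move=> we0; have := elementary_sqi we0.
  by congr (sqi _); apply/funext => w; exact: elementary_integral_T.
have sJ (e0 : @elementary R d Omega) : elementary_wf T F e0 -> sqi dPqv (fun z =>
    \sum_(p <- e0) (p.2 z.1 * \1_(`]p.1.1, p.1.2]%classic : set R) z.2)).
  move=> we0; have := uncurry_elem_sqi we0.
  by congr (sqi _); apply/funext => w; exact: uncurry_elemE.
rewrite (@eq_Rintegral _ _ _ P setT (fun w => (\sum_(p <- e) p.2 w * (M p.1.2 w - M p.1.1 w)) *
  (\sum_(p <- e') p.2 w * (M p.1.2 w - M p.1.1 w)))); last first.
  by move=> w _; rewrite !elementary_integral_T.
rewrite [RHS](@eq_Rintegral _ _ _ dPqv setT (fun z =>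
  (\sum_(p <- e) (p.2 z.1 * \1_(`]p.1.1, p.1.2]%classic : set R) z.2)) *
  (\sum_(p <- e') (p.2 z.1 * \1_(`]p.1.1, p.1.2]%classic : set R) z.2)))); last first.
  by move=> z _; rewrite !uncurry_elemE.
elim: e we => [|p e IH] we.
  under eq_Rintegral do rewrite big_nil mul0r.
  under [RHS]eq_Rintegral do rewrite big_nil mul0r.
  by rewrite !Rintegral_cst// !mul0r.
have {we}[wp we] := elementary_wf_cons we.
under eq_Rintegral do rewrite big_cons mulrDl.
under [RHS]eq_Rintegral do rewrite big_cons mulrDl.
rewrite RintegralD//; [|exact: sqi_M (elem1_sqi wp) (sI _ we')|exact: sqi_M (sI _ we) (sI _ we')].
rewrite [RHS]RintegralD//; [|exact: sqi_M (elem1_sqi_dPqv wp) (sJ _ we')|exact: sqi_M (sJ _ we) (sJ _ we')].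
rewrite IH//; congr (_ + _); clear IH.
elim: e' we' => [|q e' IH] we'.
  under eq_Rintegral do rewrite big_nil mulr0.
  under [RHS]eq_Rintegral do rewrite big_nil mulr0.
  by rewrite !Rintegral_cst// !mul0r.
have {we'}[wq we'] := elementary_wf_cons we'.
under eq_Rintegral do rewrite big_cons mulrDr.
under [RHS]eq_Rintegral do rewrite big_cons mulrDr.
rewrite RintegralD//; [|exact: sqi_M (elem1_sqi wp) (elem1_sqi wq)|exact: sqi_M (elem1_sqi wp) (sI _ we')].
rewrite [RHS]RintegralD//; [|exact: sqi_M (elem1_sqi_dPqv wp) (elem1_sqi_dPqv wq)|exact: sqi_M (elem1_sqi_dPqv wp) (sJ _ we')].
by rewrite IH// pair_isometry.
Qed.

End ito_isometry.

(** * Density of the elementary processes *)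

Section density.
Context {R : realType} {d : measure_display} {Omega : measurableType d}.
Variables (P : probability Omega R) (T : R) (T0 : 0 < T).
Variable F : filtration R Omega.
Hypothesis uF : usual_conditions P T F.
Variables (M qM : process R Omega).
Hypothesis martM : square_integrable_martingale P T F M.
Hypothesis qvM : is_predictable_quadratic_variation P T F M qM.
Local Notation mR := (measurableTypeR R).
Local Notation mu := (dPqv T0 martM qvM).
Local Notation PS := (predictable_space T F).

(** Membership in the closure of the elementary processes for the L^2(mu) distance. *)
Definition approx (g : Omega * mR -> R) := forall eps, 0 < eps ->
  exists e : @elementary R d Omega, elementary_wf T F e /\
    nsq mu (fun z => uncurry_elem e z - g z) <= eps.

Lemma uncurry_elem_nil z : uncurry_elem (@nil ((R * R) * (Omega -> R))) z = 0.
Proof. by rewrite uncurry_elemE big_nil. Qed.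

Lemma uncurry_elem_cat (e e' : @elementary R d Omega) z :
  uncurry_elem (e ++ e') z = uncurry_elem e z + uncurry_elem e' z.
Proof. by rewrite !uncurry_elemE big_cat. Qed.

Definition scale_elem c (e : @elementary R d Omega) : @elementary R d Omega :=
  [seq (p.1, fun w => c * p.2 w) | p <- e].

Lemma uncurry_elem_scale c (e : @elementary R d Omega) z :
  uncurry_elem (scale_elem c e) z = c * uncurry_elem e z.
Proof.
rewrite !uncurry_elemE big_map big_distrr/=; apply: eq_bigr => p _.
by rewrite mulrA.
Qed.

Lemma elementary_wf_cat (e e' : @elementary R d Omega) : elementary_wf T F e ->
  elementary_wf T F e' -> elementary_wf T F (e ++ e').
Proof. by move=> we we' p; rewrite mem_cat => /orP[/we|/we']. Qed.

Lemma elementary_wf_scale c (e : @elementary R d Omega) : elementary_wf T F e ->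
  elementary_wf T F (scale_elem c e).
Proof.
move=> we q /mapP[p /we[s0 st tT fx [K xK]] ->]; split=> //=.
  have sT : 0 <= p.1.1 <= T by rewrite s0 (le_trans st).
  have sF := filtration_sigma uF sT.
  by apply: (fmeasM sF) => //; exact: fmeas_cst.
by exists (`|c| * K) => w; rewrite normrM ler_wpM2l.
Qed.

Lemma approx_lin c g h : sqi mu g -> sqi mu h -> approx g -> approx h ->
  approx (fun z => c * g z + h z).
Proof.
move=> sg sh ag ah eps e0.
(* The squared norm of c a + b is at most 2 c^2 nsq a + 2 nsq b; with the bounds eps / (4 (c^2 + 1))
   and eps / 4 each summand is at most eps / 2. *)
have c0 : 0 < 4 * (c ^+ 2 + 1) by rewrite mulr_gt0// ltr_wpDl// sqr_ge0.
have [e1 [we1 H1]] := ag _ (divr_gt0 e0 c0).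
have [e2 [we2 H2]] := ah (eps / 4) (divr_gt0 e0 (ltr0n _ 4)).
exists (scale_elem c e1 ++ e2); split.
  by apply: elementary_wf_cat => //; exact: elementary_wf_scale.
have s1 := sqiB (uncurry_elem_sqi T0 uF martM qvM we1) sg.
have s2 := sqiB (uncurry_elem_sqi T0 uF martM qvM we2) sh.
rewrite (_ : (fun z => _) = (fun z => c * (uncurry_elem e1 z - g z) + (uncurry_elem e2 z - h z))); last first.
  by apply/funext => z; rewrite uncurry_elem_cat uncurry_elem_scale; ring.
rewrite (le_trans (nsqD_le (sqiZ c s1) s2))// nsqZ//.
have H3 : c ^+ 2 * nsq mu (fun z => uncurry_elem e1 z - g z) <= eps / 4.
  apply: (@le_trans _ _ (c ^+ 2 * (eps / (4 * (c ^+ 2 + 1))))).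
    by rewrite ler_wpM2l// sqr_ge0.
  have c1 : 0 < c ^+ 2 + 1 by rewrite ltr_wpDl// sqr_ge0.
  have -> : c ^+ 2 * (eps / (4 * (c ^+ 2 + 1))) = eps / 4 * (c ^+ 2 / (c ^+ 2 + 1)).
    by field; rewrite gt_eqF.
  rewrite ler_piMr ?divr_ge0 ?(ltW e0)//.
  by rewrite ler_pdivrMr// mul1r lerDl.
lra.
Qed.

Lemma approx_lim g : sqi mu g -> (forall eps, 0 < eps ->
    exists h, [/\ sqi mu h, approx h & nsq mu (fun z => h z - g z) <= eps]) ->
  approx g.
Proof.
move=> sg H eps e0.
have [h [sh ah hg]] := H (eps / 4) (divr_gt0 e0 (ltr0n _ 4)).
have [e [we eh]] := ah (eps / 4) (divr_gt0 e0 (ltr0n _ 4)).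
exists e; split=> //.
have s1 := sqiB (uncurry_elem_sqi T0 uF martM qvM we) sh.
rewrite (_ : (fun z => _) = (fun z => (uncurry_elem e z - h z) + (h z - g z))); last first.
  by apply/funext => z; ring.
by rewrite (le_trans (nsqD_le s1 (sqiB sh sg)))//; lra.
Qed.

Lemma approx_elem (e : @elementary R d Omega) g : elementary_wf T F e ->
  (forall z, uncurry_elem e z = g z) -> approx g.
Proof.
move=> we eg eps e0; exists e; split=> //.
rewrite /nsq; under eq_Rintegral do rewrite eg subrr expr0n.
by rewrite Rintegral_cst// mul0r ltW.
Qed.

Definition unc (f : PS -> R) := uncurried T (fun t w => f (t, w)).

Lemma measurable_unc (f : PS -> R) : measurable_fun setT f -> measurable_fun setT (unc f).
Proof.
move=> mf; apply: (measurable_uncurried T0 uF).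
apply/(predictableP T0 uF).
have -> : (fun u : PS => f (u.1, u.2)) = f by apply/funext => -[].
exact: measurable_funTS.
Qed.

Lemma unc_bounded (f : PS -> R) (K : R) : (forall u, `|f u| <= K) -> forall z, `|unc f z| <= K.
Proof.
move=> fK z; rewrite /unc/uncurried indicE; case: (_ \in _); rewrite ?mul1r//.
by rewrite mul0r normr0; apply: le_trans (fK point).
Qed.

Lemma unc_sqi (f : PS -> R) (K : R) : measurable_fun setT f -> (forall u, `|f u| <= K) -> sqi mu (unc f).
Proof.
move=> mf fK; apply: (sqi_bnd (K := K)); first exact: dPqv_fin.
  exact: measurable_unc.
exact: unc_bounded.
Qed.

Lemma indic_norm (U : Type) (A : set U) u : `|\1_A u : R| <= 1.
Proof. by rewrite indicE; case: (_ \in _); rewrite ?normr1 ?normr0. Qed.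

Lemma unc_indic_sqi (C : set PS) : measurable C -> sqi mu (unc \1_C).
Proof.
by move=> mC; apply: (unc_sqi (K := 1)); [exact: measurable_indic|exact: indic_norm].
Qed.

Lemma indic_setC_val (U : Type) (A : set U) u : \1_(~` A) u = 1 - \1_A u :> R.
Proof.
by rewrite !indicE in_setC; case: (_ \in _); rewrite /= ?subrr ?subr0.
Qed.

Lemma indic_setU_val (U : Type) (A B : set U) u : A `&` B = set0 ->
  \1_(A `|` B) u = \1_A u + \1_B u :> R.
Proof.
move=> AB; rewrite !indicE in_setU.
case: (boolP (u \in A)) => uA; case: (boolP (u \in B)) => uB; rewrite /= ?addr0 ?add0r//.
have : (A `&` B) u by split; exact/set_mem.
by rewrite AB.
Qed.

Lemma approx_setT : approx (unc \1_setT).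
Proof.
apply: (@approx_elem [:: ((0, T), fun=> 1)]).
  move=> p; rewrite inE => /eqP -> /=; split=> //; first exact: ltW.
    have zT : 0 <= (0 : R) <= T by rewrite lexx ltW.
    exact: (fmeas_cst (filtration_sigma uF zT)).
  by exists 1 => w; rewrite normr1.
by move=> z; rewrite uncurry_elemE big_seq1 /unc/uncurried/= indicT mulr1 mul1r.
Qed.

(** Dynkin induction from the predictable rectangles, which are stable under intersection and give
    elementary processes once cut to ]0, T]. *)
Lemma approx_indic (C : set PS) : measurable C -> approx (unc \1_C).
Proof.
apply: (@dynkin_induction _ PS (predictable_rectangles T F)
  (fun C => approx (unc \1_C))) => //.
- move=> A B [[A0 FA ->]|[s [t [A0 [s0 st tT FA ->]]]]].
  + case=> [[B0 FB ->]|[s' [t' [B0 [s0' st' tT' FB ->]]]]].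
      left; exists (A0 `&` B0); last by rewrite -setXI setIid.
      have zT : 0 <= (0 : R) <= T by rewrite lexx ltW.
      have := @measurableI _ (g_sigma_algebraType (F 0)) A0 B0.
      by rewrite /measurable/= (sigma_algebra_id (filtration_sigma uF zT)); apply.
    (* A rectangle over {0} and one over ]s, t] are disjoint; the empty set is itself written as a
       rectangle over {0}. *)
    left; exists set0.
      by have [] := filtration_sigma uF (_ : 0 <= (0 : R) <= T); rewrite ?lexx ?ltW.
    apply/seteqP; split=> -[r w] /=; last by case.
    move=> [[-> _] [+ _]].
    by rewrite in_itv/= ltNge s0'.
  + case=> [[B0 FB ->]|[s' [t' [B0 [s0' st' tT' FB ->]]]]].
      left; exists set0.
        by have [] := filtration_sigma uF (_ : 0 <= (0 : R) <= T); rewrite ?lexx ?ltW.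
      apply/seteqP; split=> -[r w] /=; last by case.
      move=> [[+ _] [r0 _]].
      by rewrite r0 in_itv/= ltNge s0.
    have [lt_|le_] := ltP (Num.max s s') (Num.min t t').
      right; exists (Num.max s s'), (Num.min t t'), (A0 `&` B0).
      have ssT : 0 <= Num.max s s' <= T.
        by rewrite le_max s0/= ge_max (le_trans (ltW st))// (le_trans (ltW st')).
      split=> //; [by case/andP: ssT|by rewrite ge_min tT| |].
        have := @measurableI _ (g_sigma_algebraType (F (Num.max s s'))) A0 B0.
        rewrite /measurable/= (sigma_algebra_id (filtration_sigma uF ssT)); apply.
          by apply: (filtration_le uF s0) FA; [rewrite le_max lexx|case/andP: ssT].
        by apply: (filtration_le uF s0') FB; [rewrite le_max lexx orbT|case/andP: ssT].
      rewrite -setXI; congr (_ `*` _); apply/seteqP; split=> r /=; rewrite !in_itv/= gt_max le_min.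
        by move=> [/andP[-> ->] /andP[-> ->]].
      by move=> /andP[/andP[-> ->] /andP[-> ->]].
    left; exists set0.
      by have [] := filtration_sigma uF (_ : 0 <= (0 : R) <= T); rewrite ?lexx ?ltW.
    apply/seteqP; split=> -[r w] /=; last by case.
    move=> [[+ _] [+ _]]; rewrite !in_itv/= => /andP[sr rt] /andP[sr' rt'].
    have : Num.max s s' < Num.min t t'.
      by apply: (@lt_le_trans _ _ r); rewrite ?gt_max ?sr ?sr'// le_min rt rt'.
    by rewrite ltNge le_.
- exact: approx_setT.
(* A rectangle over {0} is killed by the cut to ]0, T] and is matched by the empty list; a rectangle
   over ]s, t] is an elementary process with one term. *)
- move=> A [[A0 FA ->]|[s [t [A0 [s0 st tT FA ->]]]]].
    apply: (@approx_elem [::]) => // -[w r]; rewrite uncurry_elem_nil /unc/uncurried/=.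
    rewrite !indicE; case: (boolP (r \in _)); last by rewrite mul0r.
    rewrite inE/= in_itv/= => /andP[r0 _]; rewrite memNset ?mulr0// => -[/= r0' _].
    by move: r0; rewrite r0' ltxx.
  apply: (@approx_elem [:: ((s, t), \1_A0)]).
    move=> p; rewrite inE => /eqP -> /=; split=> //; first exact: ltW.
      apply: fmeas_indic => //; apply: (filtration_sigma uF).
      by rewrite s0 (le_trans (ltW st)).
    by exists 1 => w; exact: indic_norm.
  move=> [w r]; rewrite uncurry_elemE big_seq1 /unc/uncurried/=.
  rewrite !indicE in_setX/= -!natrM !mulnb; congr (nat_of_bool _)%:R.
  rewrite andbC andbA; congr (_ && _); apply/idP/andP => [|[]//].
  rewrite !inE/= !in_itv/= => /andP[sr rt]; split=> //; last by rewrite sr.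
  by rewrite (le_lt_trans s0 sr) (le_trans rt).
- move=> S mS aS.
  have := approx_lin (-1) (unc_indic_sqi mS) (unc_indic_sqi measurableT) aS approx_setT.
  congr approx; apply/funext => z.
  by rewrite /unc/uncurried indic_setC_val indicT /cst; ring.
- move=> G mG tG aG.
  pose U := \bigcup_n G n; have mU : measurable U by exact: bigcupT_measurable.
  pose V n := \big[setU/set0]_(i < n) G i.
  have mV n : measurable (V n) by exact: bigsetU_measurable.
  have aV n : approx (unc \1_(V n)).
    elim: n => [|n IH].
      apply: (@approx_elem [::]) => // z; rewrite uncurry_elem_nil /unc/uncurried.
      by rewrite /V big_ord0 indic0/= mulr0.
    have := approx_lin 1 (unc_indic_sqi (mV n)) (unc_indic_sqi (mG n)) IH (aG n).
    congr approx; apply/funext => z; rewrite /unc/uncurried.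
    rewrite /V big_ord_recr/= indic_setU_val; first by rewrite mul1r mulrDr.
    rewrite big_distrl/= big1// => i _.
    have /trivIsetP := tG; apply=> //; by rewrite neq_ltn ltn_ord.
  apply: approx_lim; first exact: unc_indic_sqi.
  (* The complement of U is added so that every point eventually lies in B n, as [nsq_trunc_cvg]
     requires; on U nothing changes, and the indicator of U cut by B n is that of V n. *)
  pose B n : set (Omega * mR) := (fun z => (z.2, z.1) : PS) @^-1` (V n `|` ~` U).
  have mB n : measurable (B n).
    rewrite -[B n]setTI; apply: (measurable_swap_predictable T0 uF) => //.
    by apply: measurableU => //; exact: measurableC.
  have VU n u : V n u -> U u.
    by rewrite /V -bigcup_mkord => -[i _ Gi]; exists i.
  have Bz z : \forall n \near \oo, B n z.
    have [[i _ Gi]|Uz] := pselect (U (z.2, z.1)); last by apply: nearW => n; right.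
    exists i.+1 => // n /= ni; left; rewrite /V -bigcup_mkord; exists i => //.
  have sU := unc_indic_sqi mU.
  have := nsq_trunc_cvg sU mB Bz.
  move/cvgr0Pnorm_le => H eps e0; have [n _ /(_ n (leqnn n)) Hn] := H _ e0.
  exists (unc \1_(V n)); split=> //; first exact: unc_indic_sqi.
  move: Hn; rewrite ger0_norm ?nsq_ge0//; congr (nsq _ _ <= _).
  apply/funext => z; congr (_ - _); rewrite /unc/uncurried mulrCA; congr (_ * _).
  rewrite !indicE -natrM mulnb; congr (nat_of_bool _)%:R; apply/idP/idP.
    move=> /andP[/set_mem [Vz|nU] /set_mem Uz]; [exact/mem_set|by []].
  by move=> /set_mem Vz; apply/andP; split; apply/mem_set; [left|exact: VU Vz].
Qed.

Lemma approx_bounded (f : PS -> R) (K : R) : measurable_fun setT f ->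
  (forall u, `|f u| <= K) -> approx (unc f).
Proof.
move=> mf fK.
suff [] : [/\ measurable_fun setT f, (exists K, forall u, `|f u| <= K) & approx (unc f)] by [].
apply: (bounded_ind (Pr := fun f : PS -> R =>
  [/\ measurable_fun setT f, (exists K, forall u, `|f u| <= K) & approx (unc f)]) fK).
- split=> //; first by exists 0 => u; rewrite normr0.
  by apply: (@approx_elem [::]) => // z; rewrite uncurry_elem_nil /unc/uncurried mulr0.
- move=> c g h [mg [K1 gK] ag] [mh [K2 hK] ah]; split.
  + by apply: measurable_funD => //; exact: measurable_funM.
  + exists (`|c| * K1 + K2) => u; rewrite (le_trans (ler_normD _ _))// lerD//.
    by rewrite normrM ler_wpM2l.
  + have := approx_lin c (unc_sqi mg gK) (unc_sqi mh hK) ag ah.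
    by congr approx; apply/funext => z; rewrite /unc/uncurried; ring.
- move=> B mB; have mC : measurable (f @^-1` B).
    by rewrite -[f @^-1` B]setTI; exact: mf.
  split; [exact: (measurable_indic mC)| |exact: (approx_indic mC)].
  by exists 1 => u; exact: indic_norm.
- move=> H; split=> //; first by exists K.
  apply: approx_lim; first exact: unc_sqi mf fK.
  move=> eps e0.
  (* A uniform error sqrt(eps / m) has squared norm at most (eps / m) mu(setT) <= eps; the added 1
     keeps m positive. *)
  pose m := fine (mu setT) + 1; have m0 : 0 < m by rewrite ltr_wpDl// fine_ge0.
  have sq0 : 0 < Num.sqrt (eps / m) by rewrite sqrtr_gt0 divr_gt0.
  have [g [[mg [K1 gK] ag] fg]] := H _ sq0.
  exists (unc g); split=> //; first exact: unc_sqi mg gK.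
  have em0 : 0 <= eps / m by rewrite divr_ge0// ltW.
  apply: (@le_trans _ _ (\int[mu]_z (eps / m))).
    apply: le_Rintegral => //.
    + by apply: sqi_sqr; apply: sqiB; [exact: unc_sqi mg gK|exact: unc_sqi mf fK].
    + by apply: (@intble_bnd _ _ _ _ _ (eps / m)) => //;
        [exact: dPqv_fin|move=> z; rewrite ger0_norm].
    + move=> z _; rewrite -[leRHS]sqr_sqrtr// -[leLHS]real_normK ?num_real//.
      rewrite lerXn2r ?nnegrE ?sqrtr_ge0// distrC.
      rewrite /unc/uncurried -mulrBr normrM.
      by rewrite -[leRHS]mul1r ler_pM ?indic_norm.
  by rewrite Rintegral_cst// mulrAC ler_pdivrMr// ler_wpM2l ?ltW// /m ltrDl.
Qed.

Lemma approx_predictable phi : predictable T F phi -> sqi mu (uncurried T phi) ->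
  approx (uncurried T phi).
Proof.
move=> /(predictableP T0 uF) mphi sphi.
pose D := @time_domain R d Omega T F.
have mD : measurable D := measurable_time_domain T0 uF.
(* Extension by 0 outside [0, T] makes phi measurable on all of [PS] and leaves [uncurried]
   unchanged. *)
pose f : PS -> R := (fun u => phi u.1 u.2) \_ D.
have mf : measurable_fun setT f by apply/(measurable_restrictT _ mD).
have uf : uncurried T phi = unc f.
  apply/funext => -[w r]; rewrite /unc/uncurried/= indicE.
  have [|] := boolP (r \in _); last by rewrite !mul0r.
  rewrite inE/= in_itv/= => /andP[r0 rT]; rewrite !mul1r /f patchE mem_set//.
  by split=> //=; rewrite in_itv/= ltW.
rewrite uf in sphi *.
apply: approx_lim => //.
pose A n := [set u | `|f u| <= n%:R].
have mA n : measurable (A n).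
  have := measurableT_comp (@normr_measurable R setT) mf.
  move=> /(_ measurableT (`]-oo, n%:R])%classic (measurable_itv _)).
  by rewrite setTI; congr measurable; apply/seteqP; split=> u /=; rewrite in_itv.
pose B n : set (Omega * mR) := (fun z => (z.2, z.1) : PS) @^-1` (A n).
have mB n : measurable (B n).
  by rewrite -[B n]setTI; exact: (measurable_swap_predictable T0 uF).
have Bz z : \forall n \near \oo, B n z.
  exists (Num.trunc `|f (z.2, z.1)|).+1 => // n /= nY.
  by rewrite /B/A/= ltW// (lt_le_trans (truncnS_gt _))// ler_nat.
have := nsq_trunc_cvg sphi mB Bz.
move/cvgr0Pnorm_le => H eps e0; have [n _ /(_ n (leqnn n)) Hn] := H _ e0.
pose g u := \1_(A n) u * f u.
have mg : measurable_fun setT g by apply: measurable_funM => //; exact: measurable_indic.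
have gK u : `|g u| <= n%:R.
  rewrite /g indicE; case: (boolP (u \in A n)); last by rewrite mul0r normr0.
  by rewrite inE mul1r.
exists (unc g); split; [exact: unc_sqi mg gK|exact: approx_bounded mg gK|].
move: Hn; rewrite ger0_norm ?nsq_ge0//; congr (nsq _ _ <= _).
apply/funext => z; congr (_ - _); rewrite /unc/uncurried mulrCA; congr (_ * _).
Qed.

End density.

(** * Uniform limits of martingales *)

Section cadlag_paths.
Context {R : realType} (T : R).
Implicit Types g h : R -> R.

Lemma cadlag_path_cst c : cadlag_path T (fun=> c).
Proof. by split=> t _; [exact: cvg_cst|apply/cvg_ex; exists c; exact: cvg_cst]. Qed.

Lemma cadlag_pathD g h : cadlag_path T g -> cadlag_path T h ->
  cadlag_path T (fun t => g t + h t).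
Proof.
move=> [g1 g2] [h1 h2]; split=> t tT; first by apply: cvgD; [exact: g1|exact: h1].
apply/cvg_ex; exists (lim (g r @[r --> t^'-]) + lim (h r @[r --> t^'-])).
by apply: cvgD; [exact: g2|exact: h2].
Qed.

Lemma cadlag_pathZ c g : cadlag_path T g -> cadlag_path T (fun t => c * g t).
Proof.
move=> [g1 g2]; split=> t tT; first by apply: cvgM; [exact: cvg_cst|exact: g1].
apply/cvg_ex; exists (c * lim (g r @[r --> t^'-])).
by apply: cvgM; [exact: cvg_cst|exact: g2].
Qed.

Lemma cadlag_path_stop g b : cadlag_path T g -> cadlag_path T (fun t => g (Num.min b t)).
Proof.
move=> [g1 g2]; split=> t tT.
  have [tb|bt] := ltP t b.
    apply: cvg_trans (g1 _ tT); apply: near_eq_cvg; near=> r.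
    by rewrite min_r//; near: r; exact: nbhs_right_le.
  by apply: cvg_near_cst; near=> r; rewrite min_l// (le_trans bt).
have [bt|tb] := ltP b t.
  apply/cvg_ex; exists (g b); apply: cvg_near_cst; near=> r.
  by rewrite min_l//; near: r; exact: nbhs_left_ge.
apply/cvg_ex; exists (lim (g r @[r --> t^'-])).
apply: cvg_trans (g2 _ tT); apply: near_eq_cvg; near=> r.
by rewrite min_r// (le_trans _ tb).
Unshelve. all: by end_near. Qed.

(** The left limit of g is not known in advance: it comes from the Cauchy criterion, with the left
    limit of a uniformly close g_n as centre of the ball. *)
Lemma cadlag_path_ulim (g_ : nat -> R -> R) g : (forall n, cadlag_path T (g_ n)) ->
  (forall e, 0 < e -> exists n, forall t, 0 <= t <= T -> `|g_ n t - g t| <= e) ->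
  cadlag_path T g.
Proof.
move=> cg ug; split=> t tT.
  apply/cvgrPdist_lt => e e0.
  have e4 : 0 < e / 4 by rewrite divr_gt0.
  have [n un] := ug _ e4.
  have /cvgrPdist_lt/(_ _ e4) gn := (cg n).1 t tT.
  have /andP[t0 tT'] := tT.
  near=> r.
  have h1 : `|g_ n t - g t| <= e / 4 by apply: un; rewrite t0 ltW.
  have h2 : `|g_ n r - g r| <= e / 4.
    apply: un; apply/andP; split; first by rewrite (le_trans t0).
    by near: r; exact: nbhs_right_le.
  have h3 : `|g_ n t - g_ n r| < e / 4 by near: r.
  rewrite (_ : g t - g r = - (g_ n t - g t) + (g_ n t - g_ n r) + (g_ n r - g r)); last by ring.
  apply: le_lt_trans (ler_normD _ _) _.
  have := ler_normD (- (g_ n t - g t)) (g_ n t - g_ n r); rewrite normrN; lra.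
apply/cauchy_cvgP; apply: cauchy_exP => e e0.
have e4 : 0 < e / 4 by rewrite divr_gt0.
have [n un] := ug _ e4.
have /cvgrPdist_lt/(_ _ e4) gn := (cg n).2 t tT.
exists (lim (g_ n r @[r --> t^'-])).
have /andP[t0 tT'] := tT.
suff : \forall r \near t^'-, ball (lim (g_ n r @[r --> t^'-])) e (g r) by [].
near=> r; rewrite /ball/=.
have h2 : `|g_ n r - g r| <= e / 4.
  apply: un; apply/andP; split; last by rewrite (le_trans _ tT').
  by near: r; exact: nbhs_left_ge.
have h3 : `|lim (g_ n r @[r --> t^'-]) - g_ n r| < e / 4 by near: r.
rewrite (_ : _ - g r = (lim (g_ n r @[r --> t^'-]) - g_ n r) + (g_ n r - g r)); last by ring.
by apply: le_lt_trans (ler_normD _ _) _; lra.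
Unshelve. all: by end_near. Qed.

End cadlag_paths.

(** * Square-integrable martingales: linearity, elementary integrals, limits *)

Section sq_martingales.
Context {R : realType} {d : measure_display} {Omega : measurableType d}.
Variables (P : probability Omega R) (T : R) (T0 : 0 < T).
Variable F : filtration R Omega.
Hypothesis uF : usual_conditions P T F.
Implicit Types X Y M : process R Omega.

Lemma indic_norm1 (A : set Omega) w : `|\1_A w : R| <= 1.
Proof. by rewrite indicE; case: (_ \in _); rewrite ?normr1 ?normr0. Qed.

Lemma expectation_sqr_lty (f : Omega -> R) : measurable_fun setT f ->
  ('E_P[(fun w => f w ^+ 2)%R] < +oo)%E <-> sqi P f.
Proof. by move=> mf; rewrite unlock; split=> [H|[]//]. Qed.

(** Square integrability contains the integrability clause, and the martingale property becomes an
    equality of real integrals, suited to linear combinations and L^2 limits. *)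
Lemma sqmartP X : square_integrable_martingale P T F X <->
  [/\ forall t, 0 <= t <= T -> fmeas (F t) (X t), cadlag T X,
      forall t, 0 <= t <= T -> sqi P (X t)
    & forall s t A, 0 <= s -> s <= t -> t <= T -> F s A ->
      \int[P]_w (\1_A w * X t w) = \int[P]_w (\1_A w * X s w)].
Proof.
split=> [mX|[aX cX sX HX]].
  split.
  - by move=> t; exact: mart_fmeas mX.1.
  - by case: mX => -[].
  - by move=> t; exact: sqmart_sqi mX.
  - by move=> s t A; exact: mart_indic mX.1.
have iX t : 0 <= t <= T -> intble P (X t).
  by move=> /sX; apply: intble_of_sqi; rewrite ltey_eq fin_num_measure.
split; last first.
  by move=> t tT; apply/expectation_sqr_lty; [exact: (fmeas_measurable uF tT (aX t tT))|exact: sX].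
split=> //.
move=> s t s0 st tT A FA.
have sT : 0 <= s <= T by rewrite s0 (le_trans st).
have tT' : 0 <= t <= T by rewrite tT (le_trans s0).
have mA : measurable A by exact: filtration_measurable uF _ sT _ FA.
have e r : 0 <= r <= T -> (\int[P]_(w in A) (X r w)%:E)%E = (\int[P]_w (\1_A w * X r w))%:E.
  move=> rT; rewrite Rintegral_indic_setI /Rintegral fineK//.
  by apply: integrable_fin_num => //; apply: integrableS (iX r rT).
by rewrite !e// (HX s t).
Qed.

Lemma sqmart_lin c X Y : square_integrable_martingale P T F X ->
  square_integrable_martingale P T F Y ->
  square_integrable_martingale P T F (fun t w => c * X t w + Y t w).
Proof.
move=> mX mY; move: (mX) (mY) => /sqmartP[aX cX sX HX] /sqmartP[aY cY sY HY].
apply/sqmartP; split.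
- move=> t tT; have sF := filtration_sigma uF tT.
  apply: (fmeasD sF); last exact: aY.
  by apply: (fmeasM sF); [exact: fmeas_cst|exact: aX].
- by move=> w; apply: cadlag_pathD => //; exact: cadlag_pathZ.
- by move=> t tT; apply: sqiD; [apply: sqiZ; exact: sX|exact: sY].
- move=> s t A s0 st tT FA.
  have sT : 0 <= s <= T by rewrite s0 (le_trans st).
  have tT' : 0 <= t <= T by rewrite tT (le_trans s0).
  have mA : measurable A by exact: filtration_measurable uF _ sT _ FA.
  have e r : 0 <= r <= T -> \int[P]_w (\1_A w * (c * X r w + Y r w)) =
      c * \int[P]_w (\1_A w * X r w) + \int[P]_w (\1_A w * Y r w).
    move=> rT.
    have iX := intble_bM (measurable_indic mA) (@indic_norm1 A) (mart_intble mX.1 rT).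
    have iY := intble_bM (measurable_indic mA) (@indic_norm1 A) (mart_intble mY.1 rT).
    rewrite -RintegralZl// -RintegralD//; last exact: intbleZ.
    by apply: eq_Rintegral => w _; ring.
  by rewrite !e// (HX s t)// (HY s t).
Qed.

Lemma sqmart0 : square_integrable_martingale P T F (fun _ _ => 0).
Proof.
apply/sqmartP; split=> //.
- by move=> t tT; exact: (fmeas_cst (filtration_sigma uF tT)).
- by move=> w; exact: cadlag_path_cst.
- move=> t tT; apply: (@sqi_bnd _ _ _ P _ 0) => //; first by rewrite ltey_eq fin_num_measure.
  by move=> _; rewrite normr0.
Qed.

Lemma sqmartB X Y : square_integrable_martingale P T F X ->
  square_integrable_martingale P T F Y ->
  square_integrable_martingale P T F (fun t w => X t w - Y t w).
Proof.
move=> mX mY; have := sqmart_lin (-1) mY mX.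
by congr square_integrable_martingale; apply/funext => t; apply/funext => w; ring.
Qed.

(** Between u and v the process moves by x times the increment of M over the part of [u, v] lying in
    [s, b]. Either this part is trivial, or it starts at the larger of u and s, where both x and the
    event A are known, and [mart_orth] applies. *)
Lemma sqmart_elem1 M (s b : R) (x : Omega -> R) (K : R) :
  square_integrable_martingale P T F M -> 0 <= s -> s <= b -> b <= T ->
  fmeas (F s) x -> (forall w, `|x w| <= K) ->
  square_integrable_martingale P T F (fun t w => x w * (M (Num.min b t) w - M (Num.min s t) w)).
Proof.
move=> mM s0 sb bT fx xK; move: (mM) => /sqmartP[aM cM sM HM].
have sT : 0 <= s <= T by rewrite s0 (le_trans sb).
have b0 : 0 <= b by exact: le_trans sb.
have mx := fmeas_measurable uF sT fx.
have minT c t : 0 <= c -> 0 <= t <= T -> 0 <= Num.min c t <= T.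
  by move=> c0 /andP[t0 tT]; rewrite le_min c0 t0 ge_min tT orbT.
have sI t : 0 <= t <= T -> sqi P (fun w => x w * (M (Num.min b t) w - M (Num.min s t) w)).
  by move=> tT; apply: sqi_bM xK _ => //; apply: sqiB; apply: sM; exact: minT.
have iI t : 0 <= t <= T -> intble P (fun w => x w * (M (Num.min b t) w - M (Num.min s t) w)).
  by move=> tT; apply: intble_of_sqi; [rewrite ltey_eq fin_num_measure|exact: sI].
apply/sqmartP; split=> //.
- move=> t tT; have sF := filtration_sigma uF tT; have /andP[t0 tT'] := tT.
  (* Up to time s the value is 0; x, which is only F_s-measurable, enters after s. *)
  have [ts|st] := leP t s.
    rewrite (_ : (fun w => _) = (fun=> 0)); first exact: fmeas_cst.
    by apply/funext => w; rewrite !min_r ?subrr ?mulr0// (le_trans ts).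
  apply: (fmeasM sF); first exact: (fmeas_le uF s0 (ltW st)).
  have fM c : 0 <= c -> fmeas (F t) (M (Num.min c t)).
    move=> c0; have /andP[m0 mT] := minT c t c0 tT.
    by apply: (fmeas_le uF m0 _ tT'); [rewrite ge_min lexx orbT|apply: aM; exact: minT].
  apply: (fmeasB sF); first exact: fM.
  by apply: (fmeas_le uF s0 (ltW st) tT'); exact: aM.
- move=> w; apply: cadlag_pathZ.
  have cs := cadlag_pathZ (-1) (cadlag_path_stop s (cM w)).
  have := cadlag_pathD (cadlag_path_stop b (cM w)) cs.
  by congr cadlag_path; apply/funext => t; rewrite mulN1r.
- move=> u v A u0 uv vT FA.
  have uT : 0 <= u <= T by rewrite u0 (le_trans uv).
  have vT' : 0 <= v <= T by rewrite vT (le_trans u0).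
  have mA : measurable A by exact: filtration_measurable uF _ uT _ FA.
  have mu1 := measurable_indic mA (D := setT) (R := R).
  apply/eqP; rewrite -subr_eq0 -RintegralB//; last 2 first.
  - by apply: intble_bM (@indic_norm1 A) _ => //; exact: iI.
  - by apply: intble_bM (@indic_norm1 A) _ => //; exact: iI.
  apply/eqP.
  have [vs|sv] := leP v s.
    have us : u <= s by exact: le_trans vs.
    rewrite (@eq_Rintegral _ _ _ P setT (fun=> 0)) ?Rintegral_cst ?mul0r// => w _.
    by rewrite ?(min_r us) ?(min_r (le_trans vs sb)) ?(min_r (le_trans us sb)); ring.
  have [us|su] := leP u s.
    have fY : fmeas (F s) (fun w => \1_A w * x w).
      have sF := filtration_sigma uF sT.
      apply: (fmeasM sF) => //; apply: (fmeas_indic sF).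
      by apply: (filtration_le uF u0 us) FA; case/andP: sT.
    have sY : sqi P (fun w => \1_A w * x w).
      apply: sqi_bM (@indic_norm1 A) _ => //.
      by apply: (@sqi_bnd _ _ _ P _ K) => //; rewrite ltey_eq fin_num_measure.
    have sbv : s <= Num.min b v by rewrite le_min sb ltW.
    have bvT : Num.min b v <= T by rewrite ge_min bT.
    have := mart_orth uF mM s0 sbv bvT fY sY.
    move=> <-; apply: eq_Rintegral => w _.
    by rewrite ?(min_l (ltW sv)) ?(min_r us) ?(min_r (le_trans us sb)); ring.
  have [bu|ub] := leP b u.
    rewrite (@eq_Rintegral _ _ _ P setT (fun=> 0)) ?Rintegral_cst ?mul0r// => w _.
    by rewrite ?(min_l bu) ?(min_l (le_trans bu uv)) ?(min_l (ltW su)) ?(min_l (ltW sv)); ring.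
  have fY : fmeas (F u) (fun w => \1_A w * x w).
    have sF := filtration_sigma uF uT.
    apply: (fmeasM sF); first exact: (fmeas_indic sF).
    by apply: (fmeas_le uF s0 (ltW su)) fx; case/andP: uT.
  have sY : sqi P (fun w => \1_A w * x w).
    apply: sqi_bM (@indic_norm1 A) _ => //.
    by apply: (@sqi_bnd _ _ _ P _ K) => //; rewrite ltey_eq fin_num_measure.
  have sbv : u <= Num.min b v by rewrite le_min (ltW ub).
  have bvT : Num.min b v <= T by rewrite ge_min bT.
  have := mart_orth uF mM u0 sbv bvT fY sY.
  move=> <-; apply: eq_Rintegral => w _.
  by rewrite ?(min_r (ltW ub)) ?(min_l (ltW su)) ?(min_l (ltW sv)); ring.
Qed.

Lemma sqmart_elementary M (e : @elementary R d Omega) :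
  square_integrable_martingale P T F M -> elementary_wf T F e ->
  square_integrable_martingale P T F (elementary_integral M e).
Proof.
move=> mM; elim: e => [|p e IH] we.
  rewrite (_ : elementary_integral _ _ = (fun _ _ => 0)); first exact: sqmart0.
  by apply/funext => t; apply/funext => w; rewrite /elementary_integral big_nil.
have [s0 st tT fx [K xK]] := we p (mem_head _ _).
have we' : elementary_wf T F e by move=> q qe; apply: we; rewrite inE qe orbT.
have := sqmart_lin 1 (sqmart_elem1 mM s0 st tT fx xK) (IH we').
congr square_integrable_martingale; apply/funext => t; apply/funext => w.
by rewrite /elementary_integral big_cons mul1r.
Qed.

(** Since [cadlag] and the uniform convergence in [sqmart_lim] concern every path, exceptional paths
    are set to 0; adaptedness survives because null sets belong to every F_t. *)
Lemma sqmart_restrict X (G : set Omega) : square_integrable_martingale P T F X ->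
  measurable G -> P (~` G) = 0%E ->
  square_integrable_martingale P T F (fun t w => \1_G w * X t w).
Proof.
move=> mX mG G0; move: (mX) => /sqmartP[aX cX sX HX].
have FG t : 0 <= t <= T -> F t G.
  move=> tT; have [_ FC _] := filtration_sigma uF tT.
  have := FC (~` G); rewrite setTD setCK; apply.
  by apply: (negligible_filtration uF tT); apply/negligibleP => //; exact: measurableC.
have aeG : {ae P, forall w, \1_G w = 1 :> R}.
  exists (~` G); split=> //; first exact: measurableC.
  by move=> w /= H Gw; apply: H; rewrite indicE mem_set.
have m1 := measurable_indic mG (D := setT) (R := R).
apply/sqmartP; split.
- move=> t tT; have sF := filtration_sigma uF tT.
  by apply: (fmeasM sF); [apply: (fmeas_indic sF); exact: FG|exact: aX].
- by move=> w; apply: cadlag_pathZ; exact: cX.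
- by move=> t tT; apply: sqi_bM (@indic_norm1 G) _ => //; exact: sX.
- move=> s t A s0 st tT FA.
  have e (f : Omega -> R) : \int[P]_w (\1_A w * (\1_G w * f w)) = \int[P]_w (\1_A w * f w).
    rewrite /Rintegral; congr fine; apply: ae_eq_integral_nonmeas.
    by apply: filterS aeG => w ->; rewrite mul1r.
  by rewrite !e (HX s t).
Qed.

(** Uniform convergence of the paths gives adaptedness and cadlag paths. The Cauchy property is
    assumed at T only; [mart_sqi] carries it to every t, and L^2 convergence preserves the
    martingale property. *)
Lemma sqmart_lim (X_ : nat -> process R Omega) X :
  (forall n, square_integrable_martingale P T F (X_ n)) ->
  (forall w e, 0 < e -> exists N, forall n t, (N <= n)%N -> 0 <= t <= T -> `|X_ n t w - X t w| <= e) ->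
  (forall e, 0 < e -> exists N, forall n m, (N <= n)%N -> (N <= m)%N ->
    nsq P (fun w => X_ n T w - X_ m T w) <= e) ->
  square_integrable_martingale P T F X /\
  (nsq P (fun w => X_ n T w - X T w) @[n --> \oo] --> 0).
Proof.
move=> mX uX cauX.
have cX t w : 0 <= t <= T -> X_ n t w @[n --> \oo] --> X t w.
  move=> tT; apply/cvgrPdist_le => e e0; have [N HN] := uX w e e0.
  by exists N => // n /= Nn; rewrite distrC HN.
have TT : 0 <= T <= T by rewrite ltW/=.
have sX_ n t : 0 <= t <= T -> sqi P (X_ n t) by exact: sqmart_sqi (mX n).
have bnd t e : 0 <= t <= T -> 0 < e -> exists N, forall n, (N <= n)%N ->
    sqi P (fun w => X_ n t w - X t w) /\ nsq P (fun w => X_ n t w - X t w) <= e.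
  move=> tT e0; have [N HN] := cauX e e0; exists N => n Nn.
  (* Fatou in the second index. The bound at t comes from the one at T, the difference being a
     martingale, and the shift by N makes the Cauchy estimate hold for all m. *)
  apply: (L2_fatou (f_ := fun m w => X_ n t w - X_ (m + N)%N t w)).
  - by move=> m; apply: sqiB; exact: sX_.
  - move=> w; apply: cvgB; first exact: cvg_cst.
    by have := cX t w tT; rewrite -(cvg_shiftn N).
  - move=> m; have mD := sqmartB (mX n) (mX (m + N)%N).
    apply: le_trans (mart_sqi uF mD.1 (sqmart_sqi mD TT) tT).2 _.
    by apply: HN => //; rewrite leq_addl.
have sX t : 0 <= t <= T -> sqi P (X t).
  move=> tT; have [N HN] := bnd t 1 tT ltr01; have [sD _] := HN N (leqnn N).
  have := sqiB (sX_ N t tT) sD; congr (sqi _); apply/funext => w; ring.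
have cL2 t : 0 <= t <= T -> nsq P (fun w => X_ n t w - X t w) @[n --> \oo] --> 0.
  move=> tT; apply/cvgr0Pnorm_le => e e0; have [N HN] := bnd t e tT e0.
  by exists N => // n /= Nn; rewrite ger0_norm ?nsq_ge0//; have [] := HN n Nn.
split; last exact: cL2.
apply/sqmartP; split=> //.
- move=> t tT; apply: (fmeas_cvg (filtration_sigma uF tT) (Y_ := fun n => X_ n t)).
    by move=> n; exact: mart_fmeas (mX n).1 tT.
  by move=> w; exact: cX.
- move=> w; apply: (@cadlag_path_ulim _ _ (fun n t => X_ n t w)).
    by move=> n; have /sqmartP[_ + _ _] := mX n; exact.
  by move=> e e0; have [N HN] := uX w e e0; exists N => t tT; exact: HN.
- move=> s t A s0 st tT FA.
  have sT : 0 <= s <= T by rewrite s0 (le_trans st).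
  have tT' : 0 <= t <= T by rewrite tT (le_trans s0).
  have mA : measurable A by exact: filtration_measurable uF _ sT _ FA.
  have sA : sqi P \1_A.
    apply: (@sqi_bnd _ _ _ P _ 1); [by rewrite ltey_eq fin_num_measure|exact: measurable_indic|exact: indic_norm1].
  have cvg r : 0 <= r <= T -> \int[P]_w (\1_A w * X_ n r w) @[n --> \oo] --> \int[P]_w (\1_A w * X r w).
    move=> rT; apply: (L2_cvg (f_ := fun=> \1_A)) => //; last exact: cL2.
    + by move=> n; exact: sX_.
    + exact: sX.
    + rewrite (_ : (fun n => _) = (fun=> 0)); first exact: cvg_cst.
      apply/funext => n; rewrite /nsq (@eq_Rintegral _ _ _ P setT (fun=> 0)) ?Rintegral_cst ?mul0r//.
      by move=> w _; rewrite subrr expr0n.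
  have h1 := cvg _ tT'; have h2 := cvg _ sT.
  have e n : \int[P]_w (\1_A w * X_ n t w) = \int[P]_w (\1_A w * X_ n s w).
    exact: (mart_indic (mX n).1).
  rewrite (funext e) in h1.
  exact: (cvg_unique _ h1 h2).
Qed.

End sq_martingales.

(** * The stochastic integral *)

Lemma cvg0_EFin {R : realType} (u : nat -> R) (v : nat -> \bar R) :
  (forall n, v n = (u n)%:E) -> (v n @[n --> \oo] --> 0%E) <-> (u n @[n --> \oo] --> 0).
Proof.
move=> vu; rewrite (funext vu); split=> H; first exact: (fine_cvg H).
by apply: cvg_EFin; [exact: nearW|exact: H].
Qed.

Section L2_probability.
Context {R : realType} {d : measure_display} {Omega : measurableType d}.
Variable (P : probability Omega R).

Lemma L1_le_L2 (f : Omega -> R) : sqi P f -> (\int[P]_w `|f w|) ^+ 2 <= nsq P f.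
Proof.
move=> sf.
have mf := sf.1.
have s1 : sqi P (fun=> 1).
  by apply: (@sqi_bnd _ _ _ P _ 1) => //; [rewrite ltey_eq fin_num_measure|move=> _; rewrite normr1].
have sa : sqi P (fun w => `|f w|).
  by apply: le_sqi sf => [|w]; [exact: measurableT_comp|rewrite normr_id].
have := cauchy_schwarz sa s1.
have -> : nsq P (fun=> 1) = 1.
  by rewrite /nsq Rintegral_cst// expr1n mul1r -[RHS]/(fine 1%E) -(probability_setT P).
have -> : nsq P (fun w => `|f w|) = nsq P f.
  by apply: eq_Rintegral => w _; rewrite real_normK ?num_real.
by rewrite mulr1; under eq_Rintegral do rewrite mulr1.
Qed.

Lemma nsq_eq0 (f : Omega -> R) : sqi P f -> nsq P f = 0 -> {ae P, forall w, f w = 0}.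
Proof.
move=> sf f0; have := EFin_nsq sf; rewrite f0 => /esym H.
have mf2 : measurable_fun setT (fun w => (f w ^+ 2)%:E).
  by apply/measurable_EFinP/measurable_funX; case: sf.
have : (\int[P]_w `|(f w ^+ 2)%:E| = 0)%E.
  rewrite (eq_integral (fun w => (f w ^+ 2)%:E)) ?H// => w _.
  by rewrite gee0_abs// lee_fin sqr_ge0.
move/(ae_eq_integral_abs P measurableT mf2); apply: filterS => w /(_ I) [] /eqP.
by rewrite sqrf_eq0 => /eqP.
Qed.

End L2_probability.

Section stochastic_integral.
Context {R : realType} {d : measure_display} {Omega : measurableType d}.
Variables (P : probability Omega R) (T : R) (T0 : 0 < T).
Variable F : filtration R Omega.
Hypothesis uF : usual_conditions P T F.
Variables (M qM : process R Omega).
Hypothesis martM : square_integrable_martingale P T F M.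
Hypothesis qvM : is_predictable_quadratic_variation P T F M qM.
Local Notation mR := (measurableTypeR R).
Local Notation mu := (dPqv T0 martM qvM).
Local Notation I := (elementary_integral M).

Let TT : 0 <= T <= T. Proof. by rewrite lexx ltW. Qed.

(** Any g agreeing with phi on ]0, T] is allowed, so that differences between an uncut elementary
    process and an [uncurried] one are covered. *)
Lemma M2_normsqE (phi : process R Omega) (g : Omega * mR -> R) : measurable_fun setT g ->
  (forall w s, 0 < s <= T -> g (w, s) = phi s w) ->
  M2_normsq P T qM phi = (\int[mu]_z (g z ^+ 2)%:E)%E.
Proof.
move=> mg gphi.
have g0 z : (0 <= (g z ^+ 2)%:E)%E by rewrite lee_fin sqr_ge0.
have mg2 : measurable_fun setT (fun z => (g z ^+ 2)%:E).
  by apply/measurable_EFinP; exact: measurable_funX.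
rewrite (ge0_integral_qvP P T0 _ (qv_cadlag qvM) (qv_nd qvM) g0 mg2).
apply: eq_integral => w _; apply: eq_integral => s.
by rewrite inE/= in_itv/= => sT; rewrite gphi.
Qed.

Lemma uncurried_in (phi : process R Omega) w s : 0 < s <= T -> uncurried T phi (w, s) = phi s w.
Proof. by move=> sT; rewrite /uncurried/= indicE mem_set ?mul1r//= in_itv. Qed.

Lemma M2_sqi phi : predictable T F phi -> (M2_normsq P T qM phi < +oo)%E ->
  sqi mu (uncurried T phi).
Proof.
move=> pphi Hphi; have mphi := measurable_uncurried T0 uF pphi; split=> //.
rewrite -(@M2_normsqE phi)// => w s; exact: uncurried_in.
Qed.

Lemma sqi_M2 phi : predictable T F phi -> sqi mu (uncurried T phi) ->
  (M2_normsq P T qM phi < +oo)%E.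
Proof.
move=> pphi [mphi Hphi]; rewrite (@M2_normsqE phi (uncurried T phi))// => w s.
exact: uncurried_in.
Qed.

Lemma M2_elementary phi (e : @elementary R d Omega) : elementary_wf T F e ->
  sqi mu (uncurried T phi) ->
  M2_normsq P T qM (fun t w => elementary_process e t w - phi t w) =
  (nsq mu (fun z => uncurry_elem e z - uncurried T phi z))%:E.
Proof.
move=> we sphi; have se := uncurry_elem_sqi T0 uF martM qvM we.
rewrite EFin_nsq; last exact: sqiB.
apply: M2_normsqE; first by apply: measurable_funB; [case: se|case: sphi].
by move=> w s sT; rewrite uncurried_in.
Qed.

Lemma elementary_isometry_nsq (e e' : @elementary R d Omega) :
  elementary_wf T F e -> elementary_wf T F e' ->
  nsq P (fun w => I e T w - I e' T w) =
  nsq mu (fun z => uncurry_elem e z - uncurry_elem e' z).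
Proof.
move=> we we'.
have sI e0 (we0 : elementary_wf T F e0) := elementary_sqi uF martM we0.
have sJ e0 (we0 : elementary_wf T F e0) := uncurry_elem_sqi T0 uF martM qvM we0.
have iso := elementary_isometry T0 uF martM qvM.
have isn e0 : elementary_wf T F e0 -> nsq P (I e0 T) = nsq mu (uncurry_elem e0).
  move=> we0; have := iso _ _ we0 we0; rewrite /nsq.
  under eq_Rintegral do rewrite -expr2.
  by under [in RHS]eq_Rintegral do rewrite -expr2.
rewrite (nsq_B (sI _ we) (sI _ we')) (nsq_B (sJ _ we) (sJ _ we')).
by rewrite !isn// iso.
Qed.

Lemma stochastic_integral_exists phi : predictable T F phi -> sqi mu (uncurried T phi) ->
  exists N, is_stochastic_integral P T F M qM phi N.
Proof.
move=> pphi sphi.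
have A eps (eps0 : 0 < eps) := approx_predictable uF pphi sphi eps0.
(* With errors 16^-n / 8 the squared distance of consecutive integrals at T is at most 16^-n, their
   L^1 distance at most 4^-n, and the maximal inequality at level 2^-n bounds the exceptional event
   by 4^-n / 2^-n = 2^-n, which is summable. *)
have q0 n : 0 < (16^-1 : R) ^+ n / 8 by rewrite divr_gt0// exprn_gt0.
have {A}/choice[e He] n := A _ (q0 n).
have we n := (He n).1; have eH n := (He n).2.
have sJ n := uncurry_elem_sqi T0 uF martM qvM (we n).
have mX n := sqmart_elementary uF martM (we n).
have sX n : sqi P (I (e n) T) := elementary_sqi uF martM (we n).
have nsq_nm n m N : (N <= n)%N -> (N <= m)%N ->
    nsq P (fun w => I (e n) T w - I (e m) T w) <= (16^-1 : R) ^+ N.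
  move=> Nn Nm; rewrite elementary_isometry_nsq//.
  rewrite (_ : (fun z => _) = (fun z => (uncurry_elem (e n) z - uncurried T phi z) -
    (uncurry_elem (e m) z - uncurried T phi z))); last by apply/funext => z; ring.
  apply: le_trans (nsqB_le (sqiB (sJ n) sphi) (sqiB (sJ m) sphi)) _.
  have mono k : (N <= k)%N -> (16^-1 : R) ^+ k <= 16^-1 ^+ N.
    by move=> Nk; apply: ler_wiXn2l => //; rewrite ?invr_ge0 ?invf_le1// ?ler1n.
  have := eH n; have := eH m; have := mono n Nn; have := mono m Nm.
  have := q0 N; lra.
have HE n : exists E, [/\ measurable E,
    forall w t, 0 <= t <= T -> ((2^-1 : R) ^+ n) < `|I (e n.+1) t w - I (e n) t w| -> E w
    & (P E <= ((2^-1 : R) ^+ n)%:E)%E].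
  have mD := sqmartB uF (mX n.+1) (mX n).
  have p2 : 0 < (2^-1 : R) ^+ n by rewrite exprn_gt0.
  have [E [mE EX PE]] := doob T0 uF mD.1 p2; exists E; split=> //.
  rewrite -(fineK (fin_num_measure P _ mE)) lee_fin.
  rewrite -(ler_pM2l p2); apply: le_trans PE _.
  rewrite -(@ler_pXn2r _ 2)// ?nnegrE ?mulr_ge0 ?(ltW p2)//; last first.
    by apply: Rintegral_ge0 => w _.
  apply: le_trans (L1_le_L2 (sqiB (sX n.+1) (sX n))) _.
  apply: le_trans (nsq_nm n.+1 n n _ _) _ => //.
  rewrite (_ : 16^-1 = (2^-1 * 2^-1) ^+ 2 :> R); last by field.
  by rewrite -exprMn -!exprM mulnC.
have {HE}/choice[E HE] := HE.
have mE n : measurable (E n) by have [] := HE n.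
have PE0 : P (lim_sup_set E) = 0%E.
  apply: lim_sup_set_cvg0 => //.
  apply: (@le_lt_trans _ _ (\sum_(n <oo) ((2^-1 : R) ^+ n)%:E)%E).
    by apply: lee_nneseries => [n _ _|n _]; [exact: measure_ge0|have [] := HE n].
  rewrite (@eq_eseriesr _ _ (fun n => (2 / (2 ^ (n + 1))%:R)%:E)).
    by have /cvg_lim := @cvg_geometric_eseries_half R 2 0; rewrite /eseries/= => ->//; rewrite ltry.
  by move=> n _; rewrite addn1 natrX exprS invfM mulrA divff// mul1r exprVn.
pose G := ~` lim_sup_set E.
have mG : measurable G.
  by apply: measurableC; apply: bigcap_measurable => // n _; exact: bigcup_measurable.
have G0 : P (~` G) = 0%E by rewrite setCK.
(* Setting the integrals to 0 off G keeps them adapted: the null set ~` G is in F 0. *)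
pose X_ n t w := \1_G w * I (e n) t w.
have X_step w : exists N, forall n t, (N <= n)%N -> 0 <= t <= T ->
    `|X_ n.+1 t w - X_ n t w| <= (2^-1 : R) ^+ n.
  have [Gw|Gw] := pselect (G w); last first.
    by exists 0%N => n t _ _; rewrite /X_ indicE memNset// !mul0r subrr normr0 exprn_ge0.
  have [N HN] : exists N, forall n, (N <= n)%N -> ~ E n w.
    move: Gw; rewrite /G /lim_sup_set setC_bigcap => -[N _ NE]; exists N => n Nn En.
    by apply: NE; exists n.
  exists N => n t Nn tT; rewrite /X_ indicE mem_set// !mul1r leNgt; apply/negP => H.
  by apply: (HN n Nn); have [_ EX _] := HE n; exact: EX tT H.
have X_cau w : exists N, forall n m t, (N <= n)%N -> (n <= m)%N -> 0 <= t <= T ->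
    `|X_ m t w - X_ n t w| <= 2 * (2^-1 : R) ^+ n.
  have [N HN] := X_step w; exists N => n m t Nn nm tT.
  (* The subtracted term is the tail of the geometric series; with it the bound is reproduced
     exactly at each step of the induction. *)
  suff : `|X_ m t w - X_ n t w| <= 2 * (2^-1 : R) ^+ n - 2 * (2^-1 : R) ^+ m.
    by have : 0 <= (2^-1 : R) ^+ m by []; lra.
  elim: m nm => [|m IH]; first by rewrite leqn0 => /eqP ->; rewrite !subrr normr0.
  rewrite leq_eqVlt ltnS => /predU1P[<-|nm]; first by rewrite !subrr normr0.
  have := HN m t (leq_trans Nn nm) tT; have := IH nm; rewrite exprS.
  have := ler_normD (X_ m.+1 t w - X_ m t w) (X_ m t w - X_ n t w).
  rewrite (_ : X_ m.+1 t w - X_ m t w + (X_ m t w - X_ n t w) = X_ m.+1 t w - X_ n t w); last by ring.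
  lra.
pose X t w := lim (X_ n t w @[n --> \oo]).
have c2 : 2 * (2^-1 : R) ^+ n @[n --> \oo] --> 0.
  rewrite -[X in _ --> X](mulr0 2); apply: cvgM; first exact: cvg_cst.
  by apply: cvg_expr; rewrite ger0_norm// invf_lt1// ltr1n.
have X_cvg t w : 0 <= t <= T -> cvg (X_ n t w @[n --> \oo]).
  move=> tT; have [N HN] := X_cau w; apply/cauchy_cvgP; apply: cauchy_exP => eps eps0.
  move/cvgr0Pnorm_lt : c2 => /(_ _ eps0) [N' _ HN'].
  exists (X_ (maxn N N') t w); exists (maxn N N') => // n /= Nn.
  rewrite /ball/= distrC; apply: le_lt_trans (HN _ _ _ _ Nn tT) _; first exact: leq_maxl.
  by have := HN' (maxn N N') (leq_maxr _ _); rewrite ger0_norm// mulr_ge0.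
have uX w eps : 0 < eps -> exists N, forall n t, (N <= n)%N -> 0 <= t <= T ->
    `|X_ n t w - X t w| <= eps.
  move=> eps0; have [N HN] := X_cau w.
  move/cvgr0Pnorm_lt : c2 => /(_ _ eps0) [N' _ HN'].
  exists (maxn N N') => n t; rewrite geq_max => /andP[Nn N'n] tT.
  have cX : `|X_ n t w - X_ m t w| @[m --> \oo] --> `|X_ n t w - X t w|.
    by apply: cvg_norm; apply: cvgB; [exact: cvg_cst|exact: X_cvg].
  apply: (cvgr_to_le cX); exists n => // m /= nm; rewrite distrC.
  apply: le_trans (HN _ _ _ Nn nm tT) _.
  by have := HN' n N'n; rewrite ger0_norm ?mulr_ge0// => /ltW.
have mX_ n := sqmart_restrict uF (mX n) mG G0.
have aeG : {ae P, forall w, \1_G w = 1 :> R}.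
  exists (~` G); split=> //; first exact: measurableC.
  by move=> w /= H Gw; apply: H; rewrite indicE mem_set.
have nsqG (f g h : Omega -> R) : nsq P (fun w => \1_G w * f w - h w) = nsq P (fun w => f w - h w).
  rewrite /nsq /Rintegral; congr fine; apply: ae_eq_integral_nonmeas.
  by apply: filterS aeG => w ->; rewrite mul1r.
have cauX eps : 0 < eps -> exists N, forall n m, (N <= n)%N -> (N <= m)%N ->
    nsq P (fun w => X_ n T w - X_ m T w) <= eps.
  move=> eps0.
  have c16 : (16^-1 : R) ^+ n @[n --> \oo] --> 0.
    by apply: cvg_expr; rewrite ger0_norm// invf_lt1// ltr1n.
  move/cvgr0Pnorm_le : c16 => /(_ _ eps0) [N _ HN]; exists N => n m Nn Nm.
  apply: (@le_trans _ _ (nsq P (fun w => I (e n) T w - I (e m) T w))).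
    rewrite le_eqVlt; apply/orP; left; apply/eqP.
    rewrite /nsq /Rintegral; congr fine; apply: ae_eq_integral_nonmeas.
    by apply: filterS aeG => w Gw; rewrite /X_ Gw !mul1r.
  apply: le_trans (nsq_nm n m N Nn Nm) _.
  by have := HN N (leqnn N); rewrite ger0_norm.
have [sqX cvX] := sqmart_lim T0 uF mX_ uX cauX.
exists X; split=> //.
  move=> w; rewrite /X (_ : (fun n => _) = (fun=> 0)); first exact: lim_cst.
  apply/funext => n; rewrite /X_ /elementary_integral big_seq big1 ?mulr0// => p pe.
  have [s0 st _ _ _] := we n p pe.
  by rewrite !min_r ?subrr ?mulr0// (le_trans s0).
exists e; split=> //.
  apply/(cvg0_EFin (fun n => M2_elementary (we n) sphi)).
  apply: (squeeze_cvgr (f := fun=> 0) (h := fun n => (16^-1 : R) ^+ n / 8)).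
  - by apply: nearW => n; rewrite nsq_ge0 eH.
  - exact: cvg_cst.
  - rewrite -[X in _ --> X](mul0r 8^-1); apply: cvgM; last exact: cvg_cst.
    by apply: cvg_expr; rewrite ger0_norm// invf_lt1// ltr1n.
have sXT := sqmart_sqi sqX TT.
apply/(@cvg0_EFin _ (fun n => nsq P (fun w => I (e n) T w - X T w))).
  by move=> n; rewrite unlock EFin_nsq//; exact: sqiB.
have H n : nsq P (fun w => I (e n) T w - X T w) = nsq P (fun w => X_ n T w - X T w).
  by rewrite -nsqG.
by rewrite (funext H).
Qed.

(** Existence rules out the default value of [xget]. *)
Lemma stochastic_integralP phi : predictable T F phi -> sqi mu (uncurried T phi) ->
  is_stochastic_integral P T F M qM phi (stochastic_integral P T F M qM phi).
Proof. by move=> pphi sphi; exact: xgetPex (stochastic_integral_exists pphi sphi). Qed.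

Lemma stochastic_integral_approx phi N : sqi mu (uncurried T phi) ->
  is_stochastic_integral P T F M qM phi N ->
  exists e : nat -> @elementary R d Omega, [/\ forall n, elementary_wf T F (e n),
    nsq mu (fun z => uncurry_elem (e n) z - uncurried T phi z) @[n --> \oo] --> 0 &
    nsq P (fun w => I (e n) T w - N T w) @[n --> \oo] --> 0].
Proof.
move=> sphi [mN _ [e [we c1 c2]]]; exists e; split=> //.
  exact/(cvg0_EFin (fun n => M2_elementary (we n) sphi)).
apply/(@cvg0_EFin _ (fun n => nsq P (fun w => I (e n) T w - N T w))); last exact: c2.
move=> n; rewrite unlock EFin_nsq//; apply: sqiB; last exact: sqmart_sqi mN TT.
exact: (elementary_sqi uF martM (we n)).
Qed.

(** Both sides are limits of the elementary isometry along approximating sequences of the two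
    integrands. It holds for arbitrary versions N and N' of the integrals. *)
Lemma ito_isometry phi psi N N' : sqi mu (uncurried T phi) -> sqi mu (uncurried T psi) ->
  is_stochastic_integral P T F M qM phi N -> is_stochastic_integral P T F M qM psi N' ->
  \int[P]_w (N T w * N' T w) = \int[mu]_z (uncurried T phi z * uncurried T psi z).
Proof.
move=> sphi spsi iN iN'.
have [e [we c1 c2]] := stochastic_integral_approx sphi iN.
have [e' [we' c1' c2']] := stochastic_integral_approx spsi iN'.
have sN : sqi P (N T) by case: iN => /sqmart_sqi/(_ TT).
have sN' : sqi P (N' T) by case: iN' => /sqmart_sqi/(_ TT).
have sI e0 (we0 : elementary_wf T F e0) := elementary_sqi uF martM we0.
have sJ e0 (we0 : elementary_wf T F e0) := uncurry_elem_sqi T0 uF martM qvM we0.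
have h1 := L2_cvg (fun n => sI _ (we n)) (fun n => sI _ (we' n)) sN sN' c2 c2'.
have h2 := L2_cvg (fun n => sJ _ (we n)) (fun n => sJ _ (we' n)) sphi spsi c1 c1'.
rewrite (funext (fun n => elementary_isometry T0 uF martM qvM (we n) (we' n))) in h1.
exact: (cvg_unique _ h1 h2).
Qed.

(** No common approximating sequence is built: the squared norm of N1 - N2 - N3 at T expands into
    inner products, which the isometry turns into those of the integrands, where they cancel.
    [mart_zero] then gives all times at once. *)
Lemma stochastic_integralB phi psi N1 N2 N3 : predictable T F phi -> predictable T F psi ->
  sqi mu (uncurried T phi) -> sqi mu (uncurried T psi) ->
  is_stochastic_integral P T F M qM phi N1 -> is_stochastic_integral P T F M qM psi N2 ->
  is_stochastic_integral P T F M qM (fun t w => phi t w - psi t w) N3 ->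
  {ae P, forall w, forall t, 0 <= t <= T -> N3 t w = N1 t w - N2 t w}.
Proof.
move=> pphi ppsi sphi spsi i1 i2 i3.
have ud : uncurried T (fun t w => phi t w - psi t w) =
    (fun z => uncurried T phi z - uncurried T psi z).
  by apply/funext => z; rewrite /uncurried mulrBr.
have sd : sqi mu (uncurried T (fun t w => phi t w - psi t w)) by rewrite ud; exact: sqiB.
have [m1 _ _] := i1; have [m2 _ _] := i2; have [m3 _ _] := i3.
have s1 := sqmart_sqi m1 TT; have s2 := sqmart_sqi m2 TT; have s3 := sqmart_sqi m3 TT.
have mD := sqmartB uF (sqmartB uF m1 m2) m3.
have nsqN phi' N : sqi mu (uncurried T phi') -> is_stochastic_integral P T F M qM phi' N ->
    nsq P (N T) = nsq mu (uncurried T phi').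
  move=> sp iN; have := ito_isometry sp sp iN iN.
  by rewrite /nsq; under eq_Rintegral do rewrite -expr2; under [in RHS]eq_Rintegral do rewrite -expr2.
have D0 : nsq P (fun w => N1 T w - N2 T w - N3 T w) = 0.
  rewrite (nsq_B (sqiB s1 s2) s3) (nsq_B s1 s2).
  have -> : \int[P]_w ((N1 T w - N2 T w) * N3 T w) =
      \int[P]_w (N1 T w * N3 T w) - \int[P]_w (N2 T w * N3 T w).
    by rewrite -RintegralB//; [apply: eq_Rintegral => w _; rewrite mulrBl|exact: sqi_M..].
  rewrite (nsqN _ _ sphi i1) (nsqN _ _ spsi i2) (nsqN _ _ sd i3).
  rewrite (ito_isometry sphi spsi i1 i2) (ito_isometry sphi sd i1 i3) (ito_isometry spsi sd i2 i3) ud.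
  rewrite -RintegralB//; [|exact: sqi_M sphi (sqiB sphi spsi)|exact: sqi_M spsi (sqiB sphi spsi)].
  rewrite -(nsq_B sphi spsi).
  rewrite [X in 2 * X](_ : _ = nsq mu (fun z => uncurried T phi z - uncurried T psi z)).
    by ring.
  by apply: eq_Rintegral => z _; ring.
have := mart_zero T0 uF mD.1 (nsq_eq0 (sqiB (sqiB s1 s2) s3) D0).
by apply: filterS => w H t tT; have := H t tT; lra.
Qed.

(** For one elementary term, x (M_t - M_s) is known at t, so O_T may be replaced by O_t. Then
    E[x M_s O_t] = E[x M_s O_s], and E[x O_t M_t] = E[x O_s M_s] because O M is a martingale up to
    A; the difference is 0. Approximation in L^2 does the rest. *)
Lemma strongly_orthogonal_integral O phi N : square_integrable_martingale P T F O ->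
  strongly_orthogonal P T F O M -> sqi mu (uncurried T phi) ->
  is_stochastic_integral P T F M qM phi N -> \int[P]_w (O T w * N T w) = 0.
Proof.
move=> mO [A [[_ _ _ _ mOMA] A0]] sphi iN.
have [e [we c1 c2]] := stochastic_integral_approx sphi iN.
have sN : sqi P (N T) by case: iN => /sqmart_sqi/(_ TT).
have sO t := sqmart_sqi mO (t := t); have sM t := sqmart_sqi martM (t := t).
have sI e0 (we0 : elementary_wf T F e0) := elementary_sqi uF martM we0.
have h1 : \int[P]_w (O T w * I (e n) T w) @[n --> \oo] --> \int[P]_w (O T w * N T w).
  have c0 : nsq P (fun w => O T w - O T w) @[n --> \oo] --> 0.
    by rewrite nsq_subrr; exact: cvg_cst.
  exact: (L2_cvg (fun=> sO _ TT) (fun n => sI _ (we n)) (sO _ TT) sN c0 c2).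
have one p : elem1_wf T F p ->
    \int[P]_w (O T w * (p.2 w * (M p.1.2 w - M p.1.1 w))) = 0.
  move=> [s0 st tT fx [K xK]].
  have sT : 0 <= p.1.1 <= T by rewrite s0 (le_trans st).
  have tTT : 0 <= p.1.2 <= T by rewrite tT (le_trans s0).
  have /andP[t0 _] := tTT.
  have mx := fmeas_measurable uF sT fx.
  have fxt : fmeas (F p.1.2) p.2 by exact: (fmeas_le uF s0 st tT).
  have Y1 : fmeas (F p.1.2) (fun w => p.2 w * (M p.1.2 w - M p.1.1 w)).
    have sF := filtration_sigma uF tTT.
    apply: (fmeasM sF) => //; apply: (fmeasB sF); first exact: mart_fmeas martM.1 tTT.
    by apply: (fmeas_le uF s0 st tT); exact: mart_fmeas martM.1 sT.
  have sY1 := sqi_bM mx xK (sqiB (sM _ tTT) (sM _ sT)).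
  have o1 := mart_test_sqi uF mO.1 t0 tT (lexx T) (sO _ TT) (sO _ tTT) Y1 sY1.
  have Y2 : fmeas (F p.1.1) (fun w => p.2 w * M p.1.1 w).
    by apply: (fmeasM (filtration_sigma uF sT)) => //; exact: mart_fmeas martM.1 sT.
  have sY2 := sqi_bM mx xK (sM _ sT).
  have o2 := mart_test_sqi uF mO.1 s0 st tT (sO _ tTT) (sO _ sT) Y2 sY2.
  have o3 := mart_test uF mOMA s0 st tT fx xK.
  (* A vanishes almost surely at each fixed time, which suffices as only two times enter. *)
  have rem r : 0 <= r <= T -> \int[P]_w (p.2 w * (O r w * M r w - A r w)) =
      \int[P]_w (p.2 w * (O r w * M r w)).
    move=> rT; rewrite /Rintegral; congr fine; apply: ae_eq_integral_nonmeas.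
    by apply: filterS (A0 r rT) => w ->; rewrite subr0.
  rewrite !rem// in o3.
  under eq_Rintegral do rewrite mulrC.
  rewrite o1.
  have i1 := intble_bM mx xK (sqi_M (sO _ tTT) (sM _ tTT)).
  have i2 := sqi_M sY2 (sO _ tTT).
  transitivity (\int[P]_w (p.2 w * (O p.1.2 w * M p.1.2 w)) - \int[P]_w (p.2 w * M p.1.1 w * O p.1.2 w)).
    by rewrite -RintegralB//; apply: eq_Rintegral => w _; ring.
  rewrite o2 o3; apply/eqP; rewrite subr_eq0; apply/eqP; apply: eq_Rintegral => w _; ring.
have h0 e0 : elementary_wf T F e0 -> \int[P]_w (O T w * I e0 T w) = 0.
  move=> we0.
  rewrite (@eq_Rintegral _ _ _ P setT (fun w => \sum_(p <- e0) O T w * (p.2 w * (M p.1.2 w - M p.1.1 w)))); last first.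
    by move=> w _; rewrite (elementary_integral_T _ _ we0) big_distrr.
  elim: e0 we0 => [|p e0 IH] we0.
    by under eq_Rintegral do rewrite big_nil; rewrite Rintegral_cst// mul0r.
  have [wp we1] := elementary_wf_cons we0.
  under eq_Rintegral do rewrite big_cons.
  have sp := elem1_sqi uF martM wp.
  rewrite RintegralD//; [by rewrite one// IH// addr0|exact: sqi_M (sO _ TT) sp|].
  have := sqi_M (sO _ TT) (sI _ we1).
  congr (_.-integrable _ (EFin \o _)); apply/funext => w.
  by rewrite (elementary_integral_T _ _ we1) big_distrr.
rewrite (funext (fun n => h0 _ (we n))) in h1.
exact: (cvg_unique _ h1 (cvg_cst 0)).
Qed.

End stochastic_integral.

(** * Integration against paths of bounded variation *)

Lemma mem_itv_set {R : realType} (i : interval R) (s : R) : (s \in [set` i]) = (s \in i).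
Proof. by rewrite mem_setE. Qed.

Section integral_functional.
Context {R : realType}.
Local Notation mR := (measurableTypeR R).
Implicit Types (phi psi z : mR -> R) (Lam : (mR -> R) -> R) (D S : set mR).

Definition bounded_borel phi :=
  measurable_fun setT phi /\ exists K : R, forall s, `|phi s| <= K.

(** A finite signed measure seen through its integrals: linearity and bounded convergence. Integrals
    with a density and differences of integrals are of this kind, without a signed measure being
    constructed. *)
Definition integral_functional Lam :=
  (forall c phi psi, bounded_borel phi -> bounded_borel psi ->
     Lam (fun s => c * phi s + psi s) = c * Lam phi + Lam psi) /\
  (forall (phi_ : nat -> mR -> R) phi (K : R),
     (forall n, measurable_fun setT (phi_ n)) -> (forall n s, `|phi_ n s| <= K) ->
     (forall s, phi_ n s @[n --> \oo] --> phi s) ->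
     Lam (phi_ n) @[n --> \oo] --> Lam phi).

Lemma bounded_borel_lin c phi psi : bounded_borel phi -> bounded_borel psi ->
  bounded_borel (fun s => c * phi s + psi s).
Proof.
move=> [mp [K pK]] [mq [K' qK']]; split.
  by apply: measurable_funD => //; apply: measurable_funM.
exists (`|c| * K + K') => s; apply: le_trans (ler_normD _ _) _.
by apply: lerD => //; rewrite normrM ler_wpM2l.
Qed.

Lemma bounded_borel_indic S : measurable S -> bounded_borel (\1_S : mR -> R).
Proof.
move=> mS; split; first exact: measurable_indic.
by exists 1 => s; rewrite indicE normr_nat lern1 leq_b1.
Qed.

Lemma bounded_borel0 : bounded_borel (fun=> 0).
Proof. by split; [exact: measurable_cst|exists 0 => s; rewrite normr0]. Qed.

Lemma integral_functionalB Lam Lam' : integral_functional Lam -> integral_functional Lam' ->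
  integral_functional (fun phi => Lam phi - Lam' phi).
Proof.
move=> [l c] [l' c']; split=> [a phi psi bp bq|phi_ phi K mp pK pp].
  by rewrite l// l'//; ring.
by apply: cvgB; [exact: c mp pK pp|exact: c' mp pK pp].
Qed.

Lemma integrable_bounded_borelM (m : {measure set mR -> \bar R}) D z phi : measurable D ->
  m.-integrable D (EFin \o z) -> bounded_borel phi ->
  m.-integrable D (EFin \o (fun s => phi s * z s)).
Proof.
move=> mD iz [mp [K pK]].
have mz : measurable_fun D z by apply/measurable_EFinP; exact: measurable_int iz.
apply: (@le_integrable _ _ _ m D mD _ (EFin \o (fun s => K * `|z s|))).
- apply/measurable_EFinP/measurable_funM => //.
  exact: measurable_funS mp.
- move=> s Ds /=; rewrite lee_fin normrM [leRHS]ger0_norm; first by rewrite ler_wpM2r.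
  by rewrite mulr_ge0// (le_trans _ (pK s)).
- apply: (@integrableZl _ _ _ m D mD K (EFin \o (fun s => `|z s|))); exact: integrable_norm.
Qed.

Lemma Rintegral_functional (m : {measure set mR -> \bar R}) D z : measurable D ->
  m.-integrable D (EFin \o z) ->
  integral_functional (fun phi => \int[m]_(s in D) (phi s * z s)).
Proof.
move=> mD iz; split=> [c phi psi bp bq|phi_ phi K mp pK pp].
  have i1 := integrable_bounded_borelM mD iz bp.
  have i2 := integrable_bounded_borelM mD iz bq.
  rewrite -RintegralZl// -RintegralD//; last first.
    exact: (@integrableZl _ _ _ m D mD c (EFin \o (fun s => phi s * z s))).
  by apply: eq_Rintegral => s _; ring.
have mz : measurable_fun D z by apply/measurable_EFinP; exact: measurable_int iz.
have mph : measurable_fun setT phi.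
  by apply: measurable_fun_cvg mp _ => s _; exact: pp.
have bphi : bounded_borel phi.
  split=> //; exists K => s; apply: (cvgr_to_le (cvg_norm (pp s))).
  by apply: nearW => n; exact: pK.
have bphi_ n : bounded_borel (phi_ n) by split=> //; exists K => s; exact: pK.
have i1 := integrable_bounded_borelM mD iz bphi.
have iK : m.-integrable D (EFin \o (fun s => K * `|z s|)).
  apply: (@integrableZl _ _ _ m D mD K (EFin \o (fun s => `|z s|))); exact: integrable_norm.
apply: fine_cvg; rewrite fineK; last exact: integrable_fin_num.
have [] // := @dominated_convergence _ _ _ m D mD
  (fun n s => (phi_ n s * z s)%:E) (fun s => (phi s * z s)%:E) _ _ _ _ iK.
- move=> n; apply/measurable_EFinP/measurable_funM => //.
  exact: measurable_funS (mp n).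
- apply/measurable_EFinP/measurable_funM => //.
  exact: measurable_funS mph.
- apply: aeW => s _ /=; apply: cvg_EFin; first exact: nearW.
  by apply: cvgM => //; exact: cvg_cst.
- by apply: aeW => s n _ /=; rewrite lee_fin normrM ler_wpM2r.
Qed.

Lemma Rintegral_functional1 (m : {measure set mR -> \bar R}) D : measurable D ->
  (m D < +oo)%E -> integral_functional (fun phi => \int[m]_(s in D) phi s).
Proof.
move=> mD mDfin.
rewrite (_ : (fun phi => _) = (fun phi => \int[m]_(s in D) (phi s * 1))).
  apply: Rintegral_functional => //; apply/integrableP; split.
    by apply/measurable_EFinP; exact: measurable_cst.
  by under eq_integral do rewrite /= normr1; rewrite integral_cst// mul1e.
by apply/funext => phi; apply: eq_Rintegral => s _; rewrite mulr1.
Qed.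

Section vanishing.
Variables (Lam : (mR -> R) -> R) (T : R).
Hypothesis T0 : 0 < T.
Hypothesis LamI : integral_functional Lam.
Hypothesis Lam_itv : forall t, 0 <= t <= T -> Lam \1_(`]0, t]%classic) = 0.
Hypothesis LamD : forall phi, Lam phi = Lam (fun s => \1_(`]0, T]%classic) s * phi s).

Let Lam0 : Lam (fun=> 0) = 0.
Proof.
have := LamI.1 1 _ _ bounded_borel0 bounded_borel0.
have -> : (fun s : mR => 1 * 0 + 0) = (fun=> 0 : R) by apply/funext => s; rewrite mulr0 addr0.
lra.
Qed.

Let LamT : Lam \1_[set: mR] = 0.
Proof.
rewrite LamD -[RHS](@Lam_itv T) ?lexx ?ltW//; congr Lam.
by apply/funext => s; rewrite [X in _ * X]indicE in_setT mulr1.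
Qed.

Let Lam_indicB S S' : measurable S -> measurable S' -> S `<=` S' ->
  Lam \1_(S' `\` S) = Lam \1_S' - Lam \1_S.
Proof.
move=> mS mS' SS'.
have -> : (\1_(S' `\` S) : mR -> R) = (fun s => -1 * \1_S s + \1_S' s).
  apply/funext => s; rewrite !indicE in_setD.
  have [sS|sS] := boolP (s \in S); last by rewrite mulr0 add0r andbT.
  have -> : s \in S' by apply/mem_set/SS'; exact: set_mem.
  by rewrite /= mulr1 addrC subrr.
rewrite (LamI.1 _ _ _ (bounded_borel_indic mS) (bounded_borel_indic mS')).
lra.
Qed.

(** Rays are stable under intersection and generate the Borel sets. Within ]0, T] a ray is ]0, T]
    minus ]0, y], with y the clamped end point. *)
Let Lam_ray x : Lam \1_(`]x, +oo[%classic) = 0.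
Proof.
pose y := Num.max 0 (Num.min x T).
have y0 : 0 <= y <= T by rewrite /y le_max lexx/= ge_max (ltW T0) ge_min lexx orbT.
rewrite LamD (_ : (fun s => _) = \1_(`]0, T] `\` `]0, y])); last first.
  apply/funext => s; rewrite !indicE -natrM mulnb; congr (_%:R); congr nat_of_bool.
  rewrite in_setD !mem_itv_set !in_itv/= andbT /y; apply/idP/idP.
    move=> /andP[/andP[s0 sT]]; rewrite s0 sT andbT /= => xs.
    by rewrite -ltNge gt_max s0 gt_min xs.
  move=> /andP[/andP[s0 sT]]; rewrite s0 sT -ltNge gt_max s0 /= gt_min.
  by rewrite [T < s]ltNge sT orbF.
rewrite Lam_indicB; [|exact: measurable_itv|exact: measurable_itv|].
  by rewrite !Lam_itv ?subrr// lexx ltW.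
move=> s /=; rewrite !in_itv/= => /andP[-> sy]/=.
by move/andP: y0 => [_]; exact: le_trans.
Qed.

Let Lam_indic S : measurable S -> Lam \1_S = 0.
Proof.
move=> mS; pose Q S := Lam \1_S = 0.
apply: (@dynkin_induction _ mR (@RGenOInfty.G R) Q).
- by rewrite -[LHS]/((@ocitv R).-sigma.-measurable) RGenOInfty.measurableE.
- move=> _ _ [x ->] [y ->]; exists (Num.max x y).
  apply/seteqP; split=> s /=; rewrite !in_itv/= !andbT gt_max.
    by move=> [-> ->].
  by move=> /andP[-> ->].
- exact: LamT.
- by move=> _ [x ->]; exact: Lam_ray.
- by move=> S' mS' QS'; rewrite /Q -setTD Lam_indicB// LamT QS' subrr.
- move=> S_ mS_ tS_ QS_; rewrite /Q.
  have c : Lam \1_(\big[setU/set0]_(k < n) S_ k) @[n --> \oo] --> Lam \1_(\bigcup_k S_ k).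
    apply: (LamI.2 _ _ 1) => [n|n s|s].
    + by apply: measurable_indic; exact: bigsetU_measurable.
    + by rewrite indicE normr_nat lern1 leq_b1.
    + apply: cvg_near_cst.
      have [[k _ Sks]|nS] := pselect ((\bigcup_k S_ k) s).
        exists k.+1 => // n /= kn; rewrite !indicE !mem_set//; first by exists k.
        by rewrite -bigcup_mkord; exists k.
      apply: nearW => n; rewrite !indicE !memNset//.
      by rewrite -bigcup_mkord => -[k _ Sks]; apply: nS; exists k.
  have L0 n : Lam \1_(\big[setU/set0]_(k < n) S_ k) = 0.
    elim: n => [|n IH].
      by rewrite big_ord0 (_ : \1_set0 = (fun=> 0 : R))//; apply/funext => s; rewrite indic0.
    have mb : measurable (\big[setU/set0]_(k < n) S_ k) by exact: bigsetU_measurable.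
    rewrite big_ord_recr/= (_ : \1_(_ `|` _) =
      (fun s : mR => 1 * \1_(\big[setU/set0]_(k < n) S_ k) s + \1_(S_ n) s)).
      rewrite (LamI.1 _ _ _ (bounded_borel_indic mb) (bounded_borel_indic (mS_ n))).
      by rewrite IH (QS_ n) mulr0 addr0.
    apply/funext => s; rewrite !indicE in_setU mul1r -natrD; congr (_%:R).
    have [|] := boolP (s \in S_ n); last by rewrite orbF addn0.
    move=> /set_mem Sns; rewrite (_ : s \in _ = false)//.
    apply/negP => /set_mem; rewrite -bigcup_mkord => -[k /= kn Sks].
    have /eqP := tS_ n k I I (ex_intro _ s (conj Sns Sks)).
    by rewrite gtn_eqF.
  by rewrite (funext L0) in c; exact: (cvg_unique _ c (cvg_cst _)).
- by move: mS; rewrite -[measurable S]/((@ocitv R).-sigma.-measurable S) RGenOInfty.measurableE.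
Qed.

(** Uniqueness of a signed measure with given distribution function, applied to differences of two
    functionals: from the intervals ]0, t] to Borel sets, then to bounded functions. *)
Lemma integral_functional_eq0 phi : bounded_borel phi -> Lam phi = 0.
Proof.
move=> [mphi [K phiK]].
suff [] : bounded_borel phi /\ Lam phi = 0 by [].
apply: (bounded_ind (Pr := fun g => bounded_borel g /\ Lam g = 0) phiK).
- by split; [exact: bounded_borel0|exact: Lam0].
- move=> c g h [bg g0] [bh h0]; split; first exact: bounded_borel_lin.
  by rewrite (LamI.1 _ _ _ bg bh) g0 h0 mulr0 addr0.
- move=> B mB; have mS : measurable (phi @^-1` B) by rewrite -[_ @^-1` _]setTI; exact: mphi.
  by split; [exact: bounded_borel_indic mS|exact: Lam_indic mS].
move=> H; split; first by split=> //; exists K.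
have e0 n : 0 < (n.+1%:R : R)^-1 by [].
(* Approximants within 1/(n+1) of phi are bounded by K + 1, so bounded convergence applies to
   them. *)
have /choice[g Hg] := fun n => H _ (e0 n).
have c : Lam (g n) @[n --> \oo] --> Lam phi.
  apply: (LamI.2 _ _ (K + 1)) => [n|n s|s].
  - by case: (Hg n) => -[[]].
  - have := (Hg n).2 s; have := phiK s; have := ler_normB (phi s) (phi s - g n s).
    have : (n.+1%:R : R)^-1 <= 1 by rewrite invf_le1// ler1n.
    rewrite (_ : phi s - (phi s - g n s) = g n s); last by ring.
    move=> h1 h2 h3 h4; apply: le_trans h2 (lerD h3 (le_trans h4 h1)).
  - apply/cvgrPdist_le => e epos.
    have /cvgr0Pnorm_le/(_ _ epos) := @cvg_harmonic R; apply: filterS => n.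
    rewrite ger0_norm//=; exact: le_trans ((Hg n).2 s).
rewrite (funext (fun n => (Hg n).1.2)) in c; exact: (cvg_unique _ c (cvg_cst _)).
Qed.

End vanishing.

Lemma integral_functional_rc Lam (t : R) : integral_functional Lam ->
  Lam \1_(`]0, r]%classic) @[r --> t^'+] --> Lam \1_(`]0, t]%classic).
Proof.
move=> [_ c]; apply/cvg_at_rightP => u [ut uc].
apply: (c (fun n => \1_`]0, u n]) _ 1) => [n|n s|s].
- by apply: measurable_indic; exact: measurable_itv.
- by rewrite indicE normr_nat lern1 leq_b1.
apply: cvg_near_cst.
have [st|ts] := leP s t.
  apply: nearW => n; rewrite !indicE; congr (_%:R); congr nat_of_bool.
  by rewrite !mem_itv_set !in_itv/= st (le_trans st (ltW (ut n))).
have : \forall n \near \oo, u n < s by exact: (cvgr_lt t).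
apply: filterS => n us.
by rewrite !indicE !memNset//= in_itv/= leNgt ?us ?ts andbF.
Qed.

Lemma Rintegral_itvE (m : {measure set mR -> \bar R}) z (t T : R) : t <= T ->
  \int[m]_(s in `]0, t]) z s = \int[m]_(s in `]0, T]) (\1_(`]0, t]%classic) s * z s).
Proof.
move=> tT; rewrite (_ : `]0, t]%classic = `]0, T]%classic `&` `]0, t]%classic); last first.
  apply/seteqP; split=> s /=; rewrite !in_itv/=; last by case.
  by move=> /andP[-> st]; rewrite st (le_trans st).
rewrite Rintegral_mkcondr; apply: eq_Rintegral => s sT.
rewrite patchE indicE in_setI sT/=; case: ifP => _; by rewrite ?mul1r ?mul0r.
Qed.

End integral_functional.

(** * Identification of integrals against paths of bounded variation *)

Section pathwise.
Context {R : realType} (T : R) (T0 : 0 < T).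
Local Notation mR := (measurableTypeR R).
Implicit Types (g : R -> R) (phi z : mR -> R).

Lemma Rintegral_stieltjes_itv g (t : R) :
  (forall s t, 0 <= s -> s <= t -> t <= T -> g s <= g t) ->
  (forall t, 0 <= t < T -> g r @[r --> t^'+] --> g t) -> 0 <= t <= T ->
  \int[stieltjes T g]_(s in `]0, T]) \1_(`]0, t]%classic) s = g t - g 0.
Proof.
move=> ndg rcg /andP[t0 tT].
under eq_Rintegral do rewrite -[\1__ _]mulr1.
by rewrite -Rintegral_itvE// Rintegral_cst//= mul1r stieltjes_itv.
Qed.

Section bounded_variation.
Variable g : R -> R.
Hypothesis rc_g : forall t, 0 <= t < T -> g r @[r --> t^'+] --> g t.
Hypothesis bv_g : bounded_variation 0 T g.

Let nd_neg_tv h : bounded_variation 0 T h -> forall s t, 0 <= s -> s <= t -> t <= T ->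
  (fine \o neg_tv 0 h) s <= (fine \o neg_tv 0 h) t.
Proof.
move=> bvh s t s0 st tT; apply: (fine_neg_tv_nondecreasing bvh) => //.
  by rewrite in_itv/= s0 (le_trans st).
by rewrite in_itv/= tT (le_trans s0).
Qed.

Let rc_neg_tv h : bounded_variation 0 T h ->
  (forall t, 0 <= t < T -> h r @[r --> t^'+] --> h t) ->
  forall t, 0 <= t < T -> (fine \o neg_tv 0 h) r @[r --> t^'+] --> (fine \o neg_tv 0 h) t.
Proof. by move=> bvh rch t /andP[t0 tT]; apply: (neg_tv_right_continuous t0 tT) => //; apply: rch; rewrite t0. Qed.

Let bvN : bounded_variation 0 T (\- g). Proof. exact/bounded_variationN. Qed.

Let rcN : forall t, 0 <= t < T -> (\- g) r @[r --> t^'+] --> (\- g) t.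
Proof. by move=> t tT; apply: cvgN; exact: rc_g. Qed.

(** [bv_integral] is itself the difference of two integral functionals, so it coincides with any
    functional carried by ]0, T] whose distribution function is that of g. *)
Lemma bv_integralE (Lam : (mR -> R) -> R) phi : integral_functional Lam ->
  (forall psi, Lam psi = Lam (fun s => \1_(`]0, T]%classic) s * psi s)) ->
  (forall t, 0 <= t <= T -> Lam \1_(`]0, t]%classic) = g t - g 0) ->
  bounded_borel phi -> bv_integral T phi g T = Lam phi.
Proof.
move=> LamI LamD LamE bphi; apply/eqP; rewrite -subr_eq0; apply/eqP.
have ndp := nd_neg_tv bvN; have rcp := rc_neg_tv bvN rcN.
have ndn := nd_neg_tv bv_g; have rcn := rc_neg_tv bv_g rc_g.
have i1 h : (stieltjes T h `]0%R, T]%classic < +oo)%E ->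
    integral_functional (fun psi => \int[stieltjes T h]_(s in `]0, T]) psi s).
  by move=> hfin; exact: Rintegral_functional1.
apply: (integral_functional_eq0 T0 (Lam := fun psi => bv_integral T psi g T - Lam psi)) => //.
- apply: integral_functionalB => //; apply: integral_functionalB; apply: i1.
    by rewrite /stieltjes_pos stieltjes_itv// ?ltry// ltW.
  by rewrite /stieltjes_neg stieltjes_itv// ?ltry// ltW.
- move=> t /andP[t0 tT]; rewrite LamE ?t0// /bv_integral.
  rewrite /stieltjes_pos /stieltjes_neg !Rintegral_stieltjes_itv ?t0//=.
  (* The positive variation of g is the negative variation of -g. The two variation functions differ
     by g itself, and their increments from 0 by g - g 0. *)
  have E s : 0 <= s <= T -> g s = fine (neg_tv 0 (\- g) s) - fine (neg_tv 0 g s).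
    by move=> sT; apply: (bounded_variation_pos_neg_tvE bv_g); rewrite in_itv.
  rewrite (E t) ?t0// (E 0) ?lexx ?ltW//; ring.
- move=> psi; rewrite [in LHS]LamD; congr (_ - _); congr (_ - _); apply: eq_Rintegral => s sT.
    by rewrite indicE sT mul1r.
  by rewrite indicE sT mul1r.
Qed.

End bounded_variation.

Lemma bounded_variation_nd g : (forall s t, 0 <= s -> s <= t -> t <= T -> g s <= g t) ->
  bounded_variation 0 T g.
Proof.
move=> ndg; apply: nondecreasing_bounded_variation => s t.
by rewrite !in_itv/= => /andP[s0 sT] /andP[t0 tT] st; exact: ndg.
Qed.

(** Links the expectations that define the dual projection of <M>, written with the Jordan
    decomposition, to mu, built from [stieltjes]. *)
Lemma bv_integral_nd g phi :
  (forall s t, 0 <= s -> s <= t -> t <= T -> g s <= g t) ->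
  (forall t, 0 <= t < T -> g r @[r --> t^'+] --> g t) ->
  bounded_borel phi -> bv_integral T phi g T = \int[stieltjes T g]_(s in `]0, T]) phi s.
Proof.
move=> ndg rcg; apply: (@bv_integralE g rcg (bounded_variation_nd ndg)
    (fun psi => \int[stieltjes T g]_(s in `]0, T]) psi s)).
- by apply: Rintegral_functional1; rewrite ?stieltjes_itv// ?ltry// ltW.
- by move=> psi; apply: eq_Rintegral => s sT; rewrite indicE sT mul1r.
- by move=> t tT; exact: Rintegral_stieltjes_itv.
Qed.

Lemma bv_integral_density (m : {measure set mR -> \bar R}) z phi :
  m.-integrable `]0, T] (EFin \o z) -> bounded_borel phi ->
  bv_integral T phi (fun t => \int[m]_(s in `]0, t]) z s) T =
  \int[m]_(s in `]0, T]) (phi s * z s).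
Proof.
move=> iz; have mD : measurable (`]0, T]%classic : set mR) by exact: measurable_itv.
have mz : measurable_fun `]0, T] z by apply/measurable_EFinP; exact: measurable_int iz.
have LamI := Rintegral_functional mD iz.
set Lam := fun _ => _ in LamI; set g := fun _ => _.
have gE t : t <= T -> g t = Lam \1_(`]0, t]%classic) by move=> tT; exact: Rintegral_itvE.
apply: (@bv_integralE g _ _ Lam) => //.
- move=> t /andP[t0 tT]; rewrite gE ?(ltW tT)//.
  apply: cvg_trans; last exact: (@integral_functional_rc _ Lam t LamI).
  apply: near_eq_cvg; near=> r.
  by rewrite -gE//; near: r; exact: nbhs_right_le.
(* Bounded variation of g comes from the positive and negative parts of z, whose integrals are
   nondecreasing in t. *)
- have part (h : mR -> R) : (forall s, 0 <= h s) -> m.-integrable `]0, T] (EFin \o h) ->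
      bounded_variation 0 T (fun t => \int[m]_(s in `]0, t]) h s).
    move=> h0 ih; apply: bounded_variation_nd => s t s0 st tT.
    rewrite !(@Rintegral_itvE _ m h _ T)// ?(le_trans st)//.
    apply: le_Rintegral => //;
      [exact: (integrable_bounded_borelM mD ih (bounded_borel_indic (measurable_itv _)))..|].
    move=> r _; apply: ler_wpM2r => //; rewrite !indicE !mem_itv_set !in_itv/= ler_nat.
    by have [r0|] := ltP 0 r => //=; have [rs|//] := leP r s; rewrite (le_trans rs st).
  have ip : m.-integrable `]0, T] (EFin \o (fun s => Num.max (z s) 0)).
    apply: le_integrable iz => //; first by apply/measurable_EFinP; exact: measurable_maxr.
    by move=> s _ /=; rewrite lee_fin; case: (leP (z s) 0) => ?; rewrite ?normr0.
  have im : m.-integrable `]0, T] (EFin \o (fun s => Num.max (- z s) 0)).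
    apply: le_integrable iz => //.
      by apply/measurable_EFinP; apply: measurable_maxr => //; exact: measurableT_comp.
    by move=> s _ /=; rewrite lee_fin; case: (leP (- z s) 0) => ?; rewrite ?normr0 ?normrN.
  pose p (t : R) := \int[m]_(s in `]0, t]) Num.max (z s) 0.
  pose q (t : R) := \int[m]_(s in `]0, t]) Num.max (- z s) 0.
  have pqE t : 0 <= t <= T -> g t = p t - q t.
    move=> /andP[t0 tT]; have Dt : (`]0, t]%classic : set mR) `<=` `]0, T]%classic.
      by move=> s /=; rewrite !in_itv/= => /andP[-> st]; exact: le_trans tT.
    have mt : measurable (`]0, t]%classic : set mR) by exact: measurable_itv.
    rewrite /p /q -RintegralB//; [|exact: integrableS ip|exact: integrableS im].
    by apply: eq_Rintegral => s _; case: (leP (z s) 0); case: (leP (- z s) 0) => *; lra.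
  (* The identity g = p - q is known on [0, T] only; the remainder vanishes there and is therefore
     nondecreasing on [0, T]. *)
  have -> : g = (p \- q) \+ (g \- (p \- q)) by apply/funext => t /=; ring.
  apply: bounded_variationD => //.
    rewrite (_ : p \- q = p \+ (\- q))//; apply: bounded_variationD => //.
      by apply: part ip => s; rewrite le_max lexx orbT.
    by apply: bounded_variationN; apply: part im => s; rewrite le_max lexx orbT.
  apply: bounded_variation_nd => s t s0 st tT /=.
  by rewrite !pqE ?subrr// ?s0 ?(le_trans st)// tT (le_trans s0).
- by move=> psi; apply: eq_Rintegral => s sT; rewrite indicE sT mul1r.
- move=> t /andP[t0 tT]; rewrite -gE// [X in _ - X](_ : _ = 0) ?subr0//.
  by rewrite /g set_itv_ge ?Rintegral_set0// bnd_simp ltxx.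
Unshelve. all: by end_near. Qed.

End pathwise.

(** * Dual projections *)

Lemma eq_bv_integral {R : realType} (T : R) (phi psi g : R -> R) :
  (forall s, 0 < s <= T -> phi s = psi s) -> bv_integral T phi g T = bv_integral T psi g T.
Proof.
by move=> pp; rewrite /bv_integral; congr (_ - _); apply: eq_Rintegral => s;
  rewrite inE/= in_itv/=; exact: pp.
Qed.

(** Associativity for dh = z dg, where z is integrable for both variation measures of g but possibly
    unbounded: psi -> integral of psi z dg is an integral functional with distribution function
    h. *)
Lemma bv_integral_bv_density {R : realType} (T : R) (T0 : 0 < T) (g h z phi : R -> R) :
  (forall t, 0 <= t < T -> h r @[r --> t^'+] --> h t) -> bounded_variation 0 T h ->
  h 0 = 0 -> bv_integrable T z g ->
  (forall t, 0 <= t <= T -> h t = bv_integral T z g t) ->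
  bounded_borel (phi : measurableTypeR R -> R) ->
  bv_integral T phi h T = bv_integral T (fun s => phi s * z s) g T.
Proof.
move=> rch bvh h0 [ip im] hE bphi.
have mD : measurable (`]0, T]%classic : set (measurableTypeR R)) by exact: measurable_itv.
apply: (bv_integralE T0 rch bvh (Lam := fun psi =>
  bv_integral T (fun s => psi s * z s) g T)) => //.
- by apply: integral_functionalB; exact: Rintegral_functional.
- move=> psi; apply: eq_bv_integral => s sT.
  by rewrite indicE mem_itv_set in_itv/= sT mul1r.
- move=> t /andP[t0 tT]; rewrite h0 subr0 hE ?t0// /bv_integral.
  by rewrite !(Rintegral_itvE _ _ tT).
Qed.

Section dual_projection.
Context {R : realType} {d : measure_display} {Omega : measurableType d}.
Variables (P : probability Omega R) (T : R) (T0 : 0 < T).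
Variables (F H : filtration R Omega).
Hypotheses (uF : usual_conditions P T F) (uH : usual_conditions P T H).
Hypothesis H_sub_F : forall t, 0 <= t <= T -> H t `<=` F t.
Variables (M qM : process R Omega).
Hypothesis martM : square_integrable_martingale P T F M.
Hypothesis qvM : is_predictable_quadratic_variation P T F M qM.
Local Notation mR := (measurableTypeR R).
Local Notation mu := (dPqv T0 martM qvM).
Implicit Types (phi : process R Omega).

Lemma predictable_sub phi : predictable T H phi -> predictable T F phi.
Proof.
move=> Hphi B mB; apply: sub_sigma_algebra2 (Hphi B mB).
move=> C [[A HA ->]|[s [t [A [s0 st tT HA ->]]]]].
  by left; exists A => //; apply: H_sub_F HA; rewrite lexx ltW.
right; exists s, t, A; split=> //.
by apply: H_sub_F HA; rewrite s0 (le_trans (ltW st)).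
Qed.

Lemma uncurried_le phi (K : R) : (forall t w, 0 <= t <= T -> `|phi t w| <= K) ->
  forall z : Omega * mR, `|uncurried T phi z| <= `|K|.
Proof.
move=> phiK [w s]; rewrite /uncurried indicE mem_itv_set in_itv/=.
have [/andP[s0 sT]|_] := boolP (0 < s <= T); last by rewrite mul0r normr0.
by rewrite mul1r (le_trans (phiK _ _ _))// ?(ltW s0)// ler_norm.
Qed.

Lemma uncurried_slice phi w : predictable T F phi ->
  measurable_fun setT (fun s : mR => uncurried T phi (w, s)).
Proof.
by move=> pphi; apply: measurableT_comp (measurable_uncurried T0 uF pphi) _; exact: measurable_pair1.
Qed.

Lemma bounded_borel_slice phi w (K : R) : predictable T F phi ->
  (forall t w, 0 <= t <= T -> `|phi t w| <= K) ->
  bounded_borel (fun s : mR => uncurried T phi (w, s)).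
Proof.
move=> pphi phiK; split; first exact: uncurried_slice.
by exists `|K| => s; exact: uncurried_le.
Qed.

Lemma uncurried_bnd_sqi phi (K : R) : predictable T F phi ->
  (forall t w, 0 <= t <= T -> `|phi t w| <= K) -> sqi mu (uncurried T phi).
Proof.
move=> pphi phiK; apply: (@sqi_bnd _ _ _ mu _ `|K|); first exact: dPqv_fin.
  exact: (measurable_uncurried T0 uF pphi).
exact: uncurried_le.
Qed.

Lemma bv_integral_uncurried phi (g : R -> R) w :
  bv_integral T (phi ^~ w) g T = bv_integral T (fun s : mR => uncurried T phi (w, s)) g T.
Proof. by apply: eq_bv_integral => s sT; rewrite uncurried_in. Qed.

Lemma expectation_bv_qv phi (K : R) : predictable T F phi ->
  (forall t w, 0 <= t <= T -> `|phi t w| <= K) ->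
  ('E_P[(fun w => bv_integral T (phi ^~ w) (qM ^~ w) T)%R])%E =
  (\int[mu]_z uncurried T phi z)%:E.
Proof.
move=> pphi phiK.
have ip : intble mu (uncurried T phi).
  by apply: intble_of_sqi; [exact: dPqv_fin|exact: uncurried_bnd_sqi phiK].
have [_ <-] := Rintegral_qvP ip.
rewrite unlock; apply: eq_integral => w _; congr (_%:E).
rewrite bv_integral_uncurried bv_integral_nd//; last exact: bounded_borel_slice phiK.
  exact: qv_nd qvM w.
by have [] := qv_cadlag qvM w.
Qed.

(** Square integrability of z for the finite measure mu makes almost every path of z integrable for
    d<M>. On those paths the indefinite integral has bounded variation and density z; the others
    form a null set. *)
Lemma expectation_bv_qv_integral phi z (K : R) : predictable T F phi ->
  (forall t w, 0 <= t <= T -> `|phi t w| <= K) -> sqi mu (uncurried T z) ->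
  ('E_P[(fun w => bv_integral T (phi ^~ w) (qv_integral T qM z ^~ w) T)%R])%E =
  (\int[mu]_u (uncurried T phi u * uncurried T z u))%:E.
Proof.
move=> pphi phiK sz.
have iz : intble mu (uncurried T z) by apply: intble_of_sqi sz; exact: dPqv_fin.
have ip : intble mu (fun u => uncurried T phi u * uncurried T z u).
  exact: sqi_M (uncurried_bnd_sqi pphi phiK) sz.
have [_ <-] := Rintegral_qvP ip; have [iw _] := Rintegral_qvP iz.
rewrite unlock; apply: ae_eq_integral_nonmeas.
apply: filterS iw => w iw; congr (_%:E).
have iw' : (qv_measure T qM w).-integrable `]0, T] (EFin \o (z ^~ w)).
  apply: eq_integrable iw => // s; rewrite inE/= in_itv/= => sT.
  by rewrite /= uncurried_in.
rewrite bv_integral_uncurried bv_integral_density//; last exact: bounded_borel_slice phiK.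
apply: eq_Rintegral => s; rewrite inE/= in_itv/= => sT.
by rewrite (uncurried_in z w sT).
Qed.

Variables (Zt LH qMH Z : process R Omega).
Hypothesis sZt : sqi mu (uncurried T Zt).
Hypothesis LH_proj : is_dual_projection P T H (qv_integral T qM Zt) LH.
Hypothesis qMH_proj : is_dual_projection P T H qM qMH.
Hypothesis Z_density : is_density P T H LH qMH Z.

(* E int phi dL = E int phi dL^H = E int phi Z d<M>^H = E int phi Z d<M> *)
Lemma Rintegral_density_bounded phi (K K' : R) : predictable T H phi ->
  (forall t w, 0 <= t <= T -> `|phi t w| <= K) ->
  (forall t w, 0 <= t <= T -> `|phi t w * Z t w| <= K') ->
  \int[mu]_u (uncurried T phi u * uncurried T Zt u) =
  \int[mu]_u (uncurried T phi u * uncurried T Z u).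
Proof.
move=> pphi phiK phiZK; have [pZ aeZ] := Z_density.
have pphiZ := predictableM T0 uH pphi pZ.
have pphi' := predictable_sub pphi.
apply: EFin_inj.
rewrite -(expectation_bv_qv_integral pphi' phiK sZt).
have [_ cLH [bvLH _] LH0 <-] := LH_proj => //; last by exists K.
have [_ _ _ _ EqM] := qMH_proj.
have -> : (\int[mu]_u (uncurried T phi u * uncurried T Z u)) =
    \int[mu]_u uncurried T (fun t w => phi t w * Z t w) u.
  apply: eq_Rintegral => -[w s] _; rewrite /uncurried/= indicE.
  by case: (s \in _); rewrite ?mul1r ?mul0r.
rewrite -(expectation_bv_qv (predictable_sub pphiZ) phiZK).
(* The product phi Z is H-predictable and bounded, hence a test process for the projection of <M>;
   this is where the second bound is used. *)
transitivity ('E_P[(fun w => bv_integral T (fun t => phi t w * Z t w)%R (qMH ^~ w) T)%R])%E; last first.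
  exact: (EqM _ pphiZ (ex_intro _ K' phiZK)).
rewrite unlock; apply: ae_eq_integral_nonmeas.
apply: filterS aeZ => w [iZ LE]; apply: (congr1 EFin).
rewrite bv_integral_uncurried (@bv_integral_bv_density _ _ T0 (qMH ^~ w) _ (Z ^~ w))//.
- by apply: eq_bv_integral => s sT; rewrite uncurried_in.
- by have [] := cLH w.
- exact: bounded_borel_slice phiK.
Qed.

(** The cut-off factor and not the truncated value: as a Borel function it can be composed with Z
    and with psi separately. *)
Let trunc (n : nat) (x : R) : R := \1_(`[- n%:R, n%:R]%classic : set R) x.

Let predictable_trunc X n : predictable T H X -> predictable T H (fun t w => trunc n (X t w)).
Proof.
move=> pX; apply: (predictable_comp T0 uH (h := trunc n) _ pX).
by apply: measurable_indic; exact: measurable_itv.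
Qed.

Let truncE n x : trunc n x = (`|x| <= n%:R)%R%:R.
Proof. by rewrite /trunc indicE mem_itv_set in_itv/= -ler_norml. Qed.

Let trunc_le1 n x : `|trunc n x| <= 1.
Proof. by rewrite truncE normr_nat lern1 leq_b1. Qed.

Let trunc_le n x : `|trunc n x * x| <= n%:R.
Proof. by rewrite truncE; case: (leP `|x|) => h; rewrite ?mul1r// mul0r normr0. Qed.

Let nearT_trunc (x : R) : \forall n \near \oo, `|x| <= n%:R.
Proof.
exists (Num.trunc `|x|).+1 => // n /= xn.
have /andP[_ /ltW h] := truncn_itv (normr_ge0 x).
by apply: le_trans h _; rewrite ler_nat.
Qed.

Lemma density_sqi : sqi mu (uncurried T Z).
Proof.
have [pZ _] := Z_density.
pose f n : process R Omega := fun t w => trunc n (Z t w) * Z t w.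
have pf n : predictable T H (f n) by exact: (predictableM T0 uH (predictable_trunc n pZ) pZ).
have fn n t w : 0 <= t <= T -> `|f n t w| <= n%:R by move=> _; exact: trunc_le.
have sf n := uncurried_bnd_sqi (predictable_sub (pf n)) (fn n).
(* f n is either Z or 0, so f n Z is the square of f n, bounded by n^2; the duality with phi = f n
   then applies. *)
have E n : nsq mu (uncurried T (f n)) =
    \int[mu]_u (uncurried T (f n) u * uncurried T Zt u).
  rewrite (@Rintegral_density_bounded (f n) n%:R (n%:R * n%:R) (pf n) (fn n)); last first.
    move=> t w tT; rewrite /f truncE; case: (leP `|Z t w|) => h; last first.
      by rewrite !mul0r normr0 mulr_ge0.
    by rewrite mul1r normrM ler_pM.
  apply: eq_Rintegral => -[w s] _; rewrite /uncurried/= /f truncE.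
  by case: (_ <= _); rewrite ?mul1r ?expr2// !(mul0r, mulr0).
apply: (proj1 (@L2_fatou _ _ _ mu (fun n => uncurried T (f n)) _ (nsq mu (uncurried T Zt)) sf _ _)).
- move=> [w s]; apply: cvg_near_cst; apply: filterS (nearT_trunc (Z s w)) => n h.
  by rewrite /uncurried/= /f truncE h mul1r.
(* Cauchy-Schwarz bounds the square of nsq (f n) by nsq (f n) times nsq Zt; a common factor is
   cancelled unless it is 0. *)
- move=> n; have := cauchy_schwarz (sf n) sZt; rewrite -E.
  have [->|n0] := eqVneq (nsq mu (uncurried T (f n))) 0; first by rewrite nsq_ge0.
  by rewrite expr2 ler_pM2l// lt0r n0 nsq_ge0.
Qed.

Lemma Rintegral_density psi : predictable T H psi -> sqi mu (uncurried T psi) ->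
  \int[mu]_u (uncurried T Zt u * uncurried T psi u) =
  \int[mu]_u (uncurried T Z u * uncurried T psi u).
Proof.
move=> ppsi spsi; have [pZ _] := Z_density; have sZ := density_sqi.
(* The cut |psi| <= n makes f n bounded and the cut |Z| <= n makes f n Z bounded, as the duality
   demands. Both cuts disappear in the limit because Z is already known to be in L^2(mu). *)
pose f n : process R Omega := fun t w => trunc n (Z t w) * (trunc n (psi t w) * psi t w).
have pf n : predictable T H (f n).
  apply: (predictableM T0 uH (predictable_trunc n pZ)).
  exact: (predictableM T0 uH (predictable_trunc n ppsi) ppsi).
have fn n t w : 0 <= t <= T -> `|f n t w| <= n%:R.
  by move=> _; rewrite normrM -[leRHS]mul1r ler_pM.
have sf n := uncurried_bnd_sqi (predictable_sub (pf n)) (fn n).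
pose A n := [set u : Omega * mR | `|uncurried T Z u| <= n%:R] `&`
            [set u : Omega * mR | `|uncurried T psi u| <= n%:R].
have fA n : uncurried T (f n) = fun u => \1_(A n) u * uncurried T psi u.
  apply/funext => -[w s]; rewrite /uncurried/= /f !truncE.
  have [sT|sT] := boolP (s \in (`]0, T]%classic : set R)); last first.
    by rewrite indicE (negbTE sT) !mul0r mulr0.
  rewrite [\1_(`]0, T]%classic) s]indicE sT !mul1r mulrA -natrM mulnb; congr (_%:R * _).
  rewrite [RHS]/(nat_of_bool _); congr nat_of_bool; apply/idP/idP.
    by move=> /andP[h1 h2]; apply/mem_set; split; rewrite /= /uncurried/= indicE sT mul1r.
  by move=> /set_mem[]; rewrite /= /uncurried/= indicE sT !mul1r => -> ->.
have mle (X : Omega * mR -> R) (n : nat) : measurable_fun setT X ->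
    measurable [set u | `|X u| <= n%:R].
  move=> mX; rewrite (_ : [set u | _] = setT `&` X @^-1` `[- n%:R, n%:R]%classic).
    by apply: mX => //; exact: measurable_itv.
  by apply/seteqP; split=> u /=; rewrite in_itv/= -ler_norml; [|case].
have mA n : measurable (A n) by apply: measurableI; apply: mle; [case: sZ|case: spsi].
have nearA u : \forall n \near \oo, A n u.
  by apply: filterS2 (nearT_trunc (uncurried T Z u)) (nearT_trunc (uncurried T psi u)).
have c : nsq mu (fun u => uncurried T (f n) u - uncurried T psi u) @[n --> \oo] --> 0.
  rewrite (funext (fun n => congr1 (fun g => nsq mu (fun u => g u - uncurried T psi u)) (fA n))).
  exact: nsq_trunc_cvg.
have c0 (X : Omega * mR -> R) : nsq mu (fun u => X u - X u) @[n --> \oo] --> 0.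
  by rewrite nsq_subrr; exact: cvg_cst.
have h1 := L2_cvg (fun=> sZt) sf sZt spsi (c0 _) c.
have h2 := L2_cvg (fun=> sZ) sf sZ spsi (c0 _) c.
have E n : \int[mu]_u (uncurried T Zt u * uncurried T (f n) u) =
    \int[mu]_u (uncurried T Z u * uncurried T (f n) u).
  under eq_Rintegral do rewrite mulrC; under [in RHS]eq_Rintegral do rewrite mulrC.
  apply: (@Rintegral_density_bounded (f n) n%:R (n%:R * n%:R) (pf n) (fn n)).
  move=> t w tT; rewrite (_ : f n t w * Z t w = trunc n (psi t w) * psi t w * (trunc n (Z t w) * Z t w)).
    by rewrite normrM ler_pM.
  by rewrite /f; ring.
by rewrite (funext E) in h1; exact: (cvg_unique _ h1 h2).
Qed.

End dual_projection.

(** * From complete to partial information *)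

Theorem proposition2p16
  (R : realType) (d : measure_display) (Omega : measurableType d)
  (P : probability Omega R) (T : R) (T_gt0 : 0 < T)
  (F H : filtration R Omega)
  (usualF : usual_conditions P T F) (usualH : usual_conditions P T H)
  (F_T : F T = measurable)
  (H_sub_F : forall t, 0 <= t <= T -> H t `<=` F t)
  (M qM : process R Omega)
  (martM : square_integrable_martingale P T F M)
  (qvM : is_predictable_quadratic_variation P T F M qM)
  (xi : Omega -> R) (xi_meas : measurable_fun setT xi)
  (xi_L2 : ('E_P[(fun w => (xi w) ^+ 2)%R] < +oo)%E)
  (f : Omega -> R -> R -> R)
  (f_pred : forall y : R, predictable T F (fun t w => f w t y))
  (Yt Zt Ot : process R Omega)
  (sol : solution_complete_info P T F M qM xi f Yt Zt Ot)
  (LH qMH Z : process R Omega)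
  (LH_proj : is_dual_projection P T H (qv_integral T qM Zt) LH)
  (qMH_proj : is_dual_projection P T H qM qMH)
  (Z_density : is_density P T H LH qMH Z) :
  let B := stochastic_integral P T F M qM (fun t w => Zt t w - Z t w) in
  [/\ square_integrable_martingale P T F B,
      weakly_orthogonal P T F H M qM B
    & solution_partial_info P T F H M qM xi f Yt Z
        (fun t w => Ot t w + B t w)].
Proof.
move=> B; have [S2Y [pZt M2Zt] L2O bsdeY orthO] := sol.
have TT : 0 <= T <= T by rewrite lexx ltW.
have sZt := M2_sqi T_gt0 usualF martM qvM pZt M2Zt.
have pZ := predictable_sub T_gt0 H_sub_F Z_density.1.
have sZ := density_sqi usualF usualH H_sub_F sZt LH_proj qMH_proj Z_density.
have pD := predictableB T_gt0 usualF pZt pZ.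
have uD : uncurried T (fun t w => Zt t w - Z t w) =
    (fun u => uncurried T Zt u - uncurried T Z u).
  by apply/funext => u; rewrite /uncurried mulrBr.
have sD : sqi (dPqv T_gt0 martM qvM) (uncurried T (fun t w => Zt t w - Z t w)).
  by rewrite uD; exact: sqiB.
have iB : is_stochastic_integral P T F M qM (fun t w => Zt t w - Z t w) B.
  exact: (stochastic_integralP usualF pD sD).
have [mB B0 _] := iB.
have sB := sqmart_sqi mB TT.
have orthB phi N : predictable T H phi -> sqi (dPqv T_gt0 martM qvM) (uncurried T phi) ->
    is_stochastic_integral P T F M qM phi N -> \int[P]_w (B T w * N T w) = 0.
  move=> pphi sphi iN; rewrite (ito_isometry usualF sD sphi iB iN) uD.
  under eq_Rintegral do rewrite mulrBl.
  rewrite RintegralB//; [|exact: sqi_M..].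
  by rewrite (Rintegral_density usualF usualH H_sub_F sZt LH_proj qMH_proj Z_density pphi sphi) subrr.
have [mO O0 EO] := L2O.
have sO : sqi P (Ot T) by split; [exact: mart_measurable mO TT|rewrite unlock in EO].
have mO2 : square_integrable_martingale P T F Ot.
  (* [in_L2] bounds the second moment at T only; the other times follow by [mart_sqi]. *)
  split=> // t tT; have [[_ st] _] := mart_sqi usualF mO sO tT.
  by rewrite unlock.
have mOB : square_integrable_martingale P T F (fun t w => Ot t w + B t w).
  have := sqmart_lin usualF 1 mO2 mB.
  by congr (square_integrable_martingale P T F _); apply/funext => t; apply/funext => w; rewrite mul1r.
(* Passes from the chosen version in the definition of weak orthogonality to arbitrary versions, and
   from extended to real expectations. *)
have weak X : sqi P (X T) -> (forall phi N, predictable T H phi ->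
    sqi (dPqv T_gt0 martM qvM) (uncurried T phi) ->
    is_stochastic_integral P T F M qM phi N -> \int[P]_w (X T w * N T w) = 0) ->
    weakly_orthogonal P T F H M qM X.
  move=> sX HX phi [pphi M2phi].
  have pphi' := predictable_sub T_gt0 H_sub_F pphi.
  have sphi := M2_sqi T_gt0 usualF martM qvM pphi' M2phi.
  have iN := stochastic_integralP usualF pphi' sphi.
  have [mN _ _] := iN; have sN := sqmart_sqi mN TT.
  by rewrite unlock -EFin_Rintegral ?(HX _ _ pphi sphi iN)//; exact: sqi_M.
split; [exact: mB|exact: weak|split; first exact: S2Y].
- by split; [exact: Z_density.1|exact: (sqi_M2 pZ sZ)].
- split; first exact: mOB.1.
    by apply: filterS O0 => w ->; rewrite B0 addr0.
  exact: mOB.2.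
- have iZt := stochastic_integralP usualF pZt sZt.
  have iZ := stochastic_integralP usualF pZ sZ.
  (* Linearity of the chosen integrals holds for all t off one null set, which is joined to the
     exceptional set of the given equation. *)
  apply: filterS2 bsdeY (stochastic_integralB usualF pZt pZ sZt sZ iZt iZ iB).
  have rearrange (x i a b c e o o' bT bt : R) : bT = a - c -> bt = b - e ->
      x + i - (a - b) - (o - o') = x + i - (c - e) - (o + bT - (o' + bt)).
    by move=> -> ->; ring.
  move=> w [iY YE] BE; split=> // t tT.
  exact: (etrans (YE t tT) (rearrange _ _ _ _ _ _ _ _ _ _ (BE T TT) (BE t tT))).
(* [Ot] is orthogonal to the integrals of all integrands in M^2_F, B only to those of M^2_H; the sum
   keeps the weaker property. *)
- apply: weak; first exact: sqmart_sqi mOB TT.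
  move=> phi N pphi sphi iN.
  have [mN _ _] := iN; have sN := sqmart_sqi mN TT.
  under eq_Rintegral do rewrite mulrDl.
  rewrite RintegralD//; [|exact: sqi_M..].
  by rewrite (strongly_orthogonal_integral usualF mO2 orthO sphi iN) (orthB _ _ pphi sphi iN) addr0.
Qed.
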